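(* Let $p\ge 0$ be an integer (arbitrary polynomial degree). Consider the linear advection problem $$u_t+\langle \beta,\nabla u\rangle=0 \ \text{in } \Omega\times(0,T),\qquad u=g \ \text{on } \partial\Omega^{\mathrm{in}}\times(0,T),\qquad u=u_0\ \text{on } \Omega\times\{t=0\},$$ on the ramp domain $\Omega\subset\widehat\Omega\subset\mathbb{R}^2$ described in the context, with constant velocity field $\beta=(\beta_1,\beta_2)^T$ parallel to the ramp. Suppose that the solution $u$ has compact support inside $\widehat\Omega$ during the considered time interval $(0,T)$ and that $\operatorname{supp}(u)\cap(\partial\Omega^{\mathrm{in}}\cup\partial\Omega^{\mathrm{out}})=\emptyset$ (so that in particular $g=0$). Let $u_h(t)$, with $u_h(t)\in\mathcal{V}_h^p(\mathcal{M}_h)$ for every fixed $t$, be the solution of the stabilized semi-discrete problem $$\left(d_tu_h(t),w_h\right)_{L^2}+a_h^{\mathrm{upw}}(u_h(t),w_h)+J_h(u_h(t),w_h)+l_h(w_h)=0\qquad\text{for all } w_h\in\mathcal{V}_h^p(\mathcal{M}_h),$$ where $a_h^{\mathrm{upw}}$, $J_h$ and $l_h$ are the forms defined in the context. Then for all $t\in(0,T)$ $$\|u_h(t)\|_{L^2(\Omega)}\le\|u_h(0)\|_{L^2(\Omega)}.$$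
   Context: **Domain and mesh.** $\widehat\Omega\subset\mathbb{R}^2$ is an open axis-parallel rectangle with a structured Cartesian background mesh $\widehat{\mathcal{M}}_h$ of closed rectangular cells. The ramp is the straight line starting at a point of the bottom side of $\widehat\Omega$ and rising to the right with angle $\gamma\in(0,\pi/2)$ to the horizontal. $\Omega\subset\widehat\Omega$ is the open connected part of $\widehat\Omega$ lying above/left of the ramp (the region below the ramp is cut out). The cut cell mesh $\mathcal{M}_h$ consists of all cells $E=\widehat E\cap\overline\Omega$, $\widehat E\in\widehat{\mathcal{M}}_h$, with nonempty interior; cells cut by the ramp are called cut cells. $|E|$ is the area of a cell and $|e|$ the length of an edge. The sets of internal and external faces are $$\Gamma_{\mathrm{int}}=\{e=\partial E_1\cap\partial E_2 : E_1,E_2\in\mathcal{M}_h,\ E_1\ne E_2,\ |e|>0\},\qquad \Gamma_{\mathrm{ext}}=\{e=\partial E\cap\partial\Omega : E\in\mathcal{M}_h,\ |e|>0\}.$$ **Velocity and boundary parts.** $\beta\in\mathbb{R}^2$ is a constant nonzero vector parallel to the ramp, $\langle\cdot,\cdot\rangle$ is the Euclidean scalar product and $n$ the outer unit normal on $\partial\Omega$. $\partial\Omega^{\mathrm{in}}=\{x\in\partial\Omega:\langle\beta,n(x)\rangle<0\}$ and $\partial\Omega^{\mathrm{out}}=\{x\in\partial\Omega:\langle\beta,n(x)\rangle>0\}$. Since $\beta$ is parallel to the ramp, $\langle\beta,n\rangle=0$ on the ramp. **Discrete space, averages, jumps.** $\mathcal{V}_h^p(\mathcal{M}_h)=\{v_h\in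 L^2(\Omega): v_h|_E\in P^p(E)\ \forall E\in\mathcal{M}_h\}$, with $P^p$ the bivariate polynomials of degree at most $p$. $(\cdot,\cdot)_{L^2}$ is the $L^2(\Omega)$ scalar product, and $\nabla_h$ is the cellwise gradient. On an internal face $e=\partial E_1\cap\partial E_2$, with $n_{E_i}$ the outer unit normal of $E_i$, let $$\{\!\{u_h\}\!\}=\tfrac12\left(u_h|_{E_1}+u_h|_{E_2}\right),\qquad [\![u_h]\!]=u_h|_{E_1}n_{E_1}+u_h|_{E_2}n_{E_2}$$ (scalar average, vector-valued jump). For $x\in\mathbb{R}$: $x^\ominus=\frac{|x|-x}{2}$ and $x^\oplus=\frac{|x|+x}{2}$. $n_e$ denotes a unit normal of the face $e$ of arbitrary fixed orientation. **Unstabilized forms.** $$a_h^{\mathrm{upw}}(u_h,w_h)=-\sum_{E\in\mathcal{M}_h}\int_E u_h\langle\beta,\nabla_hw_h\rangle\,dx+\sum_{e\in\Gamma_{\mathrm{ext}}}\int_e\langle\beta,n\rangle^\oplus u_hw_h\,ds+\sum_{e\in\Gamma_{\mathrm{int}}}\int_e\left(\{\!\{u_h\}\!\}\langle\beta,[\![w_h]\!]\rangle+\tfrac12|\langle\beta,n_e\rangle|\,\langle[\![u_h]\!],[\![w_h]\!]\rangle\right)ds,$$ $$l_h(w_h)=-\sum_{e\in\Gamma_{\mathrm{ext}}}\int_e\langle\beta,n\rangle^\ominus\, g\,w_h\,ds.$$ **Stabilization.** $\mathcal{I}\subset\mathcal{M}_h$ is the set of small cut cells that are stabilized; all of its elements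 are triangular cut cells. Each $E\in\mathcal{I}$ has three edges: a boundary edge on the ramp (no flow), an inflow edge $e_{\mathrm{in}}$, on which $\langle\beta,n_E\rangle<0$, and an outflow edge $e_{\mathrm{out}}$, the remaining edge, on which $\langle\beta,n_E\rangle\ge0$. The edges $e_{\mathrm{in}}$ and $e_{\mathrm{out}}$ are internal faces, shared with a uniquely defined inflow neighbor $E_{\mathrm{in}}\in\mathcal{M}_h$ and outflow neighbor $E_{\mathrm{out}}\in\mathcal{M}_h$, respectively (these depend on $E$). For $E'\in\mathcal{M}_h$, the extension operator $\mathcal{L}^{\mathrm{ext}}_{E'}$ maps $u_h\in\mathcal{V}_h^p(\mathcal{M}_h)$ to the polynomial $u_h|_{E'}$ evaluated on all of $\Omega$ (also outside $E'$, in particular on $\overline E$); likewise $\mathcal{L}^{\mathrm{ext}}_{E'}(\nabla w_h)$ is the gradient of the polynomial $w_h|_{E'}$ so extended. Set $$J_h(u_h,w_h)=\sum_{E\in\mathcal{I}}\left(J_h^{0,E}(u_h,w_h)+J_h^{1,E}(u_h,w_h)\right),$$ $$J_h^{0,E}(u_h,w_h)=\eta_E\int_{e_{\mathrm{out}}}\left(\mathcal{L}^{\mathrm{ext}}_{E_{\mathrm{in}}}(u_h)-u_h|_E\right)\langle\beta,[\![w_h]\!]\rangle\,ds,$$ $$J_h^{1,E}(u_h,w_h)=\eta_E\int_E\left(\mathcal{L}^{\mathrm{ext}}_{E_{\mathrm{in}}}(u_h)-u_h\right)\langle\beta,\mathcal{L}^{\mathrm{ext}}_{E_{\mathrm{in}}}(\nabla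 w_h)-\nabla w_h\rangle\,dx.$$ The stabilization parameter is $\eta_E=1-\alpha_{E,1/(2p+1)}$, where for $\omega\in(0,1]$ the capacity of $E$ is $$\alpha_{E,\omega}=\min\left(\omega\,\frac{|E|}{\Delta t\int_{\partial E}\langle\beta,n_E\rangle^\ominus\,ds},\,1\right),$$ with $\Delta t>0$ a fixed time step parameter; hence $0\le\eta_E\le1$. *)

(* Defs.v *)
From HB Require Import structures.
From mathcomp Require Import all_boot all_order all_algebra.
From mathcomp Require Import all_classical all_reals all_analysis.

Set Implicit Arguments.
Unset Strict Implicit.
Unset Printing Implicit Defensive.

Import Order.TTheory GRing.Theory Num.Theory.
Import numFieldNormedType.Exports.

Local Open Scope classical_set_scope.
Local Open Scope ring_scope.

Section Plane.
Context {R : realType}.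

Definition dot (v w : R * R) : R := v.1 * w.1 + v.2 * w.2.

Definition pos_part (x : R) : R := (`|x| + x) / 2.
Definition neg_part (x : R) : R := (`|x| - x) / 2.

Definition area_measure :=
  ((lebesgue_measure : {measure set (measurableTypeR R) -> \bar R}) \x
   (lebesgue_measure : {measure set (measurableTypeR R) -> \bar R}))%E.

Definition bdry (A : set (R * R)) : set (R * R) := closure A `\` interior A.

Definition segment (a b : R * R) : set (R * R) :=
  [set x | exists2 s : R, 0 <= s <= 1 & x = (1 - s) *: a + s *: b].

Definition triangle (a b c : R * R) : set (R * R) :=
  [set x | exists r s t : R, [/\ 0 <= r, 0 <= s, 0 <= t, r + s + t = 1
    & x = r *: a + s *: b + t *: c]].

Definition supporting_normals (A : set (R * R)) (x : R * R) : set (R * R) :=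
  [set nu | dot nu nu = 1 /\ forall y, A y -> dot nu (y - x) <= 0].

(* Only applied to convex sets A (the domain and the mesh cells) and to
   boundary points x.  At corners, where the normal is not defined, the value
   is the null vector. *)
Definition outer_normal (A : set (R * R)) (x : R * R) : R * R :=
  xget 0 [set nu | supporting_normals A x = [set nu]].

(* Bivariate polynomials: q`_i`_j is the coefficient of x^i y^j. *)
Definition beval (q : {poly {poly R}}) (x : R * R) : R := q.[x.1%:P].[x.2].

Definition bgrad (q : {poly {poly R}}) (x : R * R) : R * R :=
  (beval q^`() x, beval (map_poly (@deriv R) q) x).

Definition total_degree_le (p : nat) (q : {poly {poly R}}) : Prop :=
  forall i j : nat, (p < i + j)%N -> q`_i`_j = 0.

End Plane.

(* The background mesh is the tensor product of the grids gx 0 < ... < gx nx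
   and gy 0 < ... < gy ny; the ramp starts at (foot, gy 0). *)
Record ramp_geometry (R : realType) := RampGeometry {
  nx : nat;
  ny : nat;
  gx : nat -> R;
  gy : nat -> R;
  foot : R;
  angle : R;
  nx_gt0 : (0 < nx)%N;
  ny_gt0 : (0 < ny)%N;
  gx_incr : forall i, (i < nx)%N -> gx i < gx i.+1;
  gy_incr : forall j, (j < ny)%N -> gy j < gy j.+1;
  foot_bottom : gx 0%N <= foot <= gx nx;
  angle_acute : 0 < angle < pi / 2
}.

Section RampMesh.
Context {R : realType} (D : ramp_geometry R).

Definition ramp_dir : R * R := (cos (angle D), sin (angle D)).

Definition ramp_foot : R * R := (foot D, gy D 0%N).

Definition ramp : set (R * R) :=
  [set x | exists2 s : R, 0 <= s & x = ramp_foot + s *: ramp_dir].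

Definition Omega_hat : set (R * R) :=
  [set x | gx D 0%N < x.1 < gx D (nx D) /\ gy D 0%N < x.2 < gy D (ny D)].

(* The part of Omega_hat strictly above/left of the ramp; being convex, it is
   connected. *)
Definition Omega : set (R * R) :=
  [set x | Omega_hat x /\
    (x.1 - foot D) * sin (angle D) < (x.2 - gy D 0%N) * cos (angle D)].

(* Background cells are indexed by their position; two distinct indices in
   [mesh] have distinct cut cells, so [mesh] also enumerates the set of cut
   cells. *)
Definition cell_id : finType := ('I_(nx D) * 'I_(ny D))%type.

Definition cell (K : cell_id) : set (R * R) :=
  [set x | gx D K.1 <= x.1 <= gx D K.1.+1 /\ gy D K.2 <= x.2 <= gy D K.2.+1]
  `&` closure Omega.

Definition mesh : {set cell_id} := [set K | `[< interior (cell K) !=set0 >]].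

(* The grid lines and the ramp line, each given by a point and a unit
   direction. *)
Definition skeleton_lines : seq ((R * R) * (R * R)) :=
  [seq ((gx D i, 0), (0, 1)) | i <- iota 0 (nx D).+1] ++
  [seq ((0, gy D j), (1, 0)) | j <- iota 0 (ny D).+1] ++
  [:: (ramp_foot, ramp_dir)].

(* Arc-length integral over a subset e of the union of the skeleton lines.
   These lines are pairwise distinct, hence meet in finitely many points, so
   that summing over the lines counts every piece of e once.  The boundaries
   of Omega and of all cells lie on the skeleton. *)
Definition arc_int (e : set (R * R)) (f : R * R -> R) : R :=
  \sum_(l <- skeleton_lines)
    \int[lebesgue_measure]_(s in [set s : R | e (l.1 + s *: l.2)])
      f (l.1 + s *: l.2).

Definition arc_length (e : set (R * R)) : R := arc_int e (fun=> 1).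

Definition area (A : set (R * R)) : R := fine (area_measure A).

Definition face (K1 K2 : cell_id) : set (R * R) :=
  bdry (cell K1) `&` bdry (cell K2).

Definition ext_face (K : cell_id) : set (R * R) := bdry (cell K) `&` bdry Omega.

Definition is_int_face (K1 K2 : cell_id) : bool :=
  [&& K1 \in mesh, K2 \in mesh, K1 != K2 & 0 < arc_length (face K1 K2)].

(* Each internal face is represented by exactly one of the two orderings of
   its pair of adjacent cells. *)
Definition Gamma_int : {set cell_id * cell_id} :=
  [set P | is_int_face P.1 P.2 & (enum_rank P.1 < enum_rank P.2)%N].

(* The external face of a cell may consist of several sides of Omega; the
   outer normal of Omega then varies along it. *)
Definition Gamma_ext : {set cell_id} :=
  [set K in mesh | 0 < arc_length (ext_face K)].

Definition normal (K : cell_id) : R * R -> R * R := outer_normal (cell K).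

Section Velocity.
Variable beta : R * R.

Definition inflow_boundary : set (R * R) :=
  [set x | bdry Omega x /\ dot beta (outer_normal Omega x) < 0].

Definition outflow_boundary : set (R * R) :=
  [set x | bdry Omega x /\ 0 < dot beta (outer_normal Omega x)].

(* A broken polynomial is given by its polynomial on every cell, which also
   provides its traces and its extension outside the cell: the extension
   operator of K maps v to beval (v K), and its gradient to bgrad (v K).
   Values at indices outside [mesh] are never used. *)
Definition broken_poly := cell_id -> {poly {poly R}}.

Definition Vh (p : nat) (v : broken_poly) : Prop :=
  forall K, K \in mesh -> total_degree_le p (v K).

(* The element of L^2(Omega) defined by v; the null set of cell boundaries is
   sent to 0. *)
Definition broken_fun (v : broken_poly) (x : R * R) : R :=
  \sum_(K in mesh) \1_(interior (cell K)) x * beval (v K) x.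

Definition L2_inner (u w : broken_poly) : R :=
  \int[area_measure]_(x in Omega) (broken_fun u x * broken_fun w x).

Definition L2_norm (u : broken_poly) : R := Num.sqrt (L2_inner u u).

Definition average (K1 K2 : cell_id) (u : broken_poly) (x : R * R) : R :=
  (beval (u K1) x + beval (u K2) x) / 2.

Definition jump (K1 K2 : cell_id) (u : broken_poly) (x : R * R) : R * R :=
  beval (u K1) x *: normal K1 x + beval (u K2) x *: normal K2 x.

Definition a_upw (u w : broken_poly) : R :=
  - (\sum_(K in mesh) \int[area_measure]_(x in cell K)
       (beval (u K) x * dot beta (bgrad (w K) x)))
  + \sum_(K in Gamma_ext) arc_int (ext_face K) (fun x =>
       pos_part (dot beta (outer_normal Omega x))
       * beval (u K) x * beval (w K) x)
  + \sum_(P in Gamma_int) arc_int (face P.1 P.2) (fun x =>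
       average P.1 P.2 u x * dot beta (jump P.1 P.2 w x)
       + 1 / 2 * `|dot beta (normal P.1 x)|
         * dot (jump P.1 P.2 u x) (jump P.1 P.2 w x)).

Definition l_h (g : R * R -> R) (w : broken_poly) : R :=
  - \sum_(K in Gamma_ext) arc_int (ext_face K) (fun x =>
      neg_part (dot beta (outer_normal Omega x)) * g x * beval (w K) x).

(* K is a triangle whose edges are ab on the ramp, the inflow edge bc shared
   with Kin and the outflow edge ca shared with Kout.  Endpoints of edges are
   excluded in the sign conditions since normals are undefined there. *)
Definition triangular_cut_cell (K Kin Kout : cell_id) : Prop :=
  exists a b c : R * R,
    [/\ cell K = triangle a b c /\ segment a b `<=` ramp,
        is_int_face K Kin /\ segment b c = face K Kin,
        is_int_face K Kout /\ segment c a = face K Kout,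
        forall x, (segment b c `\` [set b; c]) x -> dot beta (normal K x) < 0
      & forall x, (segment c a `\` [set c; a]) x -> 0 <= dot beta (normal K x)].

Definition capacity (dt omega : R) (K : cell_id) : R :=
  Num.min
    (omega * (area (cell K) /
       (dt * arc_int (bdry (cell K)) (fun x => neg_part (dot beta (normal K x))))))
    1.

Definition eta (p : nat) (dt : R) (K : cell_id) : R :=
  1 - capacity dt (1 / (2 * p + 1)%:R) K.

Definition J0 (p : nat) (dt : R) (K Kin Kout : cell_id) (u w : broken_poly) : R :=
  eta p dt K * arc_int (face K Kout) (fun x =>
    (beval (u Kin) x - beval (u K) x) * dot beta (jump K Kout w x)).

Definition J1 (p : nat) (dt : R) (K Kin : cell_id) (u w : broken_poly) : R :=
  eta p dt K * \int[area_measure]_(x in cell K)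
    ((beval (u Kin) x - beval (u K) x)
     * dot beta (bgrad (w Kin) x - bgrad (w K) x)).

Definition J_h (p : nat) (dt : R) (I : {set cell_id})
    (Ein Eout : cell_id -> cell_id) (u w : broken_poly) : R :=
  \sum_(K in I) (J0 p dt K (Ein K) (Eout K) u w + J1 p dt K (Ein K) u w).

(* Classical solution: u is a function of time and of points of the closure of
   Omega (values elsewhere are irrelevant). *)
Definition advection_solution (T : R) (g : R -> R * R -> R) (u0 : R * R -> R)
    (u : R -> R * R -> R) : Prop :=
  [/\ forall (t : R) (x : R * R), 0 < t < T -> Omega x ->
        [/\ derivable (u^~ x) t 1, derivable (u t) x (1, 0),
            derivable (u t) x (0, 1)
          & 'D_1 (u^~ x) t
            + dot beta ('D_(1, 0) (u t) x, 'D_(0, 1) (u t) x) = 0],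
      forall (t : R) (x : R * R), 0 < t < T -> inflow_boundary x -> u t x = g t x
    & forall x, Omega x -> u 0 x = u0 x].

Definition support_in_closure (v : R * R -> R) : set (R * R) :=
  closure [set x | closure Omega x /\ v x != 0].

(* Solutions are continuous at t = 0 and differentiable for 0 < t < T.
   Vh p is finite-dimensional: limits and time derivatives are those of the
   polynomial coefficients, and duh t is the time derivative of uh at t. *)
Definition semidiscrete_solution (p : nat) (dt T : R) (I : {set cell_id})
    (Ein Eout : cell_id -> cell_id) (g : R -> R * R -> R)
    (uh duh : R -> broken_poly) : Prop :=
  [/\ forall t : R, 0 <= t < T -> Vh p (uh t),
      forall K i j, K \in mesh ->
        (fun s => (uh s K)`_i`_j) @ 0^'+ --> (uh 0 K)`_i`_j,
      forall (t : R) K i j, 0 < t < T -> K \in mesh ->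
        is_derive t 1 (fun s => (uh s K)`_i`_j) ((duh t K)`_i`_j)
    & forall (t : R) w, 0 < t < T -> Vh p w ->
        L2_inner (duh t) w + a_upw (uh t) w
        + J_h p dt I Ein Eout (uh t) w + l_h (g t) w = 0].

End Velocity.
End RampMesh.

(* Main.v *)
Require Import Defs.
From mathcomp Require Import all_boot all_order all_algebra.
From mathcomp Require Import all_classical all_reals all_analysis.
From mathcomp Require Import measurable_realfun.
From mathcomp Require Import ring lra.
Set Implicit Arguments.
Unset Strict Implicit.
Unset Printing Implicit Defensive.
Import Order.TTheory GRing.Theory Num.Theory.
Import numFieldNormedType.Exports.
Local Open Scope classical_set_scope.
Local Open Scope ring_scope.

(** The scheme is dissipative: testing it with [uh t] itself gives
    [1/2 d/dt |uh|^2 = - a_upw (uh, uh) - J_h (uh, uh) - l_h uh], so it suffices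
    that the right-hand side is nonpositive.

    The data term vanishes because the exact solution, hence [g], vanishes on
    the inflow boundary ([inflow_data_vanish]).

    For the other terms write [n] for the outer normal of a cell.  The volume
    integrals are [u <beta, grad u> = 1/2 div (beta u^2)], and the divergence
    theorem on every cell ([cell_divergence_sqr]) turns them into integrals over
    the cell boundaries.  On a face between K1 and K2 the two contributions
    combine with the central flux to [1/2 |<beta,n>| (u1 - u2)^2]; on the outer
    boundary they combine with the outflow term to [1/2 |<beta,n>| u^2]; on the
    ramp they vanish since beta is parallel to it.  Similarly J1 is
    [1/2 eta] times the integral over the boundary of the small cell K of
    [<beta,n> v^2], where [v = u_in - u_K].  With [w = u_K - u_out], the total
    contribution of K is, on its outflow face,
    [eta <beta,n> (v w + v^2 / 2) = 1/2 eta <beta,n> ((v + w)^2 - w^2)], and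
    [- 1/2 eta |<beta,n>| v^2] on its inflow face.  As [eta] lies in [0,1], on
    each face this is at least minus the upwind dissipation of that face
    ([stab_term_ge]).  No face is charged twice, because two triangular cut
    cells never share a flow face: both would have their right angle at the
    same end of the face, and would coincide ([ramp_triangles_not_adjacent]).

    All this is carried out pointwise.  Integrals over parts of the skeleton are
    integrals over the whole skeleton of functions extended by zero
    ([arc_intE]), and all but finitely many points of each skeleton line lie on
    no other line.  At such a [regular] point either no cell boundary, or one
    cell boundary and that of Omega, or exactly two cell boundaries pass, with
    matching normals ([skeletonP]); in each case the density of the energy is
    visibly nonnegative ([energy_density_ge0]).

    Finally the L2 inner product is a fixed bilinear form of the polynomial
    coefficients, so that [|uh|^2] is differentiable with the expected
    derivative ([is_derive_L2_inner]) and right-continuous at the initial time;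
    being nonincreasing, it stays below its initial value. *)

(** * Bivariate polynomials *)

Section BivariatePolynomials.
Context {R : realType}.
Implicit Types (q v w : {poly {poly R}}) (x : R * R).

Lemma bevalE q x : beval q x = \sum_(i < size q) (q`_i).[x.2] * x.1 ^+ i.
Proof.
rewrite /beval (horner_coef q) horner_sum; apply: eq_bigr => i _.
by rewrite hornerM -polyC_exp hornerC.
Qed.

Lemma bevalM v w x : beval (v * w) x = beval v x * beval w x.
Proof. by rewrite /beval !hornerM. Qed.

Lemma bevalB v w x : beval (v - w) x = beval v x - beval w x.
Proof. by rewrite /beval hornerD hornerD !hornerN. Qed.

(** The formal derivative in the second variable acts on the coefficients; it is
    a derivation although [map_poly deriv] is not multiplicative. *)
Lemma map_derivM v w : map_poly (@deriv R) (v * w) =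
  map_poly (@deriv R) v * w + v * map_poly (@deriv R) w.
Proof.
apply/polyP => i; rewrite coef_map coefD !coefM raddf_sum -big_split /=.
by apply: eq_bigr => j _; rewrite derivM !coef_map.
Qed.

Lemma dot_bgradB (beta : R * R) v w x :
  dot beta (bgrad (v - w) x) = dot beta (bgrad v x - bgrad w x).
Proof. by rewrite /dot /bgrad /= derivB raddfB /= !bevalB. Qed.

Lemma dot_bgradM (beta : R * R) v w x :
  dot beta (bgrad (v * w) x) =
  beval v x * dot beta (bgrad w x) + beval w x * dot beta (bgrad v x).
Proof.
rewrite /dot /bgrad /= derivM map_derivM.
have bevalD a b : beval (a + b) x = beval a x + beval b x.
  by rewrite /beval !hornerD.
rewrite !bevalD !bevalM; ring.
Qed.

Lemma beval_horner1 q (s y : R) :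
  beval q (s, y) = (map_poly (horner_eval y) q).[s].
Proof.
rewrite bevalE (@horner_coef_wide _ (size q)); last exact: size_poly.
by apply: eq_bigr => i _; rewrite coef_map.
Qed.

Lemma is_derive_beval1 q (s y : R) :
  is_derive s 1 (fun s => beval q (s, y)) (bgrad q (s, y)).1.
Proof.
under eq_fun do rewrite beval_horner1.
by rewrite /= beval_horner1 -deriv_map; exact: is_derive_poly.
Qed.

Lemma is_derive_beval2 q (s y : R) :
  is_derive s 1 (fun s => beval q (y, s)) (bgrad q (y, s)).2.
Proof.
have -> : (bgrad q (y, s)).2 = (q.[y%:P])^`().[s].
  rewrite /= bevalE (horner_coef q) raddf_sum /= horner_sum.
  rewrite -(big_mkord predT (fun i => ((map_poly (@deriv R) q)`_i).[s] * y ^+ i)).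
  rewrite -(big_mkord predT (fun i => (q`_i * y%:P ^+ i)^`().[s])).
  rewrite [RHS](big_cat_nat (n := size (map_poly (@deriv R) q))) //=;
    last exact: size_poly.
  have E i : (q`_i * y%:P ^+ i)^`().[s] =
      ((map_poly (@deriv R) q)`_i).[s] * y ^+ i.
    rewrite coef_map /= -polyC_exp derivM derivC mulr0 addr0 hornerM hornerC //.
  rewrite [X in _ = _ + X]big1_seq ?addr0; first by apply: eq_bigr => i _; rewrite E.
  move=> i /andP[_]; rewrite mem_index_iota => /andP[si _].
  by rewrite E nth_default // horner0 mul0r.
rewrite /beval /=; exact: is_derive_poly.
Qed.

Lemma continuous_beval (T : topologicalType) q (f g : T -> R) :
  continuous f -> continuous g -> continuous (fun t => beval q (f t, g t)).
Proof.
move=> cf cg; under eq_fun do rewrite bevalE /=.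
have cs (I : eqType) (s : seq I) (F : I -> T -> R) :
    (forall i, continuous (F i)) -> continuous (fun t => \sum_(i <- s) F i t).
  move=> cF t; elim: s => [|i s IH]; last first.
    under eq_fun do rewrite big_cons; apply: cvgD; [exact: cF|exact: IH].
  by under eq_fun do rewrite big_nil; exact: cvg_cst.
apply: cs => i t; apply: cvgM.
  apply: (continuous_comp (g := horner q`_i)); first exact: cg.
  exact: continuous_horner.
by apply: (continuous_comp (g := fun s : R => s ^+ i)); [exact: cf|exact: exprn_continuous].
Qed.

Lemma measurable_beval q :
  measurable_fun [set: measurableTypeR R * measurableTypeR R] (beval q).
Proof.
rewrite (_ : beval q = fun x => \sum_(i < size q) (q`_i).[x.2] * x.1 ^+ i);
  last by apply/funext => x; exact: bevalE.
apply: measurable_sum => i; apply: measurable_funM.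
  apply: (measurableT_comp (f := horner q`_i)); last exact: measurable_snd.
  by apply: continuous_measurable_fun; exact: continuous_horner.
apply: (measurableT_comp (f := fun s : R => s ^+ i)); last exact: measurable_fst.
exact: exprn_measurable.
Qed.

Lemma beval_bounded q (M : R) : exists B, forall x,
  `|x.1| <= M -> `|x.2| <= M -> `|beval q x| <= B.
Proof.
exists (\sum_(i < size q) (\sum_(j < size q`_i) `|q`_i`_j| * M ^+ j) * M ^+ i).
move=> x x1 x2; rewrite bevalE; apply: (le_trans (ler_norm_sum _ _ _)).
apply: ler_sum => i _; rewrite normrM normrX; apply: ler_pM => //.
  rewrite horner_coef; apply: (le_trans (ler_norm_sum _ _ _)).
  by apply: ler_sum => j _; rewrite normrM normrX ler_wpM2l // lerXn2r ?nnegrE //;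
    apply: le_trans x2.
by rewrite lerXn2r ?nnegrE //; apply: le_trans x1.
Qed.

Lemma beval_coef p q x : total_degree_le p q -> beval q x =
  \sum_(i < p.+1) \sum_(j < p.+1) q`_i`_j * (x.1 ^+ i * x.2 ^+ j).
Proof.
move=> dq.
have sq i : (size (q`_i)%R <= p.+1)%N.
  by apply/leq_sizeP => j pj; apply: dq; apply: leq_trans pj (leq_addl _ _).
have sqq : (size q <= p.+1)%N.
  apply/leq_sizeP => i pi; apply/polyP => j; rewrite coef0; apply: dq.
  exact: leq_trans pi (leq_addr _ _).
rewrite /beval (horner_coef_wide _ sqq) horner_sum; apply: eq_bigr => i _.
rewrite hornerM -polyC_exp hornerC (horner_coef_wide _ (sq i)) mulr_suml.
by apply: eq_bigr => j _; ring.
Qed.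

End BivariatePolynomials.

(** * The divergence theorem on a rectangle cut by a line *)

Section OneDimensionalIntegrals.
Context {R : realType}.
Notation mu := (@lebesgue_measure R).
Implicit Types f g h : R -> R.

Lemma Rintegral_FTC f (F : R -> R) (a b : R) : a <= b -> continuous f ->
  (forall x, is_derive x (1 : R) F (f x)) ->
  \int[mu]_(x in `[a, b]) f x = F b - F a.
Proof.
rewrite le_eqVlt => /predU1P[<- _ _|ab cf dF].
  by rewrite set_itv1 Rintegral_set1 subrr.
have cF : continuous F.
  move=> x; apply/differentiable_continuous/derivable1_diffP.
  exact: ex_derive.
rewrite /Rintegral (continuous_FTC2 (F := F) ab) //.
- exact: continuous_subspaceT.
- split; first by move=> x _; exact: ex_derive.
  + by apply: cvg_at_right_filter; exact: cF.
  + by apply: cvg_at_left_filter; exact: cF.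
- by move=> x _; rewrite derive1E derive_val.
Qed.

Lemma integrable_patch f (D : set R) (a b : R) :
  measurable (D : set (measurableTypeR R)) -> D `<=` `[a, b] -> continuous f ->
  mu.-integrable setT (EFin \o (f \_ D)).
Proof.
move=> mD Dab cf; rewrite -restrict_EFin.
apply/integrable_restrict => //; rewrite setTI.
apply: (integrableS _ mD Dab) => //.
apply: continuous_compact_integrable; first exact: segment_compact.
exact: continuous_subspaceT.
Qed.

Lemma finite_set_null (N : set R) : finite_set N ->
  measurable (N : set (measurableTypeR R)) /\ mu N = 0%E.
Proof.
move=> fN; split; last by apply: countable_lebesgue_measure0; exact: finite_set_countable.
apply: countable_measurable => //; exact: finite_set_countable.
Qed.

(** Integrands on the skeleton are only known away from the mesh vertices. *)
Lemma Rintegral_cofinite f g (N : set R) : finite_set N ->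
  measurable_fun setT f -> measurable_fun setT g ->
  (forall x, ~ N x -> f x = g x) ->
  \int[mu]_x f x = \int[mu]_x g x.
Proof.
move=> /finite_set_null[mN N0] mf mg fg; congr fine; apply: ae_eq_integral => //;
  try exact/measurable_EFinP.
exists N; split => // x /= H; apply: contrapT => Nx; apply: H => _.
by rewrite fg.
Qed.

Section AffineSubstitution.
Variables (y0 S : R) (S0 : 0 < S).
Let phi (t : R) := y0 + S * t.

Let mphi : measurable_fun [set: measurableTypeR R] (phi : _ -> measurableTypeR R).
Proof.
apply: continuous_measurable_fun => t; apply: cvgD; first exact: cvg_cst.
by apply: cvgM; [exact: cvg_cst|exact: cvg_id].
Qed.

(* The measure structure of a push-forward depends on the proof that the map is
   measurable, which unification cannot find. *)
Let nu : {measure set (measurableTypeR R) -> \bar R} :=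
  mscale (NngNum (ltW S0))
    (measure_function_pushforward__canonical__measure_function_Measure mu mphi).

Let nuE (A : set (measurableTypeR R)) : measurable A -> mu A = nu A.
Proof.
move: A; apply: lebesgue_measure_unique => X [[x y]] /= _ <-.
rewrite /nu /= /mscale /= /pushforward.
have -> : phi @^-1` `]x, y]%classic = `](x - y0) / S, (y - y0) / S]%classic.
  apply/seteqP; split=> t /=; rewrite !in_itv /= /phi.
    by rewrite ltr_pdivrMr // ler_pdivlMr // => /andP[? ?]; apply/andP; split; lra.
  by rewrite ltr_pdivrMr // ler_pdivlMr // => /andP[? ?]; apply/andP; split; lra.
rewrite !lebesgue_measure_itv /= !lte_fin ltr_pM2r ?invr_gt0 // ltrD2r.
case: ifP => _; last by rewrite mule0.
by rewrite -!EFinB -EFinM; congr EFin; field; rewrite gt_eqF.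
Qed.

Lemma ge0_integral_affine (f : R -> \bar R) :
  measurable_fun [set: measurableTypeR R] f -> (forall x, 0 <= f x)%E ->
  (\int[mu]_x f x = S%:E * \int[mu]_t f (y0 + S * t)%R)%E.
Proof.
move=> mf f0.
rewrite (eq_measure_integral nu); last by move=> A mA _; exact: nuE.
rewrite ge0_integral_mscale //; congr (_ * _)%E.
by rewrite ge0_integral_pushforward.
Qed.

Lemma integrable_affine h : mu.-integrable setT (EFin \o h) ->
  mu.-integrable setT (EFin \o (fun t => h (y0 + S * t))).
Proof.
move=> /integrableP[mh ih]; apply/integrableP; split.
  exact: (measurableT_comp mh mphi).
move: ih; rewrite ge0_integral_affine //; last exact: measurableT_comp.
rewrite -(lte_pmul2l (z := S^-1%:E)) ?lte_fin ?invr_gt0 // muleA -EFinM.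
by rewrite mulVf ?gt_eqF // mul1e => ih; apply: lt_le_trans ih _; rewrite leey.
Qed.

(** Lebesgue measure is [S] times its image under [t |-> y0 + S t], as one
    checks on half-open intervals. *)
Lemma Rintegral_affine h : mu.-integrable setT (EFin \o h) ->
  \int[mu]_x h x = S * \int[mu]_t h (y0 + S * t).
Proof.
move=> ih; have ih' := integrable_affine ih.
have mh := measurable_int _ ih.
rewrite /Rintegral integralE [in RHS]integralE.
have E (k : R -> R) : mu.-integrable setT (EFin \o k) ->
    fine (\int[mu]_x (EFin \o k)^\+ x - \int[mu]_x (EFin \o k)^\- x)%E =
    fine (\int[mu]_x (EFin \o k)^\+ x)%E - fine (\int[mu]_x (EFin \o k)^\- x)%E.
  move=> ik; rewrite fineB //; apply: integrable_fin_num => //.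
    exact: integrable_funepos.
  exact: integrable_funeneg.
rewrite (E _ ih) (E _ ih') mulrBr.
have := integrable_fin_num measurableT (integrable_funepos measurableT ih').
rewrite (funepos_comp (EFin \o h) (fun t => y0 + S * t)) => fin_pos.
have := integrable_fin_num measurableT (integrable_funeneg measurableT ih').
rewrite (funeneg_comp (EFin \o h) (fun t => y0 + S * t)) => fin_neg.
congr (_ - _).
  rewrite ge0_integral_affine //; last exact: measurable_funepos.
  by rewrite fineM.
rewrite ge0_integral_affine //; last exact: measurable_funeneg.
by rewrite fineM.
Qed.

End AffineSubstitution.
End OneDimensionalIntegrals.

Section CutRectangle.
Context {R : realType}.

(** At the ramp point [(X, Y)] this compares the integrands of both sides of
    the divergence theorem.  The two clamped terms equal [F (X, Y)] inside the
    rectangle, where they cancel: this is the absence of flux through the ramp. *)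
Lemma clamp_telescope (F : R * R -> R) (a b c d X Y : R) :
  a < b -> c < d -> X != a -> X != b -> Y != c -> Y != d ->
  (if c <= Y <= d then F (Num.max a (Num.min b X), Y) - F (a, Y) else 0) +
  (if a <= X <= b then F (X, d) - F (X, Num.min d (Num.max c Y)) else 0) =
  (if [&& c <= Y, Y <= d & b <= X] then F (b, Y) else 0) -
  (if [&& c <= Y, Y <= d & a <= X] then F (a, Y) else 0) +
  ((if [&& a <= X, X <= b & Y <= d] then F (X, d) else 0) -
   (if [&& a <= X, X <= b & Y <= c] then F (X, c) else 0)).
Proof.
move=> ab cd Xa Xb Yc Yd.
have mxE : Num.max a (Num.min b X) = if X < a then a else if X < b then X else b.
  case: ifPn => [Xlta|]; last rewrite -leNgt => aX.
    by apply/max_idPl; rewrite ge_min (ltW Xlta) orbT.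
  by case: (ltP b X) => bX; [rewrite ltNge (ltW bX)|move: bX; rewrite le_eqVlt
    (negPf Xb) => /= ->]; apply/max_idPr; rewrite ?(ltW ab).
have kyE : Num.min d (Num.max c Y) = if Y < c then c else if Y < d then Y else d.
  case: (ltP Y c) => cY; first by apply/min_idPr; exact: ltW.
  case: ifPn => [Yd'|]; first by apply/min_idPr; exact: ltW.
  by rewrite -leNgt => dY; apply/min_idPl.
rewrite mxE kyE.
case: (ltgtP X a) Xa => // h1 _; case: (ltgtP X b) Xb => // h2 _;
  case: (ltgtP Y c) Yc => // h3 _; case: (ltgtP Y d) Yd => // h4 _ /=;
  first [ring|lra].
Qed.

Notation mu := (@lebesgue_measure R).
Variables (a b c d x0 y0 C S : R).
Hypotheses (ab : a < b) (cd : c < d) (C0 : 0 < C) (S0 : 0 < S).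

Definition cut_rectangle : set (R * R) :=
  [set x | (a <= x.1 <= b /\ c <= x.2 <= d) /\ (x.1 - x0) * S <= (x.2 - y0) * C].
Local Notation K := cut_rectangle.

Let T2 : measurableType _ := (measurableTypeR R * measurableTypeR R)%type.

Lemma measurable_cut_rectangle : measurable (K : set T2).
Proof.
have -> : K = (`[a, b] `*` `[c, d]) `&`
    (fun x : T2 => (x.1 - x0) * S - (x.2 - y0) * C) @^-1` `]-oo, 0].
  by apply/seteqP; split=> x /=; rewrite !in_itv /= subr_le0.
apply: measurableI; first by apply: measurableX; exact: measurable_itv.
have mline : measurable_fun [set: T2] (fun x => (x.1 - x0) * S - (x.2 - y0) * C).
  by apply: measurable_funB; apply: measurable_funM => //; apply: measurable_funB.
by rewrite -[X in measurable X]setTI; apply: mline => //; exact: measurable_itv.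
Qed.

Lemma integrable_cut_rectangle q :
  (@area_measure R).-integrable K (EFin \o beval q).
Proof.
apply: measurable_bounded_integrable; first exact: measurable_cut_rectangle.
- apply: (@le_lt_trans _ _ (area_measure ((`[a, b] : set R) `*` (`[c, d] : set R)))).
    apply: le_measure; rewrite ?inE; first exact: measurable_cut_rectangle.
      by apply: measurableX; exact: measurable_itv.
    by move=> x [[xab xcd] _]; split; rewrite /= in_itv.
  rewrite [X in (X < _)%E](_ : _ = (mu `[a, b] * mu `[c, d])%E); last first.
    by apply: product_measure1E; exact: measurable_itv.
  by rewrite !lebesgue_measure_itv /= !lte_fin ab cd -!EFinB -EFinM ltry.
- exact: measurable_funTS (measurable_beval q).
- have [B HB] := beval_bounded q (`|a| + `|b| + `|c| + `|d|).
  exists B; split; first exact: num_real.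
  move=> B' BB' x [[/andP[x1a x1b] /andP[x2c x2d]] _].
  apply: le_trans (ltW BB'); apply: HB; rewrite ler_norml; apply/andP.
    have := ler_norm a; have := ler_norm b; have := normr_ge0 c; have := normr_ge0 d.
    have := normr_ge0 a; have := normr_ge0 b.
    have := ler_norm (- a); have := ler_norm (- b); rewrite !normrN.
    split; lra.
  have := ler_norm c; have := ler_norm d; have := normr_ge0 c; have := normr_ge0 d.
  have := normr_ge0 a; have := normr_ge0 b.
  have := ler_norm (- c); have := ler_norm (- d); rewrite !normrN.
  split; lra.
Qed.

(* The section of the cut rectangle at height y is the segment from a to [mx y],
   or is empty, in which case [mx y] is a; [ky] plays the same role for the
   vertical sections. *)
Let mx (y : R) := Num.max a (Num.min b (x0 + (y - y0) * C / S)).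
Let ky (x : R) := Num.min d (Num.max c (y0 + (x - x0) * S / C)).

Let cmx : continuous mx.
Proof.
rewrite (_ : mx = cst a \max (cst b \min (fun y => x0 + (y - y0) * C / S))) // => y.
apply: continuous_max; first exact: cvg_cst.
apply: continuous_min; first exact: cvg_cst.
apply: cvgD; first exact: cvg_cst.
apply: cvgM; last exact: cvg_cst.
apply: cvgM; last exact: cvg_cst.
by apply: cvgB; [exact: cvg_id|exact: cvg_cst].
Qed.

Let cky : continuous ky.
Proof.
rewrite (_ : ky = cst d \min (cst c \max (fun y => y0 + (y - x0) * S / C))) // => y.
apply: continuous_min; first exact: cvg_cst.
apply: continuous_max; first exact: cvg_cst.
apply: cvgD; first exact: cvg_cst.
apply: cvgM; last exact: cvg_cst.
apply: cvgM; last exact: cvg_cst.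
by apply: cvgB; [exact: cvg_id|exact: cvg_cst].
Qed.

Let integral_dx_section q (y : R) :
  \int[mu]_(x in [set x | K (x, y)]) (bgrad q (x, y)).1 =
  ((fun y => beval q (mx y, y) - beval q (a, y)) \_ `[c, d]) y.
Proof.
rewrite patchE mem_setE in_itv /=; case: ifPn => [ycd|nycd]; last first.
  rewrite (_ : [set x | _] = set0) ?Rintegral_set0 //.
  by apply/seteqP; split=> // x [] [_] /= H; rewrite H in nycd.
have cb : continuous (fun x => (bgrad q (x, y)).1).
  by apply: continuous_beval => t; [exact: cvg_id|exact: cvg_cst].
have lineE x : ((x - x0) * S <= (y - y0) * C) = (x <= x0 + (y - y0) * C / S).
  by rewrite -lerBlDl ler_pdivlMr.
have [ra|ar] := ltP (x0 + (y - y0) * C / S) a.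
  rewrite (_ : [set x | _] = set0); last first.
    by apply/seteqP; split=> // x [] [/= /andP[ax xb] _]; rewrite lineE => h; lra.
  rewrite Rintegral_set0 /mx.
  rewrite (_ : Num.max _ _ = a) ?subrr //.
  by apply/max_idPl; rewrite ge_min (ltW ra) orbT.
rewrite (_ : [set x | _] = `[a, mx y]%classic); last first.
  apply/seteqP; split=> x /=; rewrite in_itv /=.
    move=> [[/andP[ax xb] _]]; rewrite lineE ax /mx le_max le_min xb => ->.
    by rewrite orbT.
  rewrite /mx (_ : Num.max _ _ = Num.min b (x0 + (y - y0) * C / S)).
    rewrite le_min => /and3P[ax xb xr]; split; last by rewrite /= lineE.
    by split=> //; rewrite /= ax.
  by apply/max_idPr; rewrite le_min ar (ltW ab).
rewrite (Rintegral_FTC _ cb (fun x => is_derive_beval1 q x y)) //.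
by rewrite /mx le_max lexx.
Qed.

Let integral_dy_section q (x : R) :
  \int[mu]_(y in [set y | K (x, y)]) (bgrad q (x, y)).2 =
  ((fun x => beval q (x, d) - beval q (x, ky x)) \_ `[a, b]) x.
Proof.
rewrite patchE mem_setE in_itv /=; case: ifPn => [xab|nxab]; last first.
  rewrite (_ : [set y | _] = set0) ?Rintegral_set0 //.
  by apply/seteqP; split=> // y [] [/= H]; rewrite H in nxab.
have cb : continuous (fun y => (bgrad q (x, y)).2).
  by apply: continuous_beval => t; [exact: cvg_cst|exact: cvg_id].
have lineE y : ((x - x0) * S <= (y - y0) * C) = (y0 + (x - x0) * S / C <= y).
  by rewrite -lerBrDl ler_pdivrMr.
have [ra|ar] := ltP d (y0 + (x - x0) * S / C).
  rewrite (_ : [set y | _] = set0); last first.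
    by apply/seteqP; split=> // y [] [_ /= /andP[ax xb]]; rewrite lineE => h; lra.
  rewrite Rintegral_set0 /ky.
  rewrite (_ : Num.min _ _ = d) ?subrr //.
  by apply/min_idPl; rewrite le_max (ltW ra) orbT.
rewrite (_ : [set y | _] = `[ky x, d]%classic); last first.
  apply/seteqP; split=> y /=; rewrite in_itv /=.
    move=> [[_ /andP[ax xb]]]; rewrite lineE xb /ky ge_min ge_max ax => ->.
    by rewrite orbT.
  rewrite /ky (_ : Num.min _ _ = Num.max c (y0 + (x - x0) * S / C)).
    rewrite ge_max => /andP[/andP[cy xr] yd]; split; last by rewrite /= lineE.
    by split=> //; rewrite /= cy.
  by apply/min_idPr; rewrite ge_max ar (ltW cd).
rewrite (Rintegral_FTC _ cb (fun y => is_derive_beval2 q y x)) //.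
by rewrite /ky ge_min lexx.
Qed.

Lemma Rintegral_bgrad1 q : \int[area_measure]_(x in K) (bgrad q x).1 =
  \int[mu]_(y in `[c, d]) (beval q (mx y, y) - beval q (a, y)).
Proof.
rewrite [LHS]Rintegral_mkcond [RHS]Rintegral_mkcond /Rintegral /area_measure.
have I : ((mu \x mu)%E).-integrable setT
    (EFin \o ((fun x => (bgrad q x).1) \_ K)).
  rewrite -restrict_EFin; apply/integrable_restrict => //.
    exact: measurable_cut_rectangle.
  by rewrite setTI; exact: integrable_cut_rectangle.
have := integral21_prod_meas1 I; rewrite /= => <-; congr fine.
apply: eq_integral => y _; rewrite /fubini_G /=.
rewrite -(integral_dx_section q y) Rintegral_mkcond /Rintegral.
have E : (fun x => (((fun x => (bgrad q x).1) \_ K) (x, y))%:E) =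
  (fun x => (((fun x => (bgrad q (x, y)).1) \_ [set x | K (x, y)]) x)%:E).
  by [].
rewrite E fineK //; apply: integrable_fin_num => //.
apply: (@integrable_patch _ _ _ a b).
- have := measurable_ysection y measurable_cut_rectangle.
  rewrite /ysection; congr (measurable _).
  by apply/seteqP; split=> x /=; rewrite inE.
- by move=> x [] [/= H _] _; rewrite in_itv.
- by apply: continuous_beval => t; [exact: cvg_id|exact: cvg_cst].
Qed.

Lemma Rintegral_bgrad2 q : \int[area_measure]_(x in K) (bgrad q x).2 =
  \int[mu]_(x in `[a, b]) (beval q (x, d) - beval q (x, ky x)).
Proof.
rewrite [LHS]Rintegral_mkcond [RHS]Rintegral_mkcond /Rintegral /area_measure.
have I : ((mu \x mu)%E).-integrable setT
    (EFin \o ((fun x => (bgrad q x).2) \_ K)).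
  rewrite -restrict_EFin; apply/integrable_restrict => //.
    exact: measurable_cut_rectangle.
  by rewrite setTI; exact: integrable_cut_rectangle.
have := integral12_prod_meas1 I; rewrite /= => <-; congr fine.
apply: eq_integral => x _; rewrite /fubini_F /=.
rewrite -(integral_dy_section q x) Rintegral_mkcond /Rintegral.
have E : (fun y => (((fun x => (bgrad q x).2) \_ K) (x, y))%:E) =
  (fun y => (((fun y => (bgrad q (x, y)).2) \_ [set y | K (x, y)]) y)%:E).
  by [].
rewrite E fineK //; apply: integrable_fin_num => //.
apply: (@integrable_patch _ _ _ c d).
- have := measurable_xsection x measurable_cut_rectangle.
  rewrite /xsection; congr (measurable _).
  by apply/seteqP; split=> y /=; rewrite inE.
- by move=> y [] [/= _ H] _; rewrite in_itv.
- by apply: continuous_beval => t; [exact: cvg_cst|exact: cvg_id].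
Qed.

(** Fubini's theorem and the fundamental theorem of calculus reduce both area
    integrals to integrals over y and over x whose integrands involve the ramp
    point at that height, respectively at that abscissa.  Since the field
    [(C, S)] is parallel to the ramp, both contain the same ramp integral with
    opposite signs: after the substitutions [y = y0 + S t] and [x = x0 + C t]
    the integrands agree for almost all t ([clamp_telescope]). *)
Lemma cut_rectangle_divergence q :
  C * \int[area_measure]_(x in K) (bgrad q x).1
  + S * \int[area_measure]_(x in K) (bgrad q x).2 =
  C * (\int[mu]_(s in [set s | K (b, s)]) beval q (b, s)
       - \int[mu]_(s in [set s | K (a, s)]) beval q (a, s))
  + S * (\int[mu]_(s in [set s | K (s, d)]) beval q (s, d)
         - \int[mu]_(s in [set s | K (s, c)]) beval q (s, c)).
Proof.
rewrite Rintegral_bgrad1 Rintegral_bgrad2.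
have subst (z0 U : R) (D : set R) (al be : R) (f : R -> R) : 0 < U ->
    measurable (D : set (measurableTypeR R)) -> D `<=` `[al, be] ->
    continuous f ->
    \int[mu]_(s in D) f s = U * \int[mu]_t ((f \_ D) (z0 + U * t)) /\
    mu.-integrable setT (EFin \o (fun t => (f \_ D) (z0 + U * t))).
  move=> U0 mD Dab cf; have iD := integrable_patch mD Dab cf.
  by rewrite Rintegral_mkcond (Rintegral_affine z0 U0 iD); split=> //;
    exact: integrable_affine.
have mitv al be : measurable (`[al, be]%classic : set (measurableTypeR R)).
  exact: measurable_itv.
have msec1 z : measurable ([set s | K (z, s)] : set (measurableTypeR R)).
  have := measurable_xsection z measurable_cut_rectangle.
  rewrite /xsection; congr (measurable _).
  by apply/seteqP; split=> y /=; rewrite inE.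
have msec2 z : measurable ([set s | K (s, z)] : set (measurableTypeR R)).
  have := measurable_ysection z measurable_cut_rectangle.
  rewrite /ysection; congr (measurable _).
  by apply/seteqP; split=> y /=; rewrite inE.
have bsec1 z : [set s | K (z, s)] `<=` `[c, d].
  by move=> s [[_ H] _]; rewrite /= in_itv.
have bsec2 z : [set s | K (s, z)] `<=` `[a, b].
  by move=> s [[H _] _]; rewrite /= in_itv.
have cq1 z : continuous (fun s => beval q (z, s)).
  by apply: continuous_beval => t; [exact: cvg_cst|exact: cvg_id].
have cq2 z : continuous (fun s => beval q (s, z)).
  by apply: continuous_beval => t; [exact: cvg_id|exact: cvg_cst].
have ch1 : continuous (fun y => beval q (mx y, y) - beval q (a, y)).
  move=> y; apply: cvgB; last exact: cq1.
  by apply: (continuous_beval (f := mx) (g := id)) => // t; exact: cvg_id.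
have ch2 : continuous (fun x => beval q (x, d) - beval q (x, ky x)).
  move=> y; apply: cvgB; first exact: cq2.
  by apply: (continuous_beval (f := id) (g := ky)) => // t; exact: cvg_id.
have [-> ih1] := subst y0 S _ _ _ _ S0 (mitv c d) (@subset_refl _ _) ch1.
have [-> ih2] := subst x0 C _ _ _ _ C0 (mitv a b) (@subset_refl _ _) ch2.
have [-> ie1] := subst y0 S _ _ _ _ S0 (msec1 b) (bsec1 b) (cq1 b).
have [-> ie2] := subst y0 S _ _ _ _ S0 (msec1 a) (bsec1 a) (cq1 a).
have [-> ie3] := subst x0 C _ _ _ _ C0 (msec2 d) (bsec2 d) (cq2 d).
have [-> ie4] := subst x0 C _ _ _ _ C0 (msec2 c) (bsec2 c) (cq2 c).
(* Every term now has the factor C S, from the weight and the Jacobian. *)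
rewrite -!mulrBr !mulrA [S * C]mulrC -!mulrDr; congr (_ * _).
rewrite -!RintegralB // -!RintegralD //; last 2 first.
- by have := integrableB measurableT ie1 ie2; apply: eq_integrable.
- by have := integrableB measurableT ie3 ie4; apply: eq_integrable.
have m1 := measurable_int _ ih1; have m2 := measurable_int _ ih2.
have n1 := measurable_int _ ie1; have n2 := measurable_int _ ie2.
have n3 := measurable_int _ ie3; have n4 := measurable_int _ ie4.
apply: (@Rintegral_cofinite _ _ _
  [set (a - x0) / C; (b - x0) / C; (c - y0) / S; (d - y0) / S]).
- by rewrite !finite_setU; do ?split; exact: finite_set1.
- by apply: measurable_funD; exact/measurable_EFinP.
- by apply: measurable_funD; apply: measurable_funB; exact/measurable_EFinP.
move=> t /= Nt.
have Xa : x0 + C * t != a.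
  by apply/eqP => E; apply: Nt; do 3 left; rewrite -E; field; rewrite gt_eqF.
have Xb : x0 + C * t != b.
  by apply/eqP => E; apply: Nt; do 2 left; right; rewrite -E; field; rewrite gt_eqF.
have Yc : y0 + S * t != c.
  by apply/eqP => E; apply: Nt; left; right; rewrite -E; field; rewrite gt_eqF.
have Yd : y0 + S * t != d.
  by apply/eqP => E; apply: Nt; right; rewrite -E; field; rewrite gt_eqF.
have mxY : mx (y0 + S * t) = Num.max a (Num.min b (x0 + C * t)).
  by rewrite /mx; congr (Num.max _ (Num.min _ _)); field; rewrite gt_eqF.
have kyX : ky (x0 + C * t) = Num.min d (Num.max c (y0 + S * t)).
  by rewrite /ky; congr (Num.min _ (Num.max _ _)); field; rewrite gt_eqF.
have KY z : ((z, y0 + S * t) \in K) =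
    [&& a <= z, z <= b, c <= y0 + S * t, y0 + S * t <= d & z <= x0 + C * t].
  have -> : (z <= x0 + C * t) = ((z - x0) * S <= (y0 + S * t - y0) * C).
    by rewrite -lerBlDl -(ler_pM2r S0); congr (_ <= _); ring.
  apply/idP/idP; first by rewrite inE => -[/= [/andP[-> ->] /andP[-> ->]] ->].
  by case/and5P=> h1 h2 h3 h4 h5; rewrite inE; split=> //=; rewrite h1 h2 h3 h4.
have KX z : ((x0 + C * t, z) \in K) =
    [&& a <= x0 + C * t, x0 + C * t <= b, c <= z, z <= d & y0 + S * t <= z].
  have -> : (y0 + S * t <= z) = ((x0 + C * t - x0) * S <= (z - y0) * C).
    by rewrite -lerBrDl -(ler_pM2r C0); congr (_ <= _); ring.
  apply/idP/idP; first by rewrite inE => -[/= [/andP[-> ->] /andP[-> ->]] ->].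
  by case/and5P=> h1 h2 h3 h4 h5; rewrite inE; split=> //=; rewrite h1 h2 h3 h4.
rewrite !patchE mxY kyX.
have YK z : (y0 + S * t \in [set s | K (z, s)]) = ((z, y0 + S * t) \in K) by [].
have XK z : (x0 + C * t \in [set s | K (s, z)]) = ((x0 + C * t, z) \in K) by [].
rewrite !YK !XK !KY !KX !mem_setE !in_itv /= !lexx (ltW ab) (ltW cd) /=.
move: Xa Xb Yc Yd; set X := x0 + C * t; set Y := y0 + S * t => Xa Xb Yc Yd.
by rewrite -![point]/(0 : R) clamp_telescope.
Qed.

End CutRectangle.

(** * Boundary and normals of the domain and of the cells *)

Section HalfPlaneNormals.
Context {R : realType}.
Implicit Types (A : set (R * R)) (x y nu w : R * R).

Lemma dotBr nu x y : dot nu (x - y) = dot nu x - dot nu y.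
Proof. by rewrite /dot /=; ring. Qed.

Lemma dotDr nu x y : dot nu (x + y) = dot nu x + dot nu y.
Proof. by rewrite /dot /=; ring. Qed.

Lemma dotZr nu x (t : R) : dot nu (t *: x) = t * dot nu x.
Proof. by rewrite /dot /= /GRing.scale /=; ring. Qed.

Lemma dotNr nu x : dot nu (- x) = - dot nu x.
Proof. by rewrite /dot /=; ring. Qed.

Lemma nbhs_ray x w (P : set (R * R)) : nbhs x P ->
  exists2 t : R, 0 < t & forall s, 0 <= s <= t -> P (x + s *: w).
Proof.
move=> /nbhs_ballP[e /= e0 eP].
pose M := 1 + `|w.1| + `|w.2|.
have M0 : 0 < M by rewrite /M -addrA ltr_wpDr // addr_ge0.
exists (e / 2 / M); first by rewrite !divr_gt0.
move=> s /andP[s0 st]; apply: eP.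
have b (c : R) : `|c| <= M -> `|s * c| < e.
  move=> cM; rewrite normrM ger0_norm //.
  apply: (@le_lt_trans _ _ (e / 2)); last by lra.
  apply: (@le_trans _ _ (e / 2 / M * M)); first exact: ler_pM.
  by rewrite divfK // gt_eqF.
split; rewrite /= /ball /= opprD addrA subrr add0r normrN; apply: b.
  by rewrite /M; have := normr_ge0 w.2; lra.
by rewrite /M; have := normr_ge0 w.1; lra.
Qed.

(** Where A locally fills a half-plane, the normal of the half-plane is the only
    supporting normal: a supporting mu satisfies [<mu,w> <= 0] for all w with
    [<nu,w> < 0], because small steps from x along such w stay in A. *)
Lemma half_plane_normal A x nu : dot nu nu = 1 ->
  (forall y, A y -> dot nu (y - x) <= 0) ->
  (\forall y \near x, dot nu (y - x) < 0 -> A y) ->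
  bdry A x /\ outer_normal A x = nu.
Proof.
move=> nu1 Anu Ax.
have inA w : dot nu w < 0 -> exists2 t : R, 0 < t & A (x + t *: w).
  move=> w0; have [t t0 tA] := nbhs_ray w Ax.
  exists t => //; apply: tA; first by rewrite lexx (ltW t0).
  by rewrite addrAC subrr add0r dotZr pmulr_rlt0.
have SN : supporting_normals A x = [set nu].
  apply/seteqP; split=> [mu [mu1 Amu]|_ ->]; last by split.
  have H w : dot nu w < 0 -> dot mu w <= 0.
    move=> /inA[t t0 /Amu]; rewrite addrAC subrr add0r dotZr.
    by rewrite pmulr_rle0.
  case: mu mu1 Amu H => m1 m2; case: nu nu1 Anu Ax inA => n1 n2.
  rewrite /dot /= => nu1 Anu Ax inA mu1 Amu H.
  (* The test directions are w = - nu + k tau with tau orthogonal to nu and k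
     arbitrary, which forces mu to be orthogonal to tau. *)
  have Hk (k : R) : k * (m2 * n1 - m1 * n2) <= m1 * n1 + m2 * n2.
    have := H (- n1 - k * n2, - n2 + k * n1); rewrite /dot /=.
    have -> : n1 * (- n1 - k * n2) + n2 * (- n2 + k * n1) = - (n1 * n1 + n2 * n2).
      by ring.
    by rewrite nu1 ltrN10 => /(_ isT) h; nra.
  have tau0 : m2 * n1 - m1 * n2 = 0.
    set tau := m2 * n1 - m1 * n2 in Hk *; set ka := m1 * n1 + m2 * n2 in Hk.
    apply/eqP; apply: contraT => tn0.
    by have := Hk ((ka + 1) / tau); rewrite divfK // => h; lra.
  have ka0 := Hk 0; rewrite mul0r in ka0.
  have ka1 : m1 * n1 + m2 * n2 = 1.
    have : (m1 * n1 + m2 * n2) ^+ 2 + (m2 * n1 - m1 * n2) ^+ 2 = 1.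
      have -> : 1 = (m1 * m1 + m2 * m2) * (n1 * n1 + n2 * n2) by rewrite mu1 nu1; ring.
      by ring.
    rewrite tau0 expr0n addr0 => /eqP; rewrite sqrf_eq1 => /orP[/eqP //|/eqP h].
    by lra.
  have E : (m1 - n1) ^+ 2 + (m2 - n2) ^+ 2 = 0.
    have -> : (m1 - n1) ^+ 2 + (m2 - n2) ^+ 2 =
      (m1 * m1 + m2 * m2) + (n1 * n1 + n2 * n2) - 2 * (m1 * n1 + m2 * n2) by ring.
    by rewrite mu1 nu1 ka1; ring.
  move/eqP: E; rewrite paddr_eq0 ?sqr_ge0 // !sqrf_eq0 !subr_eq0.
  by move=> /andP[/eqP -> /eqP ->].
split; last first.
  rewrite /outer_normal SN; case: xgetP => [mu _ /= E|/(_ nu)/(_ erefl) //].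
  by have : [set mu] nu by rewrite -E.
split.
  move=> B Bx; have [t t0 tAB] := nbhs_ray (- nu) (filterI Ax Bx).
  have [|h B'] := tAB t; first by rewrite lexx (ltW t0).
  exists (x + t *: - nu); split=> //; apply: h.
  by rewrite addrAC subrr add0r dotZr pmulr_rlt0 // -scaleN1r dotZr nu1 mulr1 ltrN10.
move=> Bx; have [t t0 /(_ t)] := nbhs_ray nu Bx.
rewrite lexx (ltW t0) => /(_ isT) /Anu.
by rewrite addrAC subrr add0r dotZr nu1 mulr1 leNgt t0.
Qed.

End HalfPlaneNormals.

(** The domain is an open cut rectangle and a cell a closed one; boundary and
    normals only depend on the set up to its boundary, so both are treated as
    sets between the open and the closed rectangle. *)

Section SandwichedCutRectangle.
Context {R : realType}.
Variables (a b c d x0 y0 C S : R).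
Hypotheses (ab : a < b) (cd : c < d) (CS1 : S * S + C * C = 1).
Variable A : set (R * R).

Definition open_cut_rectangle : set (R * R) :=
  [set x | (a < x.1 < b /\ c < x.2 < d) /\ (x.1 - x0) * S < (x.2 - y0) * C].

Local Notation K := (cut_rectangle a b c d x0 y0 C S).
Local Notation Ko := open_cut_rectangle.

Lemma open_sub_cut_rectangle : Ko `<=` K.
Proof.
move=> x [[/andP[h1 h2] /andP[h3 h4]] h5].
by split; [split; apply/andP; split|]; exact: ltW.
Qed.

Let cline : continuous (fun x : R * R => (x.1 - x0) * S - (x.2 - y0) * C).
Proof.
move=> x; apply: cvgB; (apply: cvgM; last exact: cvg_cst); apply: cvgB;
  [exact: cvg_fst|exact: cvg_cst|exact: cvg_snd|exact: cvg_cst].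
Qed.

Lemma closed_cut_rectangle : closed K.
Proof.
have -> : K = fst @^-1` `[a, b]%classic `&` snd @^-1` `[c, d]%classic `&`
    (fun x => (x.1 - x0) * S - (x.2 - y0) * C) @^-1` `]-oo, 0]%classic.
  apply/seteqP; split=> x /=; rewrite !in_itv /= subr_le0.
    by move=> [[? ?] ?].
  by move=> [[? ?] ?].
apply: closedI; first apply: closedI.
- by apply: closed_comp; [move=> x _; exact: cvg_fst|exact: itv_closed].
- by apply: closed_comp; [move=> x _; exact: cvg_snd|exact: itv_closed].
- by apply: closed_comp; [move=> x _; exact: cline|exact: lray_closed].
Qed.

Let near_line x : (x.1 - x0) * S < (x.2 - y0) * C ->
  \forall y \near x, (y.1 - x0) * S < (y.2 - y0) * C.
Proof.
rewrite -subr_lt0 => h; near=> y; rewrite -subr_lt0; near: y.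
exact: (cvgr_lt _ (@cline x) _ h).
Unshelve. all: by end_near.
Qed.

Let near1 (x : R * R) (r : R) : x.1 < r -> \forall y \near x, y.1 < r.
Proof. by move=> h; exact: (cvgr_lt _ cvg_fst _ h). Qed.
Let near2 (x : R * R) (r : R) : x.2 < r -> \forall y \near x, y.2 < r.
Proof. by move=> h; exact: (cvgr_lt _ cvg_snd _ h). Qed.
Let near1' (x : R * R) (r : R) : r < x.1 -> \forall y \near x, r < y.1.
Proof. by move=> h; exact: (cvgr_gt _ cvg_fst _ h). Qed.
Let near2' (x : R * R) (r : R) : r < x.2 -> \forall y \near x, r < y.2.
Proof. by move=> h; exact: (cvgr_gt _ cvg_snd _ h). Qed.

Lemma open_cut_rectangle_nbhs x : Ko x -> nbhs x Ko.
Proof.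
move=> [[/andP[h1 h2] /andP[h3 h4]] h5].
near=> y; split; [split; apply/andP; split|]; near: y;
  [exact: near1'|exact: near1|exact: near2'|exact: near2|exact: near_line].
Unshelve. all: by end_near.
Qed.

Hypotheses (KoA : Ko `<=` A) (AK : A `<=` K).

Lemma sandwich_bdry x : bdry A x -> K x /\ ~ Ko x.
Proof.
move=> [clA nintA]; split.
  by have := closureS AK clA; rewrite -(closure_id K).1 //; exact: closed_cut_rectangle.
by move=> /open_cut_rectangle_nbhs Kx; apply: nintA; exact: filterS Kx.
Qed.

Lemma sandwich_left x : x.1 = a -> c < x.2 < d ->
  (x.1 - x0) * S < (x.2 - y0) * C ->
  bdry A x /\ outer_normal A x = (-1, 0).
Proof.
move=> xa /andP[h3 h4] h5; apply: half_plane_normal.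
- by rewrite /dot /=; ring.
- by move=> y /AK [[/andP[h _] _] _]; rewrite /dot /= xa; lra.
- near=> y; rewrite /dot /= xa => h; apply: KoA.
  have ya : a < y.1 by lra.
  by split; [split; apply/andP; split|] => //; near: y;
    [apply: near1; rewrite xa|exact: near2'|exact: near2|exact: near_line].
Unshelve. all: by end_near.
Qed.

Lemma sandwich_right x : x.1 = b -> c < x.2 < d ->
  (x.1 - x0) * S < (x.2 - y0) * C ->
  bdry A x /\ outer_normal A x = (1, 0).
Proof.
move=> xb /andP[h3 h4] h5; apply: half_plane_normal.
- by rewrite /dot /=; ring.
- by move=> y /AK [[/andP[_ h] _] _]; rewrite /dot /= xb; lra.
- near=> y; rewrite /dot /= xb => h; apply: KoA.
  have yb : y.1 < b by lra.
  by split; [split; apply/andP; split|] => //; near: y;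
    [apply: near1'; rewrite xb|exact: near2'|exact: near2|exact: near_line].
Unshelve. all: by end_near.
Qed.

Lemma sandwich_bottom x : a < x.1 < b -> x.2 = c ->
  (x.1 - x0) * S < (x.2 - y0) * C ->
  bdry A x /\ outer_normal A x = (0, -1).
Proof.
move=> /andP[h1 h2] xc h5; apply: half_plane_normal.
- by rewrite /dot /=; ring.
- by move=> y /AK [[_ /andP[h _]] _]; rewrite /dot /= xc; lra.
- near=> y; rewrite /dot /= xc => h; apply: KoA.
  have yc : c < y.2 by lra.
  by split; [split; apply/andP; split|] => //; near: y;
    [exact: near1'|exact: near1|apply: near2; rewrite xc|exact: near_line].
Unshelve. all: by end_near.
Qed.

Lemma sandwich_top x : a < x.1 < b -> x.2 = d ->
  (x.1 - x0) * S < (x.2 - y0) * C ->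
  bdry A x /\ outer_normal A x = (0, 1).
Proof.
move=> /andP[h1 h2] xd h5; apply: half_plane_normal.
- by rewrite /dot /=; ring.
- by move=> y /AK [[_ /andP[_ h]] _]; rewrite /dot /= xd; lra.
- near=> y; rewrite /dot /= xd => h; apply: KoA.
  have yd : y.2 < d by lra.
  by split; [split; apply/andP; split|] => //; near: y;
    [exact: near1'|exact: near1|apply: near2'; rewrite xd|exact: near_line].
Unshelve. all: by end_near.
Qed.

Lemma sandwich_ramp x : a < x.1 < b -> c < x.2 < d ->
  (x.1 - x0) * S = (x.2 - y0) * C ->
  bdry A x /\ outer_normal A x = (S, - C).
Proof.
move=> /andP[h1 h2] /andP[h3 h4] h5.
have E y : dot (S, - C) (y - x) = (y.1 - x0) * S - (y.2 - y0) * C.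
  rewrite -[RHS]subr0 -(subrr ((x.1 - x0) * S)) [in X in _ - (_ - X)]h5 /dot /=.
  by ring.
apply: half_plane_normal.
- by rewrite /dot /= mulrNN.
- by move=> y /AK [_ h]; rewrite E subr_le0.
- near=> y; rewrite E subr_lt0 => h; apply: KoA.
  by split; [split; apply/andP; split|] => //; near: y;
    [exact: near1'|exact: near1|exact: near2'|exact: near2].
Unshelve. all: by end_near.
Qed.

End SandwichedCutRectangle.

(** * The points of the mesh skeleton lying on a single line *)

Section Grid.
Context {R : realType}.
Variables (g : nat -> R) (n : nat).
Hypothesis g_incr : forall i, (i < n)%N -> g i < g i.+1.

Lemma grid_lt i j : (i < j <= n)%N -> g i < g j.
Proof.
elim: j => // j IH /andP[]; rewrite ltnS leq_eqVlt => /orP[/eqP ->|ij] jn.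
  exact: g_incr.
by apply: lt_trans (g_incr jn); apply: IH; rewrite ij ltnW.
Qed.

Lemma grid_le i j : (i <= j <= n)%N -> g i <= g j.
Proof.
move=> /andP[]; rewrite leq_eqVlt => /orP[/eqP -> //|ij jn].
by apply: ltW; apply: grid_lt; rewrite ij.
Qed.

Lemma grid_inj i j : (i <= n)%N -> (j <= n)%N -> g i = g j -> i = j.
Proof.
move=> im jm E; case: (ltngtP i j) => // h.
  by have := @grid_lt i j; rewrite h jm E ltxx => /(_ isT).
by have := @grid_lt j i; rewrite h im E ltxx => /(_ isT).
Qed.

Lemma grid_uniq i j y : (i < n)%N -> (j < n)%N ->
  g i < y < g i.+1 -> g j <= y <= g j.+1 -> i = j.
Proof.
move=> im jm /andP[h1 h2] /andP[h3 h4]; case: (ltngtP i j) => // h; exfalso.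
  have := @grid_le i.+1 j; rewrite h ltnW // => /(_ isT); lra.
have := @grid_le j.+1 i; rewrite h ltnW // => /(_ isT); lra.
Qed.

Lemma grid_locate y : g 0%N < y < g n -> (forall i, (i <= n)%N -> y != g i) ->
  exists2 j, (j < n)%N & g j < y < g j.+1.
Proof.
move=> /andP[y0 yn] yg.
suff H m : (m <= n)%N -> y < g m -> exists2 j, (j < m)%N & g j < y < g j.+1.
  exact: H yn.
elim: m => [|m IH] mn ym; first by lra.
case: (ltgtP y (g m)) => h.
- by have [j jm jy] := IH (ltnW mn) h; exists j => //; exact: ltnW.
- by exists m => //; rewrite h.
- by have := yg m (ltnW mn); rewrite h eqxx.
Qed.

End Grid.

Section RampMeshGeometry.
Context {R : realType} (D : ramp_geometry R).
Implicit Types (K : cell_id D) (x : R * R).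

Local Notation S := (sin (angle D)).
Local Notation C := (cos (angle D)).

Lemma sin_angle_gt0 : 0 < S.
Proof.
have /andP[h1 h2] := angle_acute D; apply: sin_gt0_pi.
by rewrite h1 /=; have := pi_gt0 R; lra.
Qed.

Lemma cos_angle_gt0 : 0 < C.
Proof.
have /andP[h1 h2] := angle_acute D; apply: cos_gt0_pihalf.
by rewrite h2 andbT; have := pi_gt0 R; lra.
Qed.

Lemma sin_cos_angle : S * S + C * C = 1.
Proof. by rewrite addrC -!expr2 cos2Dsin2. Qed.

Local Notation S0 := sin_angle_gt0.
Local Notation C0 := cos_angle_gt0.

Lemma gx_lt_end : gx D 0%N < gx D (nx D).
Proof. by apply: (grid_lt (@gx_incr _ D)); rewrite nx_gt0 leqnn. Qed.

Lemma gy_lt_end : gy D 0%N < gy D (ny D).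
Proof. by apply: (grid_lt (@gy_incr _ D)); rewrite ny_gt0 leqnn. Qed.

Definition above_ramp x := (x.1 - foot D) * S < (x.2 - gy D 0%N) * C.
Definition on_ramp x := (x.1 - foot D) * S = (x.2 - gy D 0%N) * C.

Local Notation Omega_rect := (cut_rectangle (gx D 0%N) (gx D (nx D))
  (gy D 0%N) (gy D (ny D)) (foot D) (gy D 0%N) C S).

(** Near its upper left corner the bounding rectangle lies above the ramp, which
    starts on the bottom side. *)
Lemma Omega_nonempty : exists z, Omega D z.
Proof.
have W0 := gx_lt_end; have H0 := gy_lt_end.
have /andP[f0 _] := foot_bottom D.
have C1 : C <= 1 by exact: cos_le1.
have S1 : S <= 1 by exact: sin_le1.
pose m := Num.min (gx D (nx D) - gx D 0%N) (gy D (ny D) - gy D 0%N).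
have m0 : 0 < m by rewrite lt_min !subr_gt0 W0 H0.
have mW : m <= gx D (nx D) - gx D 0%N by rewrite ge_min lexx.
have mH : m <= gy D (ny D) - gy D 0%N by rewrite ge_min lexx orbT.
pose e := m * C / 4.
have c0 := C0; have s0 := S0.
have e0 : 0 < e by rewrite divr_gt0 ?mulr_gt0.
have em : e <= m / 4 by rewrite ler_pM2r ?invr_gt0 // ler_piMr // ltW.
(* Moving the corner inwards by e costs at most 2 e in the ramp constraint,
   which has a slack of at least m C = 4 e. *)
exists (gx D 0%N + e, gy D (ny D) - e); split; first split; rewrite /=.
- by apply/andP; split; lra.
- by apply/andP; split; lra.
have h1 : e * S <= e by rewrite ler_piMr // ltW.
have h2 : (gx D 0%N - foot D) * S <= 0.
  by rewrite pmulr_lle0 // subr_le0.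
have h3 : (m - m / 4) * C <= (gy D (ny D) - e - gy D 0%N) * C.
  by rewrite ler_pM2r //; lra.
have h4 : m * C = 4 * e by rewrite /e; field.
have h5 : (m - m / 4) * C = 3 * e by rewrite /e; field.
have -> : (gx D 0%N + e - foot D) * S = (gx D 0%N - foot D) * S + e * S by ring.
lra.
Qed.

(** Omega is convex: a point of the closed polygon is the limit of the points
    strictly between it and a point of Omega. *)
Lemma closure_Omega : closure (Omega D) = Omega_rect.
Proof.
apply/seteqP; split=> x.
  move=> clx; rewrite (closure_id Omega_rect).1; last exact: closed_cut_rectangle.
  by move: x clx; apply: closureS; exact: open_sub_cut_rectangle.
move=> [[/andP[x1 x2] /andP[x3 x4]] x5] B Bx.
have [z [[/andP[z1 z2] /andP[z3 z4]] z5]] := Omega_nonempty.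
have [t t0 tB] := nbhs_ray (z - x) Bx.
pose s := Num.min t 1.
have s0 : 0 < s by rewrite lt_min t0 ltr01.
have st : s <= t by rewrite ge_min lexx.
have s1 : s <= 1 by rewrite ge_min lexx orbT.
exists (x + s *: (z - x)); split; last by apply: tB; rewrite (ltW s0).
have conv (a b u v : R) : u <= v -> a < b -> u + s * (a - u) < v + s * (b - v).
  move=> uv ab; have h1 : (1 - s) * u <= (1 - s) * v by rewrite ler_wpM2l // subr_ge0.
  have h2 : s * a < s * b by rewrite ltr_pM2l.
  by rewrite !mulrBr; lra.
have convl (a u v : R) : u <= v -> u < a -> u < v + s * (a - v).
  by move=> uv ua; have := conv u a u v uv ua; rewrite subrr mulr0 addr0.
have convr (b u v : R) : v <= u -> b < u -> v + s * (b - v) < u.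
  by move=> uv ua; have := conv b u v u uv ua; rewrite subrr mulr0 addr0.
split; first by split; apply/andP; split; [exact: convl|exact: convr|
  exact: convl|exact: convr].
have := conv _ _ _ _ x5 z5; rewrite /= /GRing.scale /=; lra.
Qed.

Local Notation cell_rect K := (cut_rectangle (gx D K.1) (gx D K.1.+1)
  (gy D K.2) (gy D K.2.+1) (foot D) (gy D 0%N) C S).
Local Notation open_cell K := (open_cut_rectangle (gx D K.1) (gx D K.1.+1)
  (gy D K.2) (gy D K.2.+1) (foot D) (gy D 0%N) C S).

Lemma cellE K : cell K = cell_rect K.
Proof.
rewrite /cell closure_Omega; apply/seteqP; split=> x.
  by move=> [[h1 h2] [_ h3]].
move=> [[/andP[h1 h1'] /andP[h2 h2']] h3]; split; first by rewrite /= h1 h1' h2 h2'.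
have a1 : gx D 0%N <= gx D K.1.
  by apply: (grid_le (@gx_incr _ D)); rewrite leq0n ltnW.
have a2 : gx D K.1.+1 <= gx D (nx D).
  by apply: (grid_le (@gx_incr _ D)); rewrite ltn_ord leqnn.
have a3 : gy D 0%N <= gy D K.2.
  by apply: (grid_le (@gy_incr _ D)); rewrite leq0n ltnW.
have a4 : gy D K.2.+1 <= gy D (ny D).
  by apply: (grid_le (@gy_incr _ D)); rewrite ltn_ord leqnn.
by split=> //; split; apply/andP; split; lra.
Qed.

Lemma cell_gx_lt K : gx D K.1 < gx D K.1.+1.
Proof. exact: gx_incr. Qed.

Lemma cell_gy_lt K : gy D K.2 < gy D K.2.+1.
Proof. exact: gy_incr. Qed.

Lemma open_cell_sub K : open_cell K `<=` cell K.
Proof. by rewrite cellE; exact: open_sub_cut_rectangle. Qed.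

Lemma interior_cell K : interior (cell K) = open_cell K.
Proof.
apply/seteqP; split=> x; last first.
  by move=> /open_cut_rectangle_nbhs; apply: filterS; exact: open_cell_sub.
rewrite cellE => intx.
have s0 := S0; have c0 := C0.
have H w : exists2 t : R, 0 < t & cell_rect K (x + t *: w).
  by have [t t0 /(_ t)] := nbhs_ray w intx; rewrite lexx (ltW t0) => /(_ isT) h; exists t.
have [t1 p1 [[/andP[h1 _] _] _]] := H (-1, 0).
have [t2 p2 [[/andP[_ h2] _] _]] := H (1, 0).
have [t3 p3 [[_ /andP[h3 _]] _]] := H (0, -1).
have [t4 p4 [[_ /andP[_ h4]] _]] := H (0, 1).
have [t5 p5 [_ h5]] := H (1, 0).
rewrite /= /GRing.scale /= in h1 h2 h3 h4 h5.
split; first by split; apply/andP; split; lra.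
have : 0 < t5 * S by rewrite mulr_gt0.
rewrite mulr1 mulr0 addr0 in h5.
have -> : (x.1 - foot D) * S = (x.1 + t5 - foot D) * S - t5 * S by ring.
lra.
Qed.

Lemma in_mesh K : (K \in mesh D) <-> exists x, open_cell K x.
Proof. by rewrite inE -interior_cell; split=> [/asboolP //|h]; exact/asboolP. Qed.

Lemma mesh_cell_inj K K' : K \in mesh D -> cell K = cell K' -> K = K'.
Proof.
move=> /in_mesh[x Kx] E; have K'x : open_cell K' x by rewrite -interior_cell -E interior_cell.
case: K K' Kx K'x {E} => [i j] [i' j'] /= [[h1 h2] _] [[h1' h2'] _].
have le2 (a b c : R) : a < b < c -> a <= b <= c.
  by move=> /andP[? ?]; apply/andP; split; exact: ltW.
congr (_, _); apply: val_inj.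
  exact: (grid_uniq (@gx_incr _ D) (ltn_ord i) (ltn_ord i') h1 (le2 _ _ _ h1')).
exact: (grid_uniq (@gy_incr _ D) (ltn_ord j) (ltn_ord j') h2 (le2 _ _ _ h2')).
Qed.

Lemma closed_cell K : closed (cell K).
Proof. by rewrite cellE; exact: closed_cut_rectangle. Qed.

Lemma bdry_cellP K x : bdry (cell K) x -> cell K x /\ ~ open_cell K x.
Proof.
move=> h; have [] := sandwich_bdry (@open_cell_sub K) _ h; first by rewrite cellE.
by rewrite cellE.
Qed.

(** Regular points lie on exactly one line of the skeleton; there the domain and
    the cells look like half-planes. *)
Definition vertical_regular i x := [/\ (i <= nx D)%N, x.1 = gx D i,
  forall j, (j <= ny D)%N -> x.2 != gy D j & ~ on_ramp x].

Definition horizontal_regular j x := [/\ (j <= ny D)%N, x.2 = gy D j,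
  forall i, (i <= nx D)%N -> x.1 != gx D i & ~ on_ramp x].

Definition ramp_regular x := [/\ on_ramp x,
  forall i, (i <= nx D)%N -> x.1 != gx D i &
  forall j, (j <= ny D)%N -> x.2 != gy D j].

Definition regular x := [\/ exists i, vertical_regular i x,
  exists j, horizontal_regular j x | ramp_regular x].

Let lt_neqr (a b : R) : a <= b -> b != a -> a < b.
Proof. by move=> ab ba; rewrite lt_neqAle eq_sym ba. Qed.
Let lt_neql (a b : R) : a <= b -> a != b -> a < b.
Proof. by move=> ab ba; rewrite lt_neqAle ba. Qed.

Let leS1 K : ((K.1 <= nx D)%N * (K.1.+1 <= nx D)%N)%type.
Proof. by split; [exact: ltnW|]. Qed.
Let leS2 K : ((K.2 <= ny D)%N * (K.2.+1 <= ny D)%N)%type.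
Proof. by split; [exact: ltnW|]. Qed.

Section OneSetOneLine.
Variables (a b c d : R).
Hypotheses (ab : a < b) (cd : c < d).
Variable A : set (R * R).
Hypotheses (KoA : open_cut_rectangle a b c d (foot D) (gy D 0%N) C S `<=` A)
  (AK : A `<=` cut_rectangle a b c d (foot D) (gy D 0%N) C S).

Lemma bdry_vertical x : x.2 != c -> x.2 != d -> ~ on_ramp x ->
  bdry A x <-> [/\ x.1 = a \/ x.1 = b, c < x.2 < d & above_ramp x].
Proof.
move=> xc xd xr; split.
  move=> /(sandwich_bdry KoA AK)[[[/andP[h1 h2] /andP[h3 h4]] h5] nKo].
  have h3' := lt_neqr h3 xc; have h4' := lt_neql h4 xd.
  have h5' : above_ramp x by apply: lt_neql h5 _; apply/eqP.
  rewrite h3' h4'; split=> //; have [->|xa] := eqVneq x.1 a; first by left.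
  have [->|xb] := eqVneq x.1 b; first by right.
  case: nKo; split=> //; split; apply/andP; split=> //; [exact: lt_neqr|exact: lt_neql].
move=> [[xa|xb] xcd xr'].
  by case: (sandwich_left ab KoA AK xa xcd xr').
by case: (sandwich_right ab KoA AK xb xcd xr').
Qed.

Lemma bdry_horizontal x : x.1 != a -> x.1 != b -> ~ on_ramp x ->
  bdry A x <-> [/\ x.2 = c \/ x.2 = d, a < x.1 < b & above_ramp x].
Proof.
move=> xa xb xr; split.
  move=> /(sandwich_bdry KoA AK)[[[/andP[h1 h2] /andP[h3 h4]] h5] nKo].
  have h1' := lt_neqr h1 xa; have h2' := lt_neql h2 xb.
  have h5' : above_ramp x by apply: lt_neql h5 _; apply/eqP.
  rewrite h1' h2'; split=> //; have [->|xc] := eqVneq x.2 c; first by left.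
  have [->|xd] := eqVneq x.2 d; first by right.
  case: nKo; split=> //; split; apply/andP; split=> //; [exact: lt_neqr|exact: lt_neql].
move=> [[xc|xd] xab xr'].
  by case: (sandwich_bottom cd KoA AK xab xc xr').
by case: (sandwich_top cd KoA AK xab xd xr').
Qed.

Lemma bdry_ramp x : on_ramp x -> x.1 != a -> x.1 != b -> x.2 != c -> x.2 != d ->
  bdry A x <-> a < x.1 < b /\ c < x.2 < d.
Proof.
move=> xr xa xb xc xd; split.
  move=> /(sandwich_bdry KoA AK)[[[/andP[h1 h2] /andP[h3 h4]] h5] nKo].
  by rewrite (lt_neqr h1 xa) (lt_neql h2 xb) (lt_neqr h3 xc) (lt_neql h4 xd).
by move=> [xab xcd]; case: (sandwich_ramp sin_cos_angle KoA AK xab xcd xr).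
Qed.

End OneSetOneLine.

Lemma cell_sub_rect K : cell K `<=` cell_rect K.
Proof. by rewrite cellE. Qed.

Lemma Omega_sub_rect : Omega D `<=` Omega_rect.
Proof. exact: open_sub_cut_rectangle. Qed.

Lemma cell_bdry_vertical i x K : vertical_regular i x ->
  bdry (cell K) x <-> [/\ i = K.1 \/ i = K.1.+1,
    gy D K.2 < x.2 < gy D K.2.+1 & above_ramp x].
Proof.
move=> [il xi yr nr].
rewrite (bdry_vertical (cell_gx_lt K) (@open_cell_sub K) (@cell_sub_rect K)) //;
  [|by apply: yr; rewrite leS2..].
have E k : (k <= nx D)%N -> x.1 = gx D k <-> i = k.
  by move=> kn; rewrite xi; split=> [/(grid_inj (@gx_incr _ D) il kn)|->].
split=> -[h ? ?]; split=> //; case: h => /E h; [left|right|left|right]; apply: h;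
  by rewrite leS1.
Qed.

Lemma cell_normal_vertical i x K : vertical_regular i x -> bdry (cell K) x ->
  normal K x = (if i == K.1 then -1 else 1, 0).
Proof.
move=> vr /(cell_bdry_vertical K vr)[iK xcd xr]; case: vr => _ xi _ _.
case: iK xi => -> xi.
  by rewrite eqxx; case: (sandwich_left (cell_gx_lt K) (@open_cell_sub K)
    (@cell_sub_rect K) xi xcd xr).
rewrite gtn_eqF //; by case: (sandwich_right (cell_gx_lt K) (@open_cell_sub K)
  (@cell_sub_rect K) xi xcd xr).
Qed.

Lemma cell_bdry_horizontal j x K : horizontal_regular j x ->
  bdry (cell K) x <-> [/\ j = K.2 \/ j = K.2.+1,
    gx D K.1 < x.1 < gx D K.1.+1 & above_ramp x].
Proof.
move=> [jl xj xr nr].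
rewrite (bdry_horizontal (cell_gy_lt K) (@open_cell_sub K) (@cell_sub_rect K)) //;
  [|by apply: xr; rewrite leS1..].
have E k : (k <= ny D)%N -> x.2 = gy D k <-> j = k.
  by move=> kn; rewrite xj; split=> [/(grid_inj (@gy_incr _ D) jl kn)|->].
split=> -[h ? ?]; split=> //; case: h => /E h; [left|right|left|right]; apply: h;
  by rewrite leS2.
Qed.

Lemma cell_normal_horizontal j x K : horizontal_regular j x -> bdry (cell K) x ->
  normal K x = (0, if j == K.2 then -1 else 1).
Proof.
move=> hr /(cell_bdry_horizontal K hr)[jK xab xr]; case: hr => _ xj _ _.
case: jK xj => -> xj.
  by rewrite eqxx; case: (sandwich_bottom (cell_gy_lt K) (@open_cell_sub K)
    (@cell_sub_rect K) xab xj xr).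
rewrite gtn_eqF //; by case: (sandwich_top (cell_gy_lt K) (@open_cell_sub K)
  (@cell_sub_rect K) xab xj xr).
Qed.

Lemma cell_bdry_ramp x K : ramp_regular x ->
  bdry (cell K) x <-> gx D K.1 < x.1 < gx D K.1.+1 /\ gy D K.2 < x.2 < gy D K.2.+1.
Proof.
move=> [xr x1 x2].
by apply: (bdry_ramp (@open_cell_sub K) (@cell_sub_rect K)) => //;
  (apply: x1 || apply: x2); rewrite ?leS1 ?leS2.
Qed.

Lemma cell_normal_ramp x K : ramp_regular x -> bdry (cell K) x ->
  normal K x = (S, - C).
Proof.
move=> rr /(cell_bdry_ramp K rr)[xab xcd]; case: rr => xr _ _.
by case: (sandwich_ramp sin_cos_angle (@open_cell_sub K) (@cell_sub_rect K) xab xcd xr).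
Qed.

(** A cell outside the mesh is empty or reduced to a corner, whereas at a regular
    boundary point of a cell its open part accumulates. *)
Lemma bdry_in_mesh x K : regular x -> bdry (cell K) x -> K \in mesh D.
Proof.
move=> rx bx; suff [cx _] : bdry (open_cell K) x.
  by have [y [Ky _]] := cx setT (@filterT _ _ _); apply/in_mesh; exists y.
have K1 := leS1 K; have K2 := leS2 K.
case: rx => [[i vr]|[j hr]|rr].
- case: (vr) => _ _ yr nr.
  apply/(bdry_vertical (cell_gx_lt K) (@subset_refl _ _)
    (@open_sub_cut_rectangle _ _ _ _ _ _ _ _ _)) => //; try by apply: yr; rewrite K2.
  have /(cell_bdry_vertical K vr)[iK ? ?] := bx; split=> //.
  by case: vr => _ -> _ _; case: iK => ->; [left|right].
- case: (hr) => _ _ yr nr.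
  apply/(bdry_horizontal (cell_gy_lt K) (@subset_refl _ _)
    (@open_sub_cut_rectangle _ _ _ _ _ _ _ _ _)) => //; try by apply: yr; rewrite K1.
  have /(cell_bdry_horizontal K hr)[iK ? ?] := bx; split=> //.
  by case: hr => _ -> _ _; case: iK => ->; [left|right].
- case: (rr) => xr x1 x2.
  apply/(bdry_ramp (@subset_refl _ _)
    (@open_sub_cut_rectangle _ _ _ _ _ _ _ _ _)) => //;
    try by [apply: x1; rewrite K1|apply: x2; rewrite K2].
  exact/(cell_bdry_ramp K rr).
Qed.

(** The possible configurations at a regular point.  All sums over cells and
    faces collapse to at most two terms there, with known relations between
    the normals. *)
Variant skeleton_spec x : Prop :=
| NoCell of forall K, ~ bdry (cell K) x
| OuterCell K of K \in mesh D & bdry (cell K) x &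
    (forall K', bdry (cell K') x -> K' = K) &
    bdry (Omega D) x & outer_normal (Omega D) x = normal K x
| TwoCells K1 K2 of K1 \in mesh D & K2 \in mesh D & K1 != K2 &
    bdry (cell K1) x & bdry (cell K2) x &
    (forall K', bdry (cell K') x -> K' = K1 \/ K' = K2) &
    ~ bdry (Omega D) x & normal K2 x = - normal K1 x &
    dot (normal K1 x) (normal K1 x) = 1.

Let ltW2 (a b c : R) : a < b < c -> a <= b <= c.
Proof. by move=> /andP[? ?]; apply/andP; split; exact: ltW. Qed.

Let gx_range K (y : R) : gx D K.1 < y < gx D K.1.+1 -> gx D 0%N < y < gx D (nx D).
Proof.
move=> /andP[h1 h2].
have a1 : gx D 0%N <= gx D K.1 by apply: (grid_le (@gx_incr _ D)); rewrite leq0n leS1.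
have a2 : gx D K.1.+1 <= gx D (nx D) by apply: (grid_le (@gx_incr _ D)); rewrite ltn_ord leqnn.
by apply/andP; split; lra.
Qed.

Let gy_range K (y : R) : gy D K.2 < y < gy D K.2.+1 -> gy D 0%N < y < gy D (ny D).
Proof.
move=> /andP[h1 h2].
have a1 : gy D 0%N <= gy D K.2 by apply: (grid_le (@gy_incr _ D)); rewrite leq0n leS2.
have a2 : gy D K.2.+1 <= gy D (ny D) by apply: (grid_le (@gy_incr _ D)); rewrite ltn_ord leqnn.
by apply/andP; split; lra.
Qed.

Lemma skeletonP_vertical i x : vertical_regular i x -> skeleton_spec x.
Proof.
move=> vr; have rx : regular x by constructor 1; exists i.
have iff K := cell_bdry_vertical K vr; have nrm K := @cell_normal_vertical _ _ K vr.
have bm K := @bdry_in_mesh _ K rx; case: (vr) => il xi yr nr.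
have [[xab xcd]|nok] := pselect (above_ramp x /\ gy D 0%N < x.2 < gy D (ny D)); last first.
  by apply: NoCell => K /iff[_ h1 h2]; apply: nok; split=> //; exact: gy_range h1.
have [j jn yj] := grid_locate xcd yr.
have bd k (kn : (k < nx D)%N) : i = k \/ i = k.+1 ->
    bdry (cell (Ordinal kn, Ordinal jn) : set (R * R)) x.
  by move=> h; apply/iff.
have un k (kn : (k < nx D)%N) K : bdry (cell K) x -> K.1 = k :> nat ->
    K = (Ordinal kn, Ordinal jn).
  move=> /iff[_ h _] Kk; case: K Kk h => K1 K2 /= Kk h.
  congr (_, _); apply: val_inj => //=.
  exact: (grid_uniq (@gy_incr _ D) (ltn_ord _) jn h (ltW2 yj)).
have c0 : x.2 != gy D 0%N by exact: yr.
have cn : x.2 != gy D (ny D) by exact: yr.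
have bO := bdry_vertical gx_lt_end (@subset_refl _ (Omega D)) Omega_sub_rect c0 cn nr.
have [i0|i0] := posnP i.
  have b1 := bd _ (nx_gt0 D) (or_introl i0).
  apply: (OuterCell (bm _ b1) b1).
  - by move=> K bK; apply: un => //; have /iff[+ _ _] := bK; rewrite i0; case=> [->|].
  - by apply/bO; split=> //; left; rewrite xi i0.
  - rewrite nrm //= i0 eqxx.
    by case: (sandwich_left gx_lt_end (@subset_refl _ (Omega D)) Omega_sub_rect
      (etrans xi (congr1 _ i0)) xcd xab).
have i1 : i = i.-1.+1 by rewrite prednK.
have ne : (i == i.-1) = false by rewrite gtn_eqF // ltn_predL.
have iln : (i.-1 < nx D)%N by rewrite -i1.
have b1 := bd _ iln (or_intror i1).
move: il; rewrite leq_eqVlt => /orP[/eqP ien|iltn].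
  apply: (OuterCell (bm _ b1) b1).
  - move=> K bK; apply: un => //; have /iff[+ _ _] := bK; case=> [h|->//].
    by have := ltn_ord K.1; rewrite -h ien ltnn.
  - by apply/bO; split=> //; right; rewrite xi ien.
  - rewrite nrm //= ne.
    by case: (sandwich_right gx_lt_end (@subset_refl _ (Omega D)) Omega_sub_rect
      (etrans xi (congr1 _ ien)) xcd xab).
have b2 := bd _ iltn (or_introl erefl).
have n1 := nrm _ b1; rewrite /= ne in n1.
have n2 := nrm _ b2; rewrite /= eqxx in n2.
apply: (TwoCells (bm _ b1) (bm _ b2) _ b1 b2).
- by apply/eqP => -[/eqP]; rewrite eq_sym ne.
- move=> K bK; have /iff[+ _ _] := bK; case=> h; [right|left]; apply: un => //.
  by rewrite h.
- move=> /bO[[]]; rewrite xi => h _ _.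
    by have := grid_inj (@gx_incr _ D) (ltnW iltn) (leq0n _) h; move: i0 => /[swap] ->.
  by have h' := grid_inj (@gx_incr _ D) (ltnW iltn) (leqnn _) h; have := iltn; rewrite {1}h' ltnn.
- by rewrite n1 n2; congr (_, _); rewrite /= ?oppr0.
- by rewrite n1 /dot /=; ring.
Qed.

Lemma skeletonP_horizontal j x : horizontal_regular j x -> skeleton_spec x.
Proof.
move=> hr; have rx : regular x by constructor 2; exists j.
have iff K := cell_bdry_horizontal K hr; have nrm K := @cell_normal_horizontal _ _ K hr.
have bm K := @bdry_in_mesh _ K rx; case: (hr) => jl xj xr nr.
have [[xab xcd]|nok] := pselect (above_ramp x /\ gx D 0%N < x.1 < gx D (nx D)); last first.
  by apply: NoCell => K /iff[_ h1 h2]; apply: nok; split=> //; exact: gx_range h1.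
have [i im yi] := grid_locate xcd xr.
have bd k (kn : (k < ny D)%N) : j = k \/ j = k.+1 ->
    bdry (cell (Ordinal im, Ordinal kn) : set (R * R)) x.
  by move=> h; apply/iff.
have un k (kn : (k < ny D)%N) K : bdry (cell K) x -> K.2 = k :> nat ->
    K = (Ordinal im, Ordinal kn).
  move=> /iff[_ h _] Kk; case: K Kk h => K1 K2 /= Kk h.
  congr (_, _); apply: val_inj => //=.
  exact: (grid_uniq (@gx_incr _ D) (ltn_ord _) im h (ltW2 yi)).
have c0 : x.1 != gx D 0%N by exact: xr.
have cn : x.1 != gx D (nx D) by exact: xr.
have bO := bdry_horizontal gy_lt_end (@subset_refl _ (Omega D)) Omega_sub_rect c0 cn nr.
have [j0|j0] := posnP j.
  have b1 := bd _ (ny_gt0 D) (or_introl j0).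
  apply: (OuterCell (bm _ b1) b1).
  - by move=> K bK; apply: un => //; have /iff[+ _ _] := bK; rewrite j0; case=> [->|].
  - by apply/bO; split=> //; left; rewrite xj j0.
  - rewrite nrm //= j0 eqxx.
    by case: (sandwich_bottom gy_lt_end (@subset_refl _ (Omega D)) Omega_sub_rect
      xcd (etrans xj (congr1 _ j0)) xab).
have j1 : j = j.-1.+1 by rewrite prednK.
have ne : (j == j.-1) = false by rewrite gtn_eqF // ltn_predL.
have jln : (j.-1 < ny D)%N by rewrite -j1.
have b1 := bd _ jln (or_intror j1).
move: jl; rewrite leq_eqVlt => /orP[/eqP jen|jltn].
  apply: (OuterCell (bm _ b1) b1).
  - move=> K bK; apply: un => //; have /iff[+ _ _] := bK; case=> [h|->//].
    by have := ltn_ord K.2; rewrite -h jen ltnn.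
  - by apply/bO; split=> //; right; rewrite xj jen.
  - rewrite nrm //= ne.
    by case: (sandwich_top gy_lt_end (@subset_refl _ (Omega D)) Omega_sub_rect
      xcd (etrans xj (congr1 _ jen)) xab).
have b2 := bd _ jltn (or_introl erefl).
have n1 := nrm _ b1; rewrite /= ne in n1.
have n2 := nrm _ b2; rewrite /= eqxx in n2.
apply: (TwoCells (bm _ b1) (bm _ b2) _ b1 b2).
- by apply/eqP => -[/eqP]; rewrite eq_sym ne.
- move=> K bK; have /iff[+ _ _] := bK; case=> h; [right|left]; apply: un => //.
  by rewrite h.
- move=> /bO[[]]; rewrite xj => h _ _.
    by have := grid_inj (@gy_incr _ D) (ltnW jltn) (leq0n _) h; move: j0 => /[swap] ->.
  by have h' := grid_inj (@gy_incr _ D) (ltnW jltn) (leqnn _) h; have := jltn; rewrite {1}h' ltnn.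
- by rewrite n1 n2; congr (_, _); rewrite /= ?oppr0.
- by rewrite n1 /dot /=; ring.
Qed.

Lemma skeletonP_ramp x : ramp_regular x -> skeleton_spec x.
Proof.
move=> rr; have rx : regular x by constructor 3.
have iff K := cell_bdry_ramp K rr; have nrm K := @cell_normal_ramp _ K rr.
have bm K := @bdry_in_mesh _ K rx; case: (rr) => xr x1 x2.
have [[xab xcd]|nok] := pselect (gx D 0%N < x.1 < gx D (nx D) /\
    gy D 0%N < x.2 < gy D (ny D)); last first.
  by apply: NoCell => K /iff[h1 h2]; apply: nok; split;
    [exact: gx_range h1|exact: gy_range h2].
have [i im xi] := grid_locate xab x1.
have [j jn xj] := grid_locate xcd x2.
have b1 : bdry (cell (Ordinal im, Ordinal jn) : set (R * R)) x by apply/iff.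
apply: (OuterCell (bm _ b1) b1).
- move=> [K1 K2] /iff[/= h1 h2]; congr (_, _); apply: val_inj => /=.
    exact: (grid_uniq (@gx_incr _ D) (ltn_ord _) im h1 (ltW2 xi)).
  exact: (grid_uniq (@gy_incr _ D) (ltn_ord _) jn h2 (ltW2 xj)).
- apply/(bdry_ramp (@subset_refl _ (Omega D)) Omega_sub_rect) => //;
  by [exact: x1|exact: x2].
- by rewrite nrm //; case: (sandwich_ramp sin_cos_angle (@subset_refl _ (Omega D))
    Omega_sub_rect xab xcd xr).
Qed.

Lemma skeletonP x : regular x -> skeleton_spec x.
Proof.
by case=> [[i]|[j]|]; [exact: skeletonP_vertical|exact: skeletonP_horizontal|
  exact: skeletonP_ramp].
Qed.

End RampMeshGeometry.

(** * Arc-length integrals over the skeleton *)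

Section CofiniteModification.
Context {R : realType}.
Notation mu := (@lebesgue_measure R).

(** The Borel sigma-algebra is not complete, so measurability is transferred by
    cutting out the finite set, all of whose subsets are measurable. *)
Lemma integrable_cofinite (f g : R -> R) (N : set R) : finite_set N ->
  (forall s, ~ N s -> f s = g s) -> mu.-integrable setT (EFin \o g) ->
  mu.-integrable setT (EFin \o f).
Proof.
move=> fN fg ig; have [mN N0] := finite_set_null fN.
have mg : measurable_fun setT (EFin \o g) := measurable_int _ ig.
have mf : measurable_fun setT (EFin \o f).
  rewrite -(setUv N); apply/measurable_funU => //; first exact: measurableC.
  split.
    move=> _ Y _; apply: (finite_set_null _).1.
    by apply: sub_finite_set fN; exact: subIsetl.
  apply: (eq_measurable_fun (EFin \o g)); last exact: measurable_funS mg.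
  by move=> s; rewrite inE => Ns /=; rewrite fg.
apply/(negligible_integrable mN) => //.
have /(negligible_integrable mN measurableT mg N0) := ig.
apply: eq_integrable; first exact: measurableD.
by move=> s; rewrite inE => -[_ Ns] /=; rewrite fg.
Qed.

Lemma Rintegral_cofinite_ge0 (f : R -> R) (N : set R) : finite_set N ->
  mu.-integrable setT (EFin \o f) -> (forall s, ~ N s -> 0 <= f s) ->
  0 <= \int[mu]_s f s.
Proof.
move=> fN intf f0; have /measurable_EFinP mf := measurable_int _ intf.
rewrite (Rintegral_cofinite (g := fun s => `|f s|) fN) //.
- by apply: Rintegral_ge0.
- exact: measurableT_comp.
- by move=> s Ns; rewrite ger0_norm // f0.
Qed.

End CofiniteModification.

Section Skeleton.
Context {R : realType} (D : ramp_geometry R).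
Notation mu := (@lebesgue_measure R).
Implicit Types (K : cell_id D) (x : R * R) (l : (R * R) * (R * R)).
Implicit Types (e : set (R * R)) (F G f : R * R -> R).

Local Notation S := (sin (angle D)).
Local Notation C := (cos (angle D)).
Local Notation pt l s := (l.1 + s *: l.2).

Lemma skeleton_linesP l : l \in skeleton_lines D ->
  [\/ exists2 i, (i <= nx D)%N & forall s : R, pt l s = (gx D i, s),
      exists2 j, (j <= ny D)%N & forall s : R, pt l s = (s, gy D j) |
      forall s : R, pt l s = (foot D + C * s, gy D 0%N + S * s)].
Proof.
rewrite !mem_cat => /or3P[/mapP[i]|/mapP[j]|].
- rewrite mem_iota add0n ltnS => /andP[_ il] ->; constructor 1; exists i => // s.
  by congr (_, _); rewrite /= /GRing.scale /=; ring.
- rewrite mem_iota add0n ltnS => /andP[_ jl] ->; constructor 2; exists j => // s.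
  by congr (_, _); rewrite /= /GRing.scale /=; ring.
- rewrite inE => /eqP ->; constructor 3 => s.
  by congr (_, _); rewrite /= /GRing.scale /=; ring.
Qed.

Lemma on_rampE (s : R) : on_ramp D (foot D + C * s, gy D 0%N + S * s).
Proof. by rewrite /on_ramp /=; ring. Qed.

Lemma regular_vertical i x : (i <= nx D)%N -> x.1 = gx D i ->
  regular D x -> vertical_regular D i x.
Proof.
move=> il xi [[k vk]|[j [_ _ h _]]|[_ h _]]; last 2 first.
- by have := h i il; rewrite xi eqxx.
- by have := h i il; rewrite xi eqxx.
have [kl xk _ _] := vk; rewrite (_ : i = k) //.
by apply: (grid_inj (@gx_incr _ D)) => //; rewrite -xi.
Qed.

Lemma regular_horizontal j x : (j <= ny D)%N -> x.2 = gy D j ->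
  regular D x -> horizontal_regular D j x.
Proof.
move=> jl xj [[i [_ _ h _]]|[k vk]|[_ _ h]].
- by have := h j jl; rewrite xj eqxx.
- have [kl xk _ _] := vk; rewrite (_ : j = k) //.
  by apply: (grid_inj (@gy_incr _ D)) => //; rewrite -xj.
- by have := h j jl; rewrite xj eqxx.
Qed.

Lemma regular_on_ramp x : on_ramp D x -> regular D x -> ramp_regular D x.
Proof. by move=> xr [[i [_ _ _ /(_ xr)]]|[j [_ _ _ /(_ xr)]]|]. Qed.

Lemma finite_grid (g : nat -> R) n : finite_set [set g i | i in `I_n].
Proof. exact/finite_image/finite_II. Qed.

Lemma skeleton_cofinite l : l \in skeleton_lines D ->
  finite_set [set s : R | ~ regular D (pt l s)].
Proof.
have s0 := sin_angle_gt0 D; have c0 := cos_angle_gt0 D.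
case/skeleton_linesP => [[i il E]|[j jl E]|E].
- pose N := [set gy D j | j in `I_(ny D).+1] `|`
    [set gy D 0%N + (gx D i - foot D) * S / C].
  apply: (@sub_finite_set _ _ N); last first.
    by rewrite finite_setU; split; [exact: finite_grid|exact: finite_set1].
  move=> s /= ns; apply: contrapT => nN; apply: ns; rewrite E.
  constructor 1; exists i; split=> //= [j jl|h].
    by apply/eqP => h; apply: nN; left; exists j.
  apply: nN; right; rewrite /= h /=; field; by rewrite gt_eqF.
- pose N := [set gx D i | i in `I_(nx D).+1] `|`
    [set foot D + (gy D j - gy D 0%N) * C / S].
  apply: (@sub_finite_set _ _ N); last first.
    by rewrite finite_setU; split; [exact: finite_grid|exact: finite_set1].
  move=> s /= ns; apply: contrapT => nN; apply: ns; rewrite E.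
  constructor 2; exists j; split=> //= [i il|h].
    by apply/eqP => h; apply: nN; left; exists i.
  apply: nN; right; rewrite /= -h /=; field; by rewrite gt_eqF.
- pose N := [set (gx D i - foot D) / C | i in `I_(nx D).+1] `|`
    [set (gy D j - gy D 0%N) / S | j in `I_(ny D).+1].
  apply: (@sub_finite_set _ _ N); last first.
    by rewrite finite_setU; split; exact: finite_grid.
  move=> s /= ns; apply: contrapT => nN; apply: ns; rewrite E.
  constructor 3; split; first exact: on_rampE.
    move=> i il; apply/eqP => /= h; apply: nN; left; exists i => //.
    by rewrite -h; field; rewrite gt_eqF.
  move=> j jl; apply/eqP => /= h; apply: nN; right; exists j => //.
  by rewrite -h; field; rewrite gt_eqF.
Qed.

(** Extending integrands by zero to the whole skeleton allows integrals over
    different faces to be added pointwise. *)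
Definition skeleton_int F : R :=
  \sum_(l <- skeleton_lines D) \int[mu]_s F (pt l s).

Lemma arc_intE e f : arc_int D e f = skeleton_int (f \_ e).
Proof. by apply: eq_bigr => l _; rewrite Rintegral_mkcond. Qed.

Lemma skeleton_intE F : skeleton_int F =
  \sum_(i < (nx D).+1) \int[mu]_s F (gx D i, s)
  + \sum_(j < (ny D).+1) \int[mu]_s F (s, gy D j)
  + \int[mu]_s F (foot D + C * s, gy D 0%N + S * s).
Proof.
rewrite /skeleton_int !big_cat big_seq1 !big_map -[LHS]/(_ + (_ + _)) addrA.
have E n (G : nat -> R) : \sum_(i <- iota 0 n) G i = \sum_(i < n) G i.
  by rewrite -(big_mkord xpredT) /index_iota subn0.
rewrite !E; congr (_ + _ + _).
- apply: eq_bigr => i _; apply: eq_Rintegral => s _; congr F.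
  by congr (_, _); rewrite /= /GRing.scale /=; ring.
- apply: eq_bigr => i _; apply: eq_Rintegral => s _; congr F.
  by congr (_, _); rewrite /= /GRing.scale /=; ring.
- apply: eq_Rintegral => s _; congr F.
  by congr (_, _); rewrite /= /GRing.scale /=; ring.
Qed.

Definition skeleton_integrable F := forall l, l \in skeleton_lines D ->
  mu.-integrable setT (EFin \o (fun s => F (pt l s))).

Lemma skeleton_integrableD F G : skeleton_integrable F -> skeleton_integrable G ->
  skeleton_integrable (fun x => F x + G x).
Proof.
move=> iF iG l ll; have := integrableD measurableT (iF l ll) (iG l ll).
exact: eq_integrable.
Qed.

Lemma skeleton_integrableZ (r : R) F : skeleton_integrable F ->
  skeleton_integrable (fun x => r * F x).
Proof.
move=> iF l ll; have := integrableZl measurableT r (iF l ll).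
exact: eq_integrable.
Qed.

Lemma skeleton_integrable0 : skeleton_integrable (fun=> 0).
Proof. by move=> l _; exact: integrable0. Qed.

Lemma skeleton_integrable_sum (I : Type) (s : seq I) (P : pred I)
    (F : I -> R * R -> R) : (forall i, P i -> skeleton_integrable (F i)) ->
  skeleton_integrable (fun x => \sum_(i <- s | P i) F i x).
Proof.
move=> iF; elim: s => [|i s IH].
  by under eq_fun do rewrite big_nil; exact: skeleton_integrable0.
have -> : (fun x => \sum_(j <- i :: s | P j) F j x) =
    (fun x => if P i then F i x + \sum_(j <- s | P j) F j x
              else \sum_(j <- s | P j) F j x).
  by apply/funext => x; rewrite big_cons.
case: (boolP (P i)) => [Pi|_]; last exact: IH.
by apply: skeleton_integrableD; [exact: iF|exact: IH].
Qed.

Lemma skeleton_intD F G : skeleton_integrable F -> skeleton_integrable G ->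
  skeleton_int (fun x => F x + G x) = skeleton_int F + skeleton_int G.
Proof.
move=> iF iG; rewrite /skeleton_int -big_split /= big_seq_cond [RHS]big_seq_cond.
by apply: eq_bigr => l /andP[ll _]; rewrite RintegralD //; [exact: iF|exact: iG].
Qed.

Lemma skeleton_intZ (r : R) F : skeleton_integrable F ->
  skeleton_int (fun x => r * F x) = r * skeleton_int F.
Proof.
move=> iF; rewrite /skeleton_int mulr_sumr big_seq_cond [RHS]big_seq_cond.
by apply: eq_bigr => l /andP[ll _]; rewrite RintegralZl //; exact: iF.
Qed.

Lemma skeleton_int0 : skeleton_int (fun=> 0) = 0.
Proof. by rewrite /skeleton_int big1 // => l _; rewrite Rintegral_cst // mul0r. Qed.

Lemma skeleton_int_sum (I : Type) (s : seq I) (P : pred I)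
    (F : I -> R * R -> R) : (forall i, P i -> skeleton_integrable (F i)) ->
  skeleton_int (fun x => \sum_(i <- s | P i) F i x) =
  \sum_(i <- s | P i) skeleton_int (F i).
Proof.
move=> iF; elim: s => [|i s IH].
  by under [in LHS]eq_fun do rewrite big_nil; rewrite big_nil skeleton_int0.
under [in LHS]eq_fun do rewrite big_cons; rewrite big_cons.
have [Pi|//] := boolP (P i); rewrite skeleton_intD ?IH //; first exact: iF.
exact: skeleton_integrable_sum.
Qed.

Lemma skeleton_int_ge0 F : skeleton_integrable F ->
  (forall x, regular D x -> 0 <= F x) -> 0 <= skeleton_int F.
Proof.
move=> iF F0; rewrite /skeleton_int big_seq_cond; apply: sumr_ge0 => l /andP[ll _].
apply: (Rintegral_cofinite_ge0 (skeleton_cofinite ll)); first exact: iF.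
by move=> s /= /contrapT; exact: F0.
Qed.

Lemma skeleton_normal l K : l \in skeleton_lines D -> exists n : R * R,
  forall s : R, regular D (pt l s) -> bdry (cell K) (pt l s) ->
    normal K (pt l s) = n.
Proof.
case/skeleton_linesP => [[i il E]|[j jl E]|E].
- exists (if i == K.1 then -1 else 1, 0) => s rs bs.
  by apply: cell_normal_vertical => //; apply: regular_vertical; rewrite // E.
- exists (0, if j == K.2 then -1 else 1) => s rs bs.
  by apply: cell_normal_horizontal => //; apply: regular_horizontal; rewrite // E.
- exists (S, - C) => s rs bs.
  apply: cell_normal_ramp => //; apply: regular_on_ramp => //.
  by rewrite E; exact: on_rampE.
Qed.

(** Integrands involve outer normals, of which no measurability is known a
    priori.  Along one skeleton line the normal of a cell is constant at the
    regular points of its boundary, so that the integrands are there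
    restrictions of continuous functions; this class is stable under algebraic
    operations. *)
Definition tame e f := forall l, l \in skeleton_lines D ->
  exists2 h : R -> R, continuous h &
    forall s, regular D (pt l s) -> e (pt l s) -> f (pt l s) = h s.

Lemma eq_tame e f F : (forall x, regular D x -> e x -> F x = f x) ->
  tame e f -> tame e F.
Proof.
move=> E tf l /tf[h ch H]; exists h => // s rs es.
by rewrite E //; exact: H.
Qed.

Lemma tame_cst e (r : R) : tame e (fun=> r).
Proof. by move=> l _; exists (fun=> r) => // s; exact: cvg_cst. Qed.

Lemma tameD e f F : tame e f -> tame e F -> tame e (fun x => f x + F x).
Proof.
move=> tf tF l ll; have [h ch H] := tf l ll; have [k ck G] := tF l ll.
exists (fun s => h s + k s); first by move=> s; apply: cvgD; [exact: ch|exact: ck].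
by move=> s rs es; rewrite H // G.
Qed.

Lemma tameM e f F : tame e f -> tame e F -> tame e (fun x => f x * F x).
Proof.
move=> tf tF l ll; have [h ch H] := tf l ll; have [k ck G] := tF l ll.
exists (fun s => h s * k s); first by move=> s; apply: cvgM; [exact: ch|exact: ck].
by move=> s rs es; rewrite H // G.
Qed.

Lemma tame_norm e f : tame e f -> tame e (fun x => `|f x|).
Proof.
move=> tf l ll; have [h ch H] := tf l ll.
exists (fun s => `|h s|); last by move=> s rs es; rewrite H.
by move=> s; apply: cvg_norm; exact: ch.
Qed.

Lemma tameN e f : tame e f -> tame e (fun x => - f x).
Proof.
move=> tf; apply: (@eq_tame _ (fun x => -1 * f x)); first by move=> x _ _; rewrite mulN1r.
by apply: tameM => //; exact: tame_cst.
Qed.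

Lemma tame_beval e q : tame e (beval q).
Proof.
move=> l ll; exists (fun s => beval q (pt l s)) => //.
have E s : pt l s = (l.1.1 + s * l.2.1, l.1.2 + s * l.2.2) by [].
under eq_fun do rewrite E.
apply: continuous_beval => s; (apply: cvgD; first exact: cvg_cst);
  by apply: cvgM; [exact: cvg_id|exact: cvg_cst].
Qed.

Lemma tame_normal K e : e `<=` bdry (cell K) ->
  tame e (fun x => (normal K x).1) /\ tame e (fun x => (normal K x).2).
Proof.
move=> eK; split=> l /(@skeleton_normal _ K)[n H].
  exists (fun=> n.1) => [s|s rs /eK es]; [exact: cvg_cst|by rewrite H].
exists (fun=> n.2) => [s|s rs /eK es]; [exact: cvg_cst|by rewrite H].
Qed.

Lemma tame_flux (beta : R * R) K e : e `<=` bdry (cell K) ->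
  tame e (fun x => dot beta (normal K x)).
Proof.
move=> /tame_normal[t1 t2]; apply: tameD; apply: tameM => //; exact: tame_cst.
Qed.

Lemma measurable_section e l : closed e ->
  measurable ([set s : R | e (pt l s)] : set (measurableTypeR R)).
Proof.
move=> ce; apply: closed_measurable.
apply: (@closed_comp _ _ (fun s : R => pt l s) e) => // s _.
apply: cvgD; first exact: cvg_cst.
by apply: cvgZr_tmp; exact: cvg_id.
Qed.

Lemma skeleton_section_bounded e (M : R) l : l \in skeleton_lines D ->
  (forall x, e x -> `|x.1| <= M /\ `|x.2| <= M) ->
  exists B : R, [set s : R | e (pt l s)] `<=` `[- B, B]%classic.
Proof.
have c0 := cos_angle_gt0 D.
move=> ll eM; case/skeleton_linesP: ll => [[i il E]|[j jl E]|E].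
- by exists M => s /= /eM; rewrite E in_itv /= -ler_norml => -[].
- by exists M => s /= /eM; rewrite E in_itv /= -ler_norml => -[].
exists ((M + `|foot D|) / C) => s /= /eM; rewrite E in_itv /= -ler_norml => -[h _].
rewrite ler_pdivlMr // -{1}(gtr0_norm c0) -normrM.
have -> : s * C = (foot D + C * s) - foot D by ring.
by apply: (le_trans (ler_normB _ _)); rewrite lerD2r.
Qed.

Lemma skeleton_integrable_tame e f (M : R) : closed e ->
  (forall x, e x -> `|x.1| <= M /\ `|x.2| <= M) -> tame e f ->
  skeleton_integrable (f \_ e).
Proof.
move=> ce eM tf l ll; have [h ch H] := tf l ll.
have [B eB] := skeleton_section_bounded ll eM.
apply: (integrable_cofinite (skeleton_cofinite ll) _
  (integrable_patch (measurable_section l ce) eB ch)).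
move=> s /= /contrapT rs; rewrite !patchE.
have -> : (s \in [set s | e (pt l s)]) = (pt l s \in e) by [].
by case: ifPn => //; rewrite inE => es; exact: H.
Qed.

Lemma cell_bounded K : exists M, forall x, cell K x -> `|x.1| <= M /\ `|x.2| <= M.
Proof.
exists (`|gx D K.1| + `|gx D K.1.+1| + `|gy D K.2| + `|gy D K.2.+1|) => x.
rewrite cellE => -[[/andP[h1 h2] /andP[h3 h4]] _].
have := ler_norm (gx D K.1); have := ler_norm (gx D K.1.+1).
have := ler_norm (gy D K.2); have := ler_norm (gy D K.2.+1).
have := ler_norm (- gx D K.1); have := ler_norm (- gx D K.1.+1).
have := ler_norm (- gy D K.2); have := ler_norm (- gy D K.2.+1).
have := normr_ge0 (gx D K.1); have := normr_ge0 (gx D K.1.+1).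
have := normr_ge0 (gy D K.2); have := normr_ge0 (gy D K.2.+1).
rewrite !normrN => *; rewrite !ler_norml; split; apply/andP; split; lra.
Qed.

Lemma closed_bdry e : closed (bdry e).
Proof. by apply: closedI; [exact: closed_closure|exact/open_closedC/open_interior]. Qed.

Lemma skeleton_integrable_cell K e f : closed e -> e `<=` bdry (cell K) ->
  tame e f -> skeleton_integrable (f \_ e).
Proof.
move=> ce eK; have [M HM] := cell_bounded K.
by apply: (skeleton_integrable_tame (M := M)) => // x /eK /bdry_cellP[/HM].
Qed.

(** Faces of zero length may thus be added to the sums over faces, which frees
    the pointwise argument from the condition that faces have positive length. *)
Lemma arc_length0 K e f : closed e -> e `<=` bdry (cell K) -> tame e f ->
  ~~ (0 < arc_length D e) -> arc_int D e f = 0.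
Proof.
move=> ce eK tf al; rewrite /arc_int big_seq; apply: big1 => l ll.
have mE := measurable_section l ce.
have [M HM] := cell_bounded K.
have [B eB] := skeleton_section_bounded ll (fun x h => HM x (bdry_cellP (eK _ h)).1).
have Efin : (mu [set s : R | e (pt l s)] < +oo)%E.
  apply: (@le_lt_trans _ _ (mu `[- B, B]%classic)).
    by apply: le_measure => //; rewrite inE //; exact: measurable_itv.
  by rewrite lebesgue_measure_itv /=; case: ifP => // _; rewrite -EFinD ltry.
have E0 : mu [set s : R | e (pt l s)] = 0%E.
  have L k : k \in skeleton_lines D ->
      0 <= \int[mu]_(s in [set s : R | e (pt k s)]) (1 : R).
    by move=> _; apply: Rintegral_ge0.
  have : arc_length D e = 0.
    apply/eqP; rewrite eq_le leNgt al /= /arc_length /arc_int big_seq.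
    by apply: sumr_ge0; exact: L.
  rewrite /arc_length /arc_int big_seq => /eqP; rewrite psumr_eq0 //.
  move=> /allP /(_ l ll); rewrite ll /= => /eqP.
  rewrite Rintegral_cst // mul1r => h.
  by rewrite -[LHS]fineK ?h // ge0_fin_numE.
have := skeleton_integrable_cell ce eK tf ll.
move=> /(measurable_int _) mf; rewrite Rintegral_mkcond.
have [h ch H] := tf l ll.
have := Rintegral_cofinite (f := fun s => (f \_ e) (pt l s))
  (g := h \_ [set s : R | e (pt l s)]) (skeleton_cofinite ll).
rewrite -[(fun s => f (pt l s)) \_ _]/(fun s => (f \_ e) (pt l s)) => ->.
- rewrite -Rintegral_mkcond /Rintegral null_set_integral //.
  by apply/measurable_EFinP; apply: measurable_funTS; exact: continuous_measurable_fun.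
- exact/measurable_EFinP.
- by have /measurable_EFinP := measurable_int _ (integrable_patch mE eB ch).
move=> s /= /contrapT rs; rewrite !patchE.
have -> : (s \in [set s | e (pt l s)]) = (pt l s \in e) by [].
by case: ifPn => //; rewrite inE => es; exact: H.
Qed.

End Skeleton.

(** * The divergence theorem on a cell *)

Section CellDivergence.
Context {R : realType} (D : ramp_geometry R).
Notation mu := (@lebesgue_measure R).
Variables (beta : R * R) (c : R).
Hypothesis beta_ramp : beta = c *: ramp_dir D.
Implicit Types (K : cell_id D) (q v : {poly {poly R}}).

Local Notation S := (sin (angle D)).
Local Notation C := (cos (angle D)).

Let betaE : beta = (c * C, c * S).
Proof. by rewrite beta_ramp. Qed.

Lemma ramp_flux0 x K : ramp_regular D x -> bdry (cell K) x ->
  dot beta (normal K x) = 0.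
Proof. by move=> rx bx; rewrite (cell_normal_ramp rx bx) betaE /dot /=; ring. Qed.

Lemma integrable_cell K q : (@area_measure R).-integrable (cell K) (EFin \o beval q).
Proof.
rewrite cellE; apply: integrable_cut_rectangle; first exact: cell_gx_lt.
exact: cell_gy_lt.
Qed.

Lemma measurable_cell K :
  measurable (cell K : set (measurableTypeR R * measurableTypeR R)).
Proof. by rewrite cellE; exact: measurable_cut_rectangle. Qed.

Lemma integrable_dot_bgrad K q :
  (@area_measure R).-integrable (cell K) (EFin \o (fun x => dot beta (bgrad q x))).
Proof.
have mK := measurable_cell K.
have := integrableD mK (integrableZl mK beta.1 (integrable_cell K q^`()))
  (integrableZl mK beta.2 (integrable_cell K (map_poly (@deriv R) q))).
exact: eq_integrable.
Qed.

Lemma cell_edge_bdry K x : cell K x ->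
  [\/ x.1 = gx D K.1, x.1 = gx D K.1.+1, x.2 = gy D K.2 | x.2 = gy D K.2.+1] ->
  bdry (cell K) x.
Proof.
move=> Kx h; split; first exact: subset_closure.
rewrite interior_cell => -[[/andP[h1 h2] /andP[h3 h4]] _].
by case: h => E; move: h1 h2 h3 h4; rewrite E ltxx.
Qed.

Let sum_pick n (F : nat -> R) k : (k < n)%N ->
  \sum_(i < n) (i == k :> nat)%:R * F i = F k.
Proof.
move=> kn; rewrite (bigD1 (Ordinal kn)) //= eqxx mul1r big1 ?addr0 // => i ik.
by rewrite (_ : (i == k :> nat) = false) ?mul0r //; apply: negPf.
Qed.

(* The nonzero component of the normal of a cell in column (or row) k along the
   grid line i, and 0 on the grid lines off the cell. *)
Let edge_sign (i k : nat) : R := (i == k.+1)%:R - (i == k)%:R.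

Let edge_signE i k : i = k \/ i = k.+1 -> edge_sign i k = if i == k then -1 else 1.
Proof.
case=> ->; rewrite /edge_sign eqxx; first by rewrite ltn_eqF // sub0r.
by rewrite gtn_eqF // subr0.
Qed.

(** The divergence theorem of the cut rectangle, rewritten with the normals: only
    the four grid lines through the sides of the cell carry flux, since the
    normal on the ramp is orthogonal to beta. *)
Lemma cell_divergence K q :
  \int[area_measure]_(x in cell K) dot beta (bgrad q x) =
  arc_int D (bdry (cell K)) (fun x => dot beta (normal K x) * beval q x).
Proof.
set F := fun x => _ * _; rewrite arc_intE skeleton_intE.
have mK := measurable_cell K.
have -> : \int[area_measure]_(x in cell K) dot beta (bgrad q x) =
    c * (C * \int[area_measure]_(x in cell K) (bgrad q x).1
         + S * \int[area_measure]_(x in cell K) (bgrad q x).2).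
  rewrite {1}betaE /dot /= RintegralD //.
  - by rewrite !RintegralZl; [ring|done|exact: integrable_cell..|done|exact: integrable_cell].
  - by have := integrableZl mK (c * C) (integrable_cell K q^`()); apply: eq_integrable.
  - have := integrableZl mK (c * S) (integrable_cell K (map_poly (@deriv R) q)).
    exact: eq_integrable.
rewrite cellE cut_rectangle_divergence; [|exact: cell_gx_lt|exact: cell_gy_lt|
  exact: cos_angle_gt0|exact: sin_angle_gt0].
rewrite -!cellE.
have iF : skeleton_integrable D (F \_ (bdry (cell K))).
  apply: (@skeleton_integrable_cell _ _ K) => //; first exact: closed_bdry.
  by apply: tameM; [exact: tame_flux|exact: tame_beval].
have mF l : l \in skeleton_lines D ->
    measurable_fun [set: measurableTypeR R] (fun s : R => (F \_ (bdry (cell K))) (l.1 + s *: l.2)).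
  by move=> ll; have /measurable_EFinP := measurable_int _ (iF l ll).
have [M HM] := cell_bounded K.
have vert i : (i < (nx D).+1)%N -> \int[mu]_s (F \_ (bdry (cell K))) (gx D i, s) =
    edge_sign i K.1 * (c * C * \int[mu]_(s in [set s | cell K (gx D i, s)])
      beval q (gx D i, s)).
  move=> il; pose l := ((gx D i, 0), (0, 1)) : (R * R) * (R * R).
  have ll : l \in skeleton_lines D.
    by rewrite !mem_cat; apply/orP; left; apply/mapP; exists i; rewrite // mem_iota.
  have lE (s : R) : l.1 + s *: l.2 = (gx D i, s).
    by congr (_, _); rewrite /= /GRing.scale /=; ring.
  have E (T : Type) (G : R * R -> T) :
      (fun s : R => G (l.1 + s *: l.2)) = (fun s : R => G (gx D i, s)).
    by apply/funext => s; rewrite lE.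
  have fin := skeleton_cofinite ll; have mFl := mF l ll.
  have ms : measurable ([set s | cell K (gx D i, s)] : set (measurableTypeR R)).
    have := measurable_section l (@closed_cell _ D K).
    by congr (measurable _); exact: (E _ (cell K)).
  have bs : [set s | cell K (gx D i, s)] `<=` `[- M, M]%classic.
    by move=> s /= /HM[_ /=]; rewrite in_itv /= ler_norml.
  have cq : continuous (fun s => beval q (gx D i, s)).
    by apply: continuous_beval => t; [exact: cvg_cst|exact: cvg_id].
  have ip := integrable_patch ms bs cq.
  rewrite [in RHS]Rintegral_mkcond -RintegralZl // -RintegralZl //; last first.
    by have := integrableZl measurableT (c * C) ip; apply: eq_integrable.
  apply: (Rintegral_cofinite fin).
  - by rewrite -(E _ (F \_ (bdry (cell K)))).
  - apply/measurable_EFinP.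
    have := integrableZl measurableT (edge_sign i K.1)
      (integrableZl measurableT (c * C) ip).
    exact: measurable_int.
  move=> s /= /contrapT; rewrite lE => /(@regular_vertical _ D i (gx D i, s) il erefl) vr.
  rewrite !patchE.
  have -> : (s \in [set s | cell K (gx D i, s)]) = ((gx D i, s) \in cell K) by [].
  case: ifPn => [|/negP]; rewrite inE => bx.
    have [iK _ _] := (cell_bdry_vertical K vr).1 bx.
    rewrite mem_set; last exact: (bdry_cellP bx).1.
    rewrite /F (cell_normal_vertical vr bx) edge_signE // betaE /dot /=; ring.
  case: ifPn; last by rewrite -![point]/(0 : R) !mulr0.
  rewrite inE => Kx; have [iK|/eqP iK] := eqVneq i K.1.
    by case: bx; apply: cell_edge_bdry => //; rewrite /= iK; constructor 1.
  have [iK1|/eqP iK1] := eqVneq i K.1.+1.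
    by case: bx; apply: cell_edge_bdry => //; rewrite /= iK1; constructor 2.
  by rewrite /edge_sign (negPf (introN eqP iK)) (negPf (introN eqP iK1)) subr0 mul0r.
have horiz j : (j < (ny D).+1)%N -> \int[mu]_s (F \_ (bdry (cell K))) (s, gy D j) =
    edge_sign j K.2 * (c * S * \int[mu]_(s in [set s | cell K (s, gy D j)])
      beval q (s, gy D j)).
  move=> jl; pose l := ((0, gy D j), (1, 0)) : (R * R) * (R * R).
  have ll : l \in skeleton_lines D.
    rewrite !mem_cat; apply/orP; right; apply/orP; left; apply/mapP.
    by exists j; rewrite // mem_iota.
  have lE (s : R) : l.1 + s *: l.2 = (s, gy D j).
    by congr (_, _); rewrite /= /GRing.scale /=; ring.
  have E (T : Type) (G : R * R -> T) :
      (fun s : R => G (l.1 + s *: l.2)) = (fun s : R => G (s, gy D j)).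
    by apply/funext => s; rewrite lE.
  have fin := skeleton_cofinite ll; have mFl := mF l ll.
  have ms : measurable ([set s | cell K (s, gy D j)] : set (measurableTypeR R)).
    have := measurable_section l (@closed_cell _ D K).
    by congr (measurable _); exact: (E _ (cell K)).
  have bs : [set s | cell K (s, gy D j)] `<=` `[- M, M]%classic.
    by move=> s /= /HM[/= + _]; rewrite in_itv /= ler_norml.
  have cq : continuous (fun s => beval q (s, gy D j)).
    by apply: continuous_beval => t; [exact: cvg_id|exact: cvg_cst].
  have ip := integrable_patch ms bs cq.
  rewrite [in RHS]Rintegral_mkcond -RintegralZl // -RintegralZl //; last first.
    by have := integrableZl measurableT (c * S) ip; apply: eq_integrable.
  apply: (Rintegral_cofinite fin).
  - by rewrite -(E _ (F \_ (bdry (cell K)))).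
  - apply/measurable_EFinP.
    have := integrableZl measurableT (edge_sign j K.2)
      (integrableZl measurableT (c * S) ip).
    exact: measurable_int.
  move=> s /= /contrapT; rewrite lE => /(@regular_horizontal _ D j (s, gy D j) jl erefl) hr.
  rewrite !patchE.
  have -> : (s \in [set s | cell K (s, gy D j)]) = ((s, gy D j) \in cell K) by [].
  case: ifPn => [|/negP]; rewrite inE => bx.
    have [jK _ _] := (cell_bdry_horizontal K hr).1 bx.
    rewrite mem_set; last exact: (bdry_cellP bx).1.
    rewrite /F (cell_normal_horizontal hr bx) edge_signE // betaE /dot /=; ring.
  case: ifPn; last by rewrite -![point]/(0 : R) !mulr0.
  rewrite inE => Kx; have [jK|/eqP jK] := eqVneq j K.2.
    by case: bx; apply: cell_edge_bdry => //; rewrite /= jK; constructor 3.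
  have [jK1|/eqP jK1] := eqVneq j K.2.+1.
    by case: bx; apply: cell_edge_bdry => //; rewrite /= jK1; constructor 4.
  by rewrite /edge_sign (negPf (introN eqP jK)) (negPf (introN eqP jK1)) subr0 mul0r.
have -> : \int[mu]_s (F \_ (bdry (cell K))) (foot D + C * s, gy D 0%N + S * s) = 0.
  pose l := (ramp_foot D, ramp_dir D).
  have ll : l \in skeleton_lines D by rewrite !mem_cat mem_seq1 eqxx !orbT.
  have lE (s : R) : l.1 + s *: l.2 = (foot D + C * s, gy D 0%N + S * s).
    by congr (_, _); rewrite /= /GRing.scale /=; ring.
  have E : (fun s : R => (F \_ (bdry (cell K))) (l.1 + s *: l.2)) =
      (fun s : R => (F \_ (bdry (cell K))) (foot D + C * s, gy D 0%N + S * s)).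
    by apply/funext => s; rewrite lE.
  rewrite (Rintegral_cofinite (g := fun=> 0) (skeleton_cofinite ll)) //.
  - by rewrite Rintegral_cst // mul0r.
  - by rewrite -E; exact: mF.
  move=> s /= /contrapT rs; rewrite patchE; case: ifPn => //; rewrite inE => bx.
  rewrite lE in rs.
  rewrite /F ramp_flux0 ?mul0r //; apply: regular_on_ramp rs; exact: on_rampE.
rewrite addr0.
under eq_bigr => i _ do rewrite vert //.
under [X in _ = _ + X]eq_bigr => j _ do rewrite horiz //.
have split_sign n (G : nat -> R) k : (k < n)%N ->
    \sum_(i < n.+1) edge_sign i k * G i = G k.+1 - G k.
  move=> kn; under eq_bigr => i _ do rewrite /edge_sign mulrBl.
  by rewrite sumrB !sum_pick // ltnW.
rewrite (split_sign _ (fun i => c * C * \int[mu]_(s in [set s | cell K (gx D i, s)])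
  beval q (gx D i, s))) //.
rewrite (split_sign _ (fun j => c * S * \int[mu]_(s in [set s | cell K (s, gy D j)])
  beval q (s, gy D j))) //.
ring.
Qed.

(** [v <beta, grad v>] is half the divergence of [beta v^2]. *)
Lemma cell_divergence_sqr K v :
  \int[area_measure]_(x in cell K) (beval v x * dot beta (bgrad v x)) =
  1 / 2 * arc_int D (bdry (cell K)) (fun x => dot beta (normal K x) * beval v x ^+ 2).
Proof.
have := cell_divergence K (v * v).
under [in RHS]eq_fun do rewrite bevalM -expr2.
move=> <-; rewrite -RintegralZl //; last 2 first.
- exact: measurable_cell.
- exact: integrable_dot_bgrad.
by apply: eq_Rintegral => x _; rewrite dot_bgradM; field.
Qed.

End CellDivergence.

(** * Triangular cut cells *)

Section TriangularCutCells.
Context {R : realType} (D : ramp_geometry R).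
Implicit Types (K : cell_id D) (x y a b c : R * R).

Local Notation S := (sin (angle D)).
Local Notation C := (cos (angle D)).

Lemma ramp_on_ramp x : ramp D x -> on_ramp D x.
Proof. by move=> [s _ ->]; rewrite /on_ramp /= /GRing.scale /=; ring. Qed.

Lemma on_ramp_fst x y : on_ramp D x -> on_ramp D y -> x.1 = y.1 -> x = y.
Proof.
case: x y => [x1 x2] [y1 y2]; rewrite /on_ramp /= => hx hy E; congr (_, _) => //.
have cn0 : C != 0 by rewrite gt_eqF // cos_angle_gt0.
by move: hx; rewrite E hy => /(mulIf cn0) /(addIr _).
Qed.

Lemma on_ramp_snd x y : on_ramp D x -> on_ramp D y -> x.2 = y.2 -> x = y.
Proof.
case: x y => [x1 x2] [y1 y2]; rewrite /on_ramp /= => hx hy E; congr (_, _) => //.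
have sn0 : S != 0 by rewrite gt_eqF // sin_angle_gt0.
by move: hx; rewrite E -hy => /(mulIf sn0) /(addIr _).
Qed.

Lemma on_rampP x : on_ramp D x <-> dot (S, - C) (x - ramp_foot D) = 0.
Proof.
have -> : dot (S, - C) (x - ramp_foot D) =
    (x.1 - foot D) * S - (x.2 - gy D 0%N) * C by rewrite /dot /=; ring.
by split=> [->|/eqP]; [rewrite subrr|rewrite subr_eq0 => /eqP].
Qed.

Lemma triangle_vertices a b c :
  [/\ triangle a b c a, triangle a b c b & triangle a b c c].
Proof.
split; [exists 1, 0, 0|exists 0, 1, 0|exists 0, 0, 1]; split=> //;
  rewrite ?addr0 ?add0r // !scale0r scale1r ?addr0 ?add0r //.
Qed.

Lemma triangle_rot a b c : triangle b a c = triangle a b c.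
Proof.
apply/seteqP; split=> x [r [s [t [r0 s0 t0 rst ->]]]];
  by exists s, r, t; split=> //; [rewrite [s + r]addrC|rewrite [s *: _ + _]addrC].
Qed.

Lemma segment_sym a b : segment a b = segment b a.
Proof.
apply/seteqP; split=> x [s /andP[s0 s1] ->]; exists (1 - s);
  rewrite ?subr_ge0 ?s1 ?lerBlDr ?lerDl ?s0 // opprB addrC subrKC addrC //.
Qed.

Lemma segment_ends a b : segment a b a /\ segment a b b.
Proof.
split; [exists 0|exists 1]; rewrite ?lexx ?ler01 // ?subr0 ?subrr;
  by rewrite scale1r scale0r ?addr0 ?add0r.
Qed.

Lemma mesh_triangle_not_flat K a b c nu (w : R) : K \in mesh D ->
  cell K = triangle a b c -> dot nu nu != 0 ->
  dot nu a = w -> dot nu b = w -> dot nu c = w -> False.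
Proof.
move=> /in_mesh[z Kz] KT nu0 ha hb hc.
have flat y : cell K y -> dot nu y = w.
  rewrite KT => -[r [s [t [_ _ _ rst ->]]]].
  by rewrite !dotDr !dotZr ha hb hc -!mulrDl rst mul1r.
have [t t0 /(_ t)] := nbhs_ray nu (open_cut_rectangle_nbhs Kz).
rewrite lexx (ltW t0) => /(_ isT) /open_cell_sub /flat.
rewrite dotDr dotZr (flat z (open_cell_sub Kz)) => /eqP.
by rewrite -subr_eq0 addrAC subrr add0r mulf_eq0 (negPf nu0) gt_eqF.
Qed.

Let flat_of_max (ra rb rc fa fb fc w : R) : 0 < ra -> 0 < rb -> 0 < rc ->
  ra + rb + rc = 1 -> fa <= w -> fb <= w -> fc <= w ->
  ra * fa + rb * fb + rc * fc = w -> [/\ fa = w, fb = w & fc = w].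
Proof.
move=> ra0 rb0 rc0 r1 ha hb hc h.
have : ra * (w - fa) + rb * (w - fb) + rc * (w - fc) = 0.
  rewrite (_ : _ + _ = (ra + rb + rc) * w - (ra * fa + rb * fb + rc * fc)); last by ring.
  by rewrite r1 h mul1r subrr.
move/eqP; rewrite !paddr_eq0 ?addr_ge0 ?mulr_ge0 ?subr_ge0 ?(ltW ra0) ?(ltW rb0) ?(ltW rc0) //.
rewrite !mulf_eq0 (gt_eqF ra0) (gt_eqF rb0) (gt_eqF rc0) /= !subr_eq0.
by move=> /andP[/andP[/eqP <- /eqP <-] /eqP <-].
Qed.

(** At a boundary point one of the affine constraints of the cell is active.  If
    the barycentric coordinates were all positive, the constraint would be
    active at the three vertices and the triangle would be flat. *)
Lemma bdry_triangle K a b c x : K \in mesh D -> cell K = triangle a b c ->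
  bdry (cell K) x -> [\/ segment a b x, segment b c x | segment c a x].
Proof.
move=> mK KT /bdry_cellP[Kx nKox].
have [Ta Tb Tc] := triangle_vertices a b c; rewrite -KT in Ta Tb Tc.
have [r [s [t [r0 s0 t0 rst xE]]]] : triangle a b c x by rewrite -KT.
have [tz|tn] := eqVneq t 0.
  constructor 1; exists s; first by rewrite s0 /=; lra.
  rewrite xE tz scale0r addr0; congr (_ *: _ + _); lra.
have [rz|rn] := eqVneq r 0.
  constructor 2; exists t; first by rewrite t0 /=; lra.
  rewrite xE rz scale0r add0r; congr (_ *: _ + _); lra.
have [sz|sn] := eqVneq s 0.
  constructor 3; exists r; first by rewrite r0 /=; lra.
  rewrite xE sz scale0r addr0 addrC; congr (_ *: _ + _); lra.
have r0' : 0 < r by rewrite lt_neqAle eq_sym rn.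
have s0' : 0 < s by rewrite lt_neqAle eq_sym sn.
have t0' : 0 < t by rewrite lt_neqAle eq_sym tn.
have strict nu w : dot nu nu != 0 -> (forall y, cell K y -> dot nu y <= w) -> dot nu x < w.
  move=> nu0 Hw; rewrite lt_neqAle Hw // andbT; apply/eqP => h.
  have [] := flat_of_max r0' s0' t0' rst (Hw _ Ta) (Hw _ Tb) (Hw _ Tc).
    by rewrite -h xE !dotDr !dotZr.
  exact: mesh_triangle_not_flat KT nu0.
have d1 : dot (1, 0) (1, 0) != 0 :> R by rewrite /dot /= mulr0 addr0 mul1r oner_eq0.
have d2 : dot (-1, 0) (-1, 0) != 0 :> R by rewrite /dot /= mulr0 addr0 mulrNN mul1r oner_eq0.
have d3 : dot (0, 1) (0, 1) != 0 :> R by rewrite /dot /= mulr0 add0r mul1r oner_eq0.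
have d4 : dot (0, -1) (0, -1) != 0 :> R by rewrite /dot /= mulr0 add0r mulrNN mul1r oner_eq0.
have d5 : dot (S, - C) (S, - C) != 0 :> R.
  by rewrite /dot /= mulrNN sin_cos_angle oner_eq0.
case: nKox; move: strict; rewrite cellE => strict; split; [split; apply/andP; split|].
- have := strict (-1, 0) (- gx D K.1) d2; rewrite /dot /= => h; rewrite -ltrN2.
  suff: -1 * x.1 + 0 * x.2 < - gx D K.1 by lra.
  by apply: h => y [[/andP[h1 _] _] _]; lra.
- have := strict (1, 0) (gx D K.1.+1) d1; rewrite /dot /= => h.
  suff: 1 * x.1 + 0 * x.2 < gx D K.1.+1 by lra.
  by apply: h => y [[/andP[_ h1] _] _]; lra.
- have := strict (0, -1) (- gy D K.2) d4; rewrite /dot /= => h; rewrite -ltrN2.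
  suff: 0 * x.1 + -1 * x.2 < - gy D K.2 by lra.
  by apply: h => y [[_ /andP[h1 _]] _]; lra.
- have := strict (0, 1) (gy D K.2.+1) d3; rewrite /dot /= => h.
  suff: 0 * x.1 + 1 * x.2 < gy D K.2.+1 by lra.
  by apply: h => y [[_ /andP[_ h1]] _]; lra.
- have := strict (S, - C) (foot D * S - gy D 0%N * C) d5; rewrite /dot /= => h.
  suff: S * x.1 + - C * x.2 < foot D * S - gy D 0%N * C by lra.
  by apply: h => y [_ h1]; lra.
Qed.

Lemma face_sym K1 K2 : face K1 K2 = face K2 K1.
Proof. exact: setIC. Qed.

(** Two background cells are separated by a grid line, which contains their
    common face. *)
Lemma face_axis K1 K2 : K1 != K2 ->
  (exists2 i, (i <= nx D)%N & forall x, face K1 K2 x -> x.1 = gx D i) \/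
  (exists2 j, (j <= ny D)%N & forall x, face K1 K2 x -> x.2 = gy D j).
Proof.
move=> ne.
have inface x : face K1 K2 x -> cell K1 x /\ cell K2 x.
  by move=> [/bdry_cellP[? _] /bdry_cellP[? _]].
have [lt|lt|E1] := ltngtP K1.1 K2.1.
- left; exists K2.1; first exact: ltnW.
  move=> x /inface; rewrite !cellE => -[[[/andP[_ h1] _] _] [[/andP[h2 _] _] _]].
  have := @grid_le _ _ _ (@gx_incr _ D) K1.1.+1 K2.1; rewrite lt ltnW // => /(_ isT); lra.
- left; exists K1.1; first exact: ltnW.
  move=> x /inface; rewrite !cellE => -[[[/andP[h2 _] _] _] [[/andP[_ h1] _] _]].
  have := @grid_le _ _ _ (@gx_incr _ D) K2.1.+1 K1.1; rewrite lt ltnW // => /(_ isT); lra.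
have [lt|lt|E2] := ltngtP K1.2 K2.2.
- right; exists K2.2; first exact: ltnW.
  move=> x /inface; rewrite !cellE => -[[[_ /andP[_ h1]] _] [[_ /andP[h2 _]] _]].
  have := @grid_le _ _ _ (@gy_incr _ D) K1.2.+1 K2.2; rewrite lt ltnW // => /(_ isT); lra.
- right; exists K1.2; first exact: ltnW.
  move=> x /inface; rewrite !cellE => -[[[_ /andP[h2 _]] _] [[_ /andP[_ h1]] _]].
  have := @grid_le _ _ _ (@gy_incr _ D) K2.2.+1 K1.2; rewrite lt ltnW // => /(_ isT); lra.
case/eqP: ne; case: K1 K2 E1 E2 {inface} => [? ?] [? ?] /= E1 E2.
by congr (_, _); exact: val_inj.
Qed.

(** A stabilized cell seen from its neighbour K': exchanging a and b exchanges
    the inflow and the outflow face, so that both are treated at once. *)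
Definition ramp_triangle K K' a b c : Prop :=
  [/\ K \in mesh D, cell K = triangle a b c, on_ramp D a /\ on_ramp D b,
      K != K' /\ face K K' = segment b c &
      exists2 K2, K != K2 & face K K2 = segment c a].

(** Both faces issued from the vertex c are contained in grid lines; these are
    perpendicular, or the triangle would be flat.  Hence c is a grid vertex. *)
Lemma ramp_triangle_corner K K' a b c : ramp_triangle K K' a b c ->
  ~ regular D c /\
  ((b.1 = c.1 /\ a.2 = c.2) \/ (b.2 = c.2 /\ a.1 = c.1)).
Proof.
move=> [mK KT [ra rb] [ne F] [K2 ne2 F2]].
have flat1 : a.1 = c.1 -> b.1 = c.1 -> False.
  move=> h1 h2; apply: (@mesh_triangle_not_flat K a b c (1, 0) c.1) => //;
    by rewrite /dot /= ?h1 ?h2 ?mulr0 ?addr0 ?mul1r ?mul0r ?oner_eq0 ?addr0.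
have flat2 : a.2 = c.2 -> b.2 = c.2 -> False.
  move=> h1 h2; apply: (@mesh_triangle_not_flat K a b c (0, 1) c.2) => //;
    by rewrite /dot /= ?h1 ?h2 ?mulr0 ?add0r ?mul1r ?mul0r ?oner_eq0 ?add0r.
have [eb ec] := segment_ends b c; rewrite -F in eb ec.
have [ec' ea] := segment_ends c a; rewrite -F2 in ec' ea.
case: (face_axis ne) => [[i il Hi]|[j jl Hj]]; case: (face_axis ne2) => [[k kl Hk]|[k kl Hk]].
- by exfalso; apply: flat1; [rewrite (Hk _ ea) (Hk _ ec')|rewrite (Hi _ eb) (Hi _ ec)].
- split; last by left; rewrite (Hi _ eb) (Hi _ ec) (Hk _ ea) (Hk _ ec').
  move=> /(regular_vertical il (Hi _ ec))[_ _ /(_ k kl)].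
  by rewrite (Hk _ ec') eqxx.
- split; last by right; rewrite (Hj _ eb) (Hj _ ec) (Hk _ ea) (Hk _ ec').
  move=> /(regular_vertical kl (Hk _ ec'))[_ _ /(_ j jl)].
  by rewrite (Hj _ ec) eqxx.
- by exfalso; apply: flat2; [rewrite (Hk _ ea) (Hk _ ec')|rewrite (Hj _ eb) (Hj _ ec)].
Qed.

Lemma ramp_triangle_off K K' a b c : ramp_triangle K K' a b c ->
  dot (S, - C) (c - ramp_foot D) != 0.
Proof.
move=> [mK KT [/on_rampP ra /on_rampP rb] _ _]; apply/eqP => rc.
apply: (@mesh_triangle_not_flat K a b c (S, - C) (dot (S, - C) (ramp_foot D))) => //.
- by rewrite /dot /= mulrNN sin_cos_angle oner_eq0.
- by apply/eqP; rewrite -subr_eq0 -dotBr ra.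
- by apply/eqP; rewrite -subr_eq0 -dotBr rb.
- by apply/eqP; rewrite -subr_eq0 -dotBr rc.
Qed.

(** The shared face determines its end b on the ramp and its other end c, and the
    right angle at c then determines the third vertex, so that both triangles
    are equal. *)
Lemma ramp_triangles_not_adjacent K K' a b c a' b' c' :
  ramp_triangle K K' a b c -> ramp_triangle K' K a' b' c' -> False.
Proof.
move=> T T'; have off := ramp_triangle_off T; have off' := ramp_triangle_off T'.
have [_ corner] := ramp_triangle_corner T; have [_ corner'] := ramp_triangle_corner T'.
case: T => mK KT [ra rb] [ne F] _; case: T' => mK' KT' [ra' rb'] [_ F'] _.
have SE : segment b c = segment b' c' by rewrite -F -F' face_sym.
pose L y := dot (S, - C) (y - ramp_foot D).
have Lb : L b = 0 by exact/on_rampP.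
have Lb' : L b' = 0 by exact/on_rampP.
have Lseg p q s : L ((1 - s) *: p + s *: q) = (1 - s) * L p + s * L q.
  by rewrite /L !dotBr dotDr !dotZr; ring.
have [s s01 cE] : segment b' c' c by rewrite -SE; exact: (segment_ends b c).2.
have [t t01 cE'] : segment b c c' by rewrite SE; exact: (segment_ends b' c').2.
have Lc : L c = s * L c' by rewrite {1}cE Lseg Lb' mulr0 add0r.
have Lc' : L c' = t * L c by rewrite {1}cE' Lseg Lb mulr0 add0r.
have s1 : s = 1.
  have st : s * t = 1.
    apply: (mulIf off); rewrite mul1r -mulrA; change (s * (t * L c) = L c).
    by rewrite -Lc' -Lc.
  case/andP: s01 => s0 sl; case/andP: t01 => t0 tl.
  apply/eqP; rewrite eq_le sl /= -st ler_piMr //.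
have cc : c = c' by rewrite cE s1 subrr scale0r add0r scale1r.
have [r r01 bE] : segment b' c' b by rewrite -SE; exact: (segment_ends b c).1.
have bb : b = b'.
  have : r * L c' = 0.
    by have := congr1 L bE; rewrite Lb Lseg Lb' mulr0 add0r => <-.
  move/eqP; rewrite mulf_eq0 (negPf off') orbF => /eqP r0.
  by rewrite bE r0 subr0 scale0r addr0 scale1r.
clear cE cE' bE; subst b' c'.
have bc : b.1 = c.1 -> b.2 = c.2 -> False.
  move=> h1 h2; case/eqP: off; have -> : c = b.
    by rewrite [RHS]surjective_pairing h1 h2 -surjective_pairing.
  exact: Lb.
have aa : a = a'.
  case: corner corner' => [[h1 h2]|[h1 h2]] [[h3 h4]|[h3 h4]].
  - by apply: on_ramp_snd => //; rewrite h2 h4.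
  - by case: bc.
  - by case: bc.
  - by apply: on_ramp_fst => //; rewrite h2 h4.
have KK : cell K = cell K' by rewrite KT KT' aa.
by move: ne; rewrite (mesh_cell_inj mK KK) eqxx.
Qed.

End TriangularCutCells.

(** * The discrete energy inequality *)

Section Energy.
Context {R : realType} (D : ramp_geometry R).
Variables (beta : R * R) (c : R).
Hypothesis beta_ramp : beta = c *: ramp_dir D.
Variables (p : nat) (dt : R).
Hypothesis dt_gt0 : 0 < dt.
Variables (I : {set cell_id D}) (Ein Eout : cell_id D -> cell_id D).
Hypothesis I_stab : forall K, K \in I ->
  triangular_cut_cell beta K (Ein K) (Eout K).
Variable u : broken_poly D.
Implicit Types (K : cell_id D) (x : R * R).

Local Notation sg K x := (dot beta (normal K x)).
Local Notation U K x := (beval (u K) x).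

Lemma eta_itv K : 0 <= eta beta p dt K <= 1.
Proof.
have n0 y : 0 <= neg_part y :> R.
  by rewrite /neg_part divr_ge0 // subr_ge0 ler_norm.
have cap0 : 0 <= capacity beta dt (1 / (2 * p + 1)%:R) K.
  rewrite /capacity le_min ler01 andbT mulr_ge0 ?divr_ge0 //.
    by rewrite /area fine_ge0.
  rewrite mulr_ge0 ?(ltW dt_gt0) // /arc_int big_seq sumr_ge0 // => l _.
  exact: Rintegral_ge0.
have cap1 : capacity beta dt (1 / (2 * p + 1)%:R) K <= 1 by rewrite /capacity ge_min lexx orbT.
by rewrite /eta subr_ge0 cap1 gerBl.
Qed.

Lemma triangular_ramp_triangle K Kin Kout :
  triangular_cut_cell beta K Kin Kout -> exists a b d,
  [/\ ramp_triangle K Kin a b d, ramp_triangle K Kout b a d &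
    forall x, (segment d a `\` [set d; a]) x -> 0 <= sg K x].
Proof.
move=> [a [b [d [[KT abr] [/and4P[mK _ ne1 _] F1] [/and4P[_ _ ne2 _] F2] _ pos]]]].
have [ea eb] := segment_ends a b.
have ra := ramp_on_ramp (abr _ ea); have rb := ramp_on_ramp (abr _ eb).
exists a, b, d; split=> //.
  by split=> //; exists Kout.
split=> //; first by rewrite triangle_rot.
  by split=> //; rewrite -F2 segment_sym.
by exists Kin; rewrite // -F1 segment_sym.
Qed.

(** The boundary of the triangle consists of the ramp edge, without flux, and the
    two faces, which only meet at a grid vertex.  The sign of the flux through
    the outflow face is unspecified at its ends, but one of them is that grid
    vertex, which is not regular, and the other lies on the ramp. *)
Lemma triangular_faces K x : K \in I -> regular D x -> bdry (cell K) x ->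
  sg K x != 0 ->
  (face K (Ein K) x /\ ~ face K (Eout K) x) \/
  [/\ face K (Eout K) x, ~ face K (Ein K) x & 0 <= sg K x].
Proof.
move=> /I_stab/triangular_ramp_triangle[a [b [d [T1 T2 pos]]]] rx bx sgn0.
have off_ramp : ~ on_ramp D x.
  move=> xr; case/eqP: sgn0; apply: (ramp_flux0 beta_ramp) bx.
  exact: regular_on_ramp.
have [nd corner] := ramp_triangle_corner T1.
case: T1 => mK KT [ra rb] [_ F1] _; case: T2 => _ _ _ [_ F2] _.
rewrite segment_sym in F2.
have disj : segment b d x -> segment d a x -> False.
  move=> [s _ E1] [t _ E2]; apply: nd; rewrite (_ : d = x) //.
  rewrite [LHS]surjective_pairing [RHS]surjective_pairing.
  case: corner => -[h1 h2]; congr (_, _).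
  - by rewrite E1 /= /GRing.scale /= h1; ring.
  - by rewrite E2 /= /GRing.scale /= h2; ring.
  - by rewrite E2 /= /GRing.scale /= h2; ring.
  - by rewrite E1 /= /GRing.scale /= h1; ring.
rewrite F1 F2; case: (bdry_triangle mK KT bx) => h.
- case: off_ramp; case: h => s s01 ->; move: ra rb; rewrite !on_rampP => ra rb.
  have -> : (1 - s) *: a + s *: b - ramp_foot D =
      (1 - s) *: (a - ramp_foot D) + s *: (b - ramp_foot D).
    rewrite !scalerBr addrACA -opprD -scalerDl subrK scale1r //.
  by rewrite dotDr !dotZr ra rb !mulr0 addr0.
- by left; split=> // h'; exact: disj.
- right; split=> //; first by move=> h'; exact: disj.
  apply: pos; split=> // -[/= E|/= E]; first by apply: nd; rewrite -E.
  by apply: off_ramp; rewrite E.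
Qed.

Lemma stabilized_cells_not_adjacent K K' : K \in I -> K' \in I ->
  K' = Ein K \/ K' = Eout K -> K = Ein K' \/ K = Eout K' -> False.
Proof.
move=> /I_stab/triangular_ramp_triangle[a [b [d [T1 T2 _]]]].
move=> /I_stab/triangular_ramp_triangle[a' [b' [d' [T1' T2' _]]]].
case=> E [] E'.
- by rewrite -E in T1; rewrite -E' in T1'; exact: ramp_triangles_not_adjacent T1 T1'.
- by rewrite -E in T1; rewrite -E' in T2'; exact: ramp_triangles_not_adjacent T1 T2'.
- by rewrite -E in T2; rewrite -E' in T1'; exact: ramp_triangles_not_adjacent T2 T1'.
- by rewrite -E in T2; rewrite -E' in T2'; exact: ramp_triangles_not_adjacent T2 T2'.
Qed.

Lemma stabilized_neighbours K : K \in I -> K != Ein K /\ K != Eout K.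
Proof.
by move=> /I_stab/triangular_ramp_triangle[a [b [d [[_ _ _ [? _] _] [_ _ _ [? _] _] _]]]].
Qed.

(** The integrands of the forms evaluated at [(u, u)], the volume integrals being
    replaced by the boundary integrals given by the divergence theorem. *)
Definition flux_term K x := sg K x * U K x ^+ 2.

Definition outflow_term K x :=
  pos_part (dot beta (outer_normal (Omega D) x)) * U K x * U K x.

Definition upwind_term (P : cell_id D * cell_id D) x :=
  average P.1 P.2 u x * dot beta (jump P.1 P.2 u x)
  + 1 / 2 * `|sg P.1 x| * dot (jump P.1 P.2 u x) (jump P.1 P.2 u x).

Definition extension_term K x :=
  (U (Ein K) x - U K x) * dot beta (jump K (Eout K) u x).

Definition extension_flux_term K x := sg K x * beval (u (Ein K) - u K) x ^+ 2.

Definition stab_term K x := eta beta p dt K *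
  ((extension_term K \_ (face K (Eout K))) x
   + 1 / 2 * (extension_flux_term K \_ (bdry (cell K))) x).

Lemma patch_in (e : set (R * R)) (f : R * R -> R) x : e x -> (f \_ e) x = f x.
Proof. by move=> ex; rewrite patchE mem_set. Qed.

Lemma patch_out (e : set (R * R)) (f : R * R -> R) x : ~ e x -> (f \_ e) x = 0.
Proof. by move=> ex; rewrite patchE memNset. Qed.

Lemma stab_term_out K x : ~ bdry (cell K) x -> stab_term K x = 0.
Proof.
move=> nb; rewrite /stab_term !patch_out ?mulr0 ?addr0 ?mulr0 //.
by move=> [].
Qed.

Lemma dot_jump K K' x : dot beta (jump K K' u x) = U K x * sg K x + U K' x * sg K' x.
Proof. by rewrite /jump dotDr !dotZr. Qed.

Lemma stab_term_flux0 K K' x : K \in I -> regular D x ->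
  (forall K'', bdry (cell K'') x -> K'' = K \/ K'' = K') ->
  normal K' x = - normal K x -> sg K x = 0 -> stab_term K x = 0.
Proof.
move=> KI rx uniq nK' sg0.
have [bx|/stab_term_out//] := pselect (bdry (cell K) x).
rewrite /stab_term (patch_in (extension_flux_term K) bx) /extension_flux_term sg0 mul0r mulr0 addr0.
have [fx|nfx] := pselect (face K (Eout K) x); last by rewrite patch_out // mulr0.
rewrite patch_in // /extension_term dot_jump sg0.
have [_ ne] := stabilized_neighbours KI.
have [E|->] := uniq _ fx.2; first by rewrite E eqxx in ne.
by rewrite nK' dotNr sg0 oppr0 !mulr0 addr0 !mulr0.
Qed.

(** On the inflow face only the boundary term of J1 contributes, at worst with a
    negative sign.  On the outflow face, with [a = u_in - u_K] and
    [b = u_K - u_out], completing the square gives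
    [a b + a^2 / 2 = ((a + b)^2 - b^2) / 2]. *)
Lemma stab_term_ge K K' x : K \in I -> regular D x -> bdry (cell K) x ->
  (forall K'', bdry (cell K'') x -> K'' = K \/ K'' = K') ->
  normal K' x = - normal K x ->
  - (1 / 2 * `|sg K x| * (U K x - U K' x) ^+ 2) <= stab_term K x.
Proof.
move=> KI rx bx uniq nK'.
have [sg0|sgn0] := eqVneq (sg K x) 0.
  by rewrite (stab_term_flux0 KI rx uniq) // sg0 normr0 mulr0 mul0r oppr0.
have [ne1 ne2] := stabilized_neighbours KI.
have /andP[eta0 eta1] := eta_itv K.
have nbr K'' : K != K'' -> face K K'' x -> K'' = K'.
  by move=> ne [_ /uniq[E|]//]; rewrite E eqxx in ne.
have sgK' : sg K' x = - sg K x by rewrite nK' dotNr.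
rewrite /stab_term (patch_in (extension_flux_term K) bx) /extension_flux_term bevalB.
have [[fin nfout]|[fout nfin sgp]] := triangular_faces KI rx bx sgn0.
  rewrite patch_out // add0r (nbr _ ne1 fin).
  set a := (U K x - U K' x) ^+ 2.
  have -> : (U K' x - U K x) ^+ 2 = a by rewrite /a; ring.
  have a0 : 0 <= a by exact: sqr_ge0.
  have h1 : - (`|sg K x| * a) <= sg K x * a.
    by rewrite -mulNr; apply: ler_wpM2r => //; rewrite lerNl -normrN ler_norm.
  have h2 : eta beta p dt K * (`|sg K x| * a) <= `|sg K x| * a.
    by apply: ler_piMl => //; exact: mulr_ge0.
  have h3 : eta beta p dt K * - (`|sg K x| * a) <= eta beta p dt K * (sg K x * a).
    exact: ler_wpM2l.
  lra.
rewrite patch_in // /extension_term dot_jump (nbr _ ne2 fout) sgK' ger0_norm //.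
set a := U (Ein K) x - U K x; set b := U K x - U K' x.
have -> : U K x * sg K x + U K' x * - sg K x = sg K x * b by rewrite /b; ring.
have -> : a * (sg K x * b) + 1 / 2 * (sg K x * a ^+ 2) =
    1 / 2 * (sg K x * (a + b) ^+ 2) - 1 / 2 * (sg K x * b ^+ 2) by field.
have h1 : 0 <= sg K x * (a + b) ^+ 2 by rewrite mulr_ge0 // sqr_ge0.
have h2 : 0 <= sg K x * b ^+ 2 by rewrite mulr_ge0 // sqr_ge0.
have h3 : 0 <= eta beta p dt K * (sg K x * (a + b) ^+ 2) by exact: mulr_ge0.
have h4 : eta beta p dt K * (sg K x * b ^+ 2) <= sg K x * b ^+ 2 by exact: ler_piMl.
lra.
Qed.

(** All pairs of mesh cells are included: those whose common face has zero
    length contribute nothing, by [arc_length0]. *)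
Definition ordered_pair (P : cell_id D * cell_id D) : bool :=
  [&& P.1 \in mesh D, P.2 \in mesh D & (enum_rank P.1 < enum_rank P.2)%N].

Definition energy_density x :=
  - (1 / 2 * \sum_(K in mesh D) (flux_term K \_ (bdry (cell K))) x)
  + \sum_(K in mesh D) (outflow_term K \_ (ext_face K)) x
  + \sum_(P | ordered_pair P) (upwind_term P \_ (face P.1 P.2)) x
  + \sum_(K in I) stab_term K x.

(** The flux terms of both cells and the central flux telescope, leaving the
    upwind dissipation.  It absorbs the stabilization of one of the two cells;
    if both are stabilized, there is no flux through the point. *)
Lemma energy_density_two_cells x K1 K2 : regular D x ->
  K1 \in mesh D -> K2 \in mesh D -> (enum_rank K1 < enum_rank K2)%N ->
  bdry (cell K1) x -> bdry (cell K2) x ->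
  (forall K', bdry (cell K') x -> K' = K1 \/ K' = K2) ->
  ~ bdry (Omega D) x -> normal K2 x = - normal K1 x ->
  dot (normal K1 x) (normal K1 x) = 1 -> 0 <= energy_density x.
Proof.
move=> rx m1 m2 rk b1 b2 uniq nO n2 n11.
have ne : K1 != K2 by apply/eqP => E; rewrite E ltnn in rk.
have sg2 : sg K2 x = - sg K1 x by rewrite n2 dotNr.
rewrite /energy_density.
rewrite (bigD1 K1) //= (bigD1 K2) /=; last by rewrite m2 eq_sym.
rewrite [X in _ + (_ + X)]big1; last first.
  move=> K /andP[/andP[_ k1] k2]; apply: patch_out => /uniq[E|E].
    by rewrite E eqxx in k1.
  by rewrite E eqxx in k2.
rewrite [X in _ + X + _ + _]big1; last first.
  by move=> K _; apply: patch_out => -[_ /nO].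
rewrite (bigD1 (K1, K2)) /=; last by rewrite /ordered_pair m1 m2.
rewrite [X in _ + (_ + X) + _]big1; last first.
  move=> [L1 L2] /andP[/and3P[_ _ /= rkL] neL]; apply: patch_out => -[/= /uniq h1 /uniq h2].
  case: h1 h2 rkL neL => -> [] ->; rewrite ?ltnn ?eqxx //.
  by move=> /ltnW; rewrite leqNgt rk.
rewrite (patch_in _ b1) (patch_in _ b2) patch_in; last by split.
rewrite !addr0 /flux_term /upwind_term /= dot_jump sg2.
have -> : dot (jump K1 K2 u x) (jump K1 K2 u x) = (U K1 x - U K2 x) ^+ 2.
  rewrite /jump n2 scalerN -scalerBl dotZr.
  have -> : dot ((U K1 x - U K2 x) *: normal K1 x) (normal K1 x) =
      (U K1 x - U K2 x) * dot (normal K1 x) (normal K1 x).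
    by rewrite /dot /= /GRing.scale /=; ring.
  by rewrite n11 mulr1 expr2.
have -> : average K1 K2 u x * (U K1 x * sg K1 x + U K2 x * - sg K1 x) =
    1 / 2 * (sg K1 x * U K1 x ^+ 2 + - sg K1 x * U K2 x ^+ 2).
  by rewrite /average; field.
rewrite addrA addNr add0r.
have uniq' K' : bdry (cell K') x -> K' = K2 \/ K' = K1 by move=> /uniq[]; [right|left].
have n1 : normal K1 x = - normal K2 x by rewrite n2 opprK.
have E2 : (U K2 x - U K1 x) ^+ 2 = (U K1 x - U K2 x) ^+ 2 by ring.
suff : - (1 / 2 * `|sg K1 x| * (U K1 x - U K2 x) ^+ 2) <= \sum_(K in I) stab_term K x.
  by move=> h; rewrite -subr_ge0 opprK addrC in h.
have both : K1 \in I -> K2 \in I -> sg K1 x = 0.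
  move=> I1 I2; apply/eqP; apply: contraT => sgn0.
  have [ne11 ne12] := stabilized_neighbours I1.
  have [ne21 ne22] := stabilized_neighbours I2.
  exfalso; apply: (stabilized_cells_not_adjacent I1 I2).
    case: (triangular_faces I1 rx b1 sgn0) => [[[_ /uniq[E|E]] _]|[[_ /uniq[E|E]] _ _]].
    - by rewrite E eqxx in ne11.
    - by left.
    - by rewrite E eqxx in ne12.
    - by right.
  have sgn0' : sg K2 x != 0 by rewrite sg2 oppr_eq0.
  case: (triangular_faces I2 rx b2 sgn0') => [[[_ /uniq'[E|E]] _]|[[_ /uniq'[E|E]] _ _]].
  - by rewrite E eqxx in ne21.
  - by left.
  - by rewrite E eqxx in ne22.
  - by right.
have [I1|I1] := boolP (K1 \in I).
  rewrite (bigD1 K1) //= big1 ?addr0; first exact: stab_term_ge.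
  move=> K /andP[KI kn]; have [|/stab_term_out//] := pselect (bdry (cell K) x).
  move=> /uniq[E|E]; first by rewrite E eqxx in kn.
  subst K; apply: (stab_term_flux0 KI rx uniq') => //.
  by rewrite sg2 (both I1 KI) oppr0.
have [I2|I2] := boolP (K2 \in I).
  rewrite (bigD1 K2) //= big1 ?addr0.
    by rewrite -E2 -normrN -sg2; exact: stab_term_ge.
  move=> K /andP[KI kn]; apply: stab_term_out => /uniq[E|E].
    by rewrite -E KI in I1.
  by rewrite E eqxx in kn.
rewrite big1.
  by rewrite oppr_le0; apply: mulr_ge0 (sqr_ge0 _); rewrite mulr_ge0 // divr_ge0.
move=> K KI; apply: stab_term_out => /uniq[E|E].
  by rewrite -E KI in I1.
by rewrite -E KI in I2.
Qed.

Lemma energy_density_ge0 x : regular D x -> 0 <= energy_density x.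
Proof.
move=> rx; case: (skeletonP rx) => [none|K mK bK uniq bO nO|
    K1 K2 m1 m2 ne b1 b2 uniq nbO n2 n11].
- rewrite /energy_density !big1 ?mulr0 ?oppr0 ?addr0 //.
  + by move=> K _; exact/stab_term_out/none.
  + by move=> P _; apply: patch_out => -[/none].
  + by move=> K _; apply: patch_out => -[/none].
  + by move=> K _; exact/patch_out/none.
- have out K' : K' != K -> ~ bdry (cell K') x by move=> /eqP nK /uniq.
  rewrite /energy_density (bigD1 K) //= big1; last first.
    by move=> K' /andP[_ /out h]; exact: patch_out.
  rewrite (bigD1 K) //= [X in _ + (_ + X)]big1; last first.
    by move=> K' /andP[_ /out h]; apply: patch_out => -[].
  rewrite [X in _ + X + _]big1; last first.
    move=> [L1 L2] /and3P[_ _ /= rk]; apply: patch_out => -[/= /uniq E1 /uniq E2].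
    by rewrite E1 E2 ltnn in rk.
  rewrite [X in _ + X]big1; last first.
    move=> K' K'I; have [bK'|/stab_term_out//] := pselect (bdry (cell K') x).
    have E := uniq _ bK'; subst K'.
    have [ne1 ne2] := stabilized_neighbours K'I.
    rewrite /stab_term patch_out ?add0r; last first.
      by move=> [_ /uniq E]; rewrite E eqxx in ne2.
    rewrite (patch_in (extension_flux_term K) bK) /extension_flux_term.
    have [->|sgn0] := eqVneq (sg K x) 0; first by rewrite mul0r !mulr0.
    case: (triangular_faces K'I rx bK sgn0) => [[[_ /uniq E] _]|[[_ /uniq E] _ _]].
      by rewrite E eqxx in ne1.
    by rewrite E eqxx in ne2.
  rewrite (patch_in _ bK) patch_in; last by split.
  rewrite !addr0 /flux_term /outflow_term nO /pos_part.
  have -> : - (1 / 2 * (sg K x * U K x ^+ 2)) +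
      (`|sg K x| + sg K x) / 2 * U K x * U K x = 1 / 2 * `|sg K x| * U K x ^+ 2.
    by field.
  by apply: mulr_ge0 (sqr_ge0 _); rewrite mulr_ge0 // divr_ge0.
- have [rk|rk|/val_inj/enum_rank_inj E] := ltngtP (enum_rank K1) (enum_rank K2).
  + exact: (energy_density_two_cells rx m1 m2).
  + apply: (energy_density_two_cells rx m2 m1 rk b2 b1) => //.
    * by move=> K' /uniq[]; [right|left].
    * by rewrite n2 opprK.
    * by move: n11; rewrite n2 /dot /= !mulrNN.
  + by rewrite E eqxx in ne.
Qed.

Let closed_face K1 K2 : closed (face K1 K2).
Proof. by apply: closedI; exact: closed_bdry. Qed.

Let closed_ext_face K : closed (ext_face K).
Proof. by apply: closedI; exact: closed_bdry. Qed.

Lemma tame_jump e K1 K2 : e `<=` bdry (cell K1) -> e `<=` bdry (cell K2) ->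
  tame D e (fun x => (jump K1 K2 u x).1) /\ tame D e (fun x => (jump K1 K2 u x).2).
Proof.
move=> /tame_normal[t1 t2] /tame_normal[t3 t4].
by split; apply: tameD; apply: tameM => //; exact: tame_beval.
Qed.

Lemma tame_dot_jump e K1 K2 : e `<=` bdry (cell K1) -> e `<=` bdry (cell K2) ->
  tame D e (fun x => dot beta (jump K1 K2 u x)).
Proof.
move=> e1 e2; have [t1 t2] := tame_jump e1 e2.
by apply: tameD; apply: tameM => //; exact: tame_cst.
Qed.

Lemma tame_flux_term K : tame D (bdry (cell K)) (flux_term K).
Proof.
by apply: tameM; [exact: tame_flux|apply: tameM; exact: tame_beval].
Qed.

(** On the boundary of a cell the outer normal of Omega is that of the cell. *)
Lemma tame_outflow_term K : tame D (ext_face K) (outflow_term K).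
Proof.
apply: tameM; last exact: tame_beval.
apply: tameM; last exact: tame_beval.
have eK : ext_face K `<=` bdry (cell K) by exact: subIsetl.
apply: (@eq_tame _ _ _ (fun x => pos_part (sg K x))).
  move=> x rx [bK bO]; case: (skeletonP rx) => [none|K' _ _ uniq _ ->|
      K1 K2 _ _ _ _ _ _ /(_ bO)//].
    by case: (none _ bK).
  by rewrite (uniq _ bK).
apply: tameM; last exact: tame_cst.
by apply: tameD; [apply: tame_norm|]; exact: tame_flux.
Qed.

Lemma tame_upwind_term P : tame D (face P.1 P.2) (upwind_term P).
Proof.
have e1 : face P.1 P.2 `<=` bdry (cell P.1) by exact: subIsetl.
have e2 : face P.1 P.2 `<=` bdry (cell P.2) by exact: subIsetr.
have [t1 t2] := tame_jump e1 e2.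
apply: tameD; apply: tameM.
- by apply: tameM; [apply: tameD; exact: tame_beval|exact: tame_cst].
- exact: tame_dot_jump.
- by apply: tameM; [exact: tame_cst|apply: tame_norm; exact: tame_flux].
- by apply: tameD; exact: tameM.
Qed.

Lemma tame_extension_term K : tame D (face K (Eout K)) (extension_term K).
Proof.
apply: tameM; last by apply: tame_dot_jump; [exact: subIsetl|exact: subIsetr].
by apply: tameD; [|apply: tameN]; exact: tame_beval.
Qed.

Lemma tame_extension_flux_term K : tame D (bdry (cell K)) (extension_flux_term K).
Proof.
by apply: tameM; [exact: tame_flux|apply: tameM; exact: tame_beval].
Qed.

Lemma energyE : skeleton_integrable D energy_density /\
  a_upw beta u u + J_h beta p dt I Ein Eout u u = skeleton_int D energy_density.
Proof.
have i1 K : skeleton_integrable D (flux_term K \_ (bdry (cell K))).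
  by apply: (@skeleton_integrable_cell _ _ K); [exact: closed_bdry|done|exact: tame_flux_term].
have i2 K : skeleton_integrable D (outflow_term K \_ (ext_face K)).
  by apply: (@skeleton_integrable_cell _ _ K); [exact: closed_ext_face|exact: subIsetl|
    exact: tame_outflow_term].
have i3 P : skeleton_integrable D (upwind_term P \_ (face P.1 P.2)).
  by apply: (@skeleton_integrable_cell _ _ P.1); [exact: closed_face|exact: subIsetl|
    exact: tame_upwind_term].
have i4 K : skeleton_integrable D (extension_term K \_ (face K (Eout K))).
  by apply: (@skeleton_integrable_cell _ _ K); [exact: closed_face|exact: subIsetl|
    exact: tame_extension_term].
have i5 K : skeleton_integrable D (extension_flux_term K \_ (bdry (cell K))).
  by apply: (@skeleton_integrable_cell _ _ K); [exact: closed_bdry|done|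
    exact: tame_extension_flux_term].
have i5' K : skeleton_integrable D
    (fun x => 1 / 2 * (extension_flux_term K \_ (bdry (cell K))) x).
  exact: skeleton_integrableZ.
have i45 K := skeleton_integrableD (i4 K) (i5' K).
have i6 K : skeleton_integrable D (stab_term K) by exact: skeleton_integrableZ.
have s1 : skeleton_integrable D
    (fun x => \sum_(K in mesh D) (flux_term K \_ (bdry (cell K))) x).
  exact: skeleton_integrable_sum.
have s2 : skeleton_integrable D
    (fun x => \sum_(K in mesh D) (outflow_term K \_ (ext_face K)) x).
  exact: skeleton_integrable_sum.
have s3 : skeleton_integrable D
    (fun x => \sum_(P | ordered_pair P) (upwind_term P \_ (face P.1 P.2)) x).
  exact: skeleton_integrable_sum.
have s4 : skeleton_integrable D (fun x => \sum_(K in I) stab_term K x).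
  exact: skeleton_integrable_sum.
have s1' := skeleton_integrableZ (- (1 / 2)) s1.
have -> : energy_density = fun x =>
    - (1 / 2) * (\sum_(K in mesh D) (flux_term K \_ (bdry (cell K))) x)
    + \sum_(K in mesh D) (outflow_term K \_ (ext_face K)) x
    + \sum_(P | ordered_pair P) (upwind_term P \_ (face P.1 P.2)) x
    + \sum_(K in I) stab_term K x.
  by apply/funext => x; rewrite /energy_density mulNr.
have s12 := skeleton_integrableD s1' s2; have s123 := skeleton_integrableD s12 s3.
split; first exact: skeleton_integrableD s123 s4.
rewrite (skeleton_intD s123 s4) (skeleton_intD s12 s3) (skeleton_intD s1' s2).
rewrite (skeleton_intZ _ s1) !skeleton_int_sum //.
rewrite /a_upw /J_h; congr (_ + _ + _ + _).
- rewrite mulNr mulr_sumr; congr (- _); apply: eq_bigr => K _.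
  by rewrite (cell_divergence_sqr beta_ramp) arc_intE.
- rewrite [RHS](bigID (fun K => 0 < arc_length D (ext_face K))) /=.
  rewrite [X in _ + X]big1 ?addr0; last first.
    move=> K /andP[_ al]; rewrite -arc_intE.
    by apply: arc_length0 (tame_outflow_term K) al; [exact: closed_ext_face|exact: subIsetl].
  by apply: eq_big => [K|K _]; [rewrite !inE|rewrite arc_intE].
- rewrite [RHS](bigID (fun P => 0 < arc_length D (face P.1 P.2))) /=.
  rewrite [X in _ + X]big1 ?addr0; last first.
    move=> P /andP[_ al]; rewrite -arc_intE.
    by apply: arc_length0 (tame_upwind_term P) al; [exact: closed_face|exact: subIsetl].
  apply: eq_big => [P|P _]; last by rewrite arc_intE.
  rewrite inE /is_int_face /ordered_pair; case: (_ \in _) => //=; case: (_ \in _) => //=.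
  have [->|] := eqVneq P.1 P.2; first by rewrite ltnn.
  by rewrite andbC.
- apply: eq_bigr => K _; rewrite (skeleton_intZ _ (i45 K)) (skeleton_intD (i4 K) (i5' K)).
  rewrite (skeleton_intZ _ (i5 K)) -!arc_intE mulrDr; congr (_ + _ * _).
  rewrite -(cell_divergence_sqr beta_ramp); apply: eq_Rintegral => x _.
  by rewrite bevalB dot_bgradB.
Qed.

Theorem energy_ge0 : 0 <= a_upw beta u u + J_h beta p dt I Ein Eout u u.
Proof.
have [int ->] := energyE.
by apply: skeleton_int_ge0 int _; exact: energy_density_ge0.
Qed.

End Energy.

(** * The L2 inner product in coefficients, and the stability estimate *)

Section L2Coefficients.
Context {R : realType} (D : ramp_geometry R) (p : nat).
Implicit Types (u w v : broken_poly D).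

(** A broken polynomial of degree at most p is a combination of finitely many
    fixed functions, indexed by a cell and the two exponents of a monomial. *)
Definition dof : finType := (cell_id D * ('I_p.+1 * 'I_p.+1))%type.

Definition coef v (J : dof) : R := (v J.1)`_(J.2.1)`_(J.2.2).

Definition basis_fun (J : dof) (x : R * R) : R :=
  \1_(interior (cell J.1)) x * (x.1 ^+ J.2.1 * x.2 ^+ J.2.2).

Definition mass (J J' : dof) : R :=
  \int[area_measure]_(x in Omega D) (basis_fun J x * basis_fun J' x).

Lemma broken_funE v x : Vh p v -> broken_fun v x =
  \sum_(J : dof | J.1 \in mesh D) coef v J * basis_fun J x.
Proof.
move=> Vv; rewrite /broken_fun.
transitivity (\sum_(K in mesh D) \sum_(ij : 'I_p.+1 * 'I_p.+1)
    coef v (K, ij) * basis_fun (K, ij) x).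
  apply: eq_bigr => K KM; rewrite (beval_coef _ (Vv K KM)) pair_bigA mulr_sumr /=.
  by apply: eq_bigr => ij _; rewrite /coef /basis_fun /=; ring.
rewrite pair_big_dep /=; apply: eq_big => [J|[K ij] _ //]; exact: andbT.
Qed.

Lemma measurable_open_cut_rectangle (a b c d x0 y0 C S : R) :
  measurable (open_cut_rectangle a b c d x0 y0 C S :
    set (measurableTypeR R * measurableTypeR R)).
Proof.
have -> : open_cut_rectangle a b c d x0 y0 C S = (`]a, b[ `*` `]c, d[) `&`
    (fun x => (x.1 - x0) * S - (x.2 - y0) * C) @^-1` `]-oo, 0[.
  by apply/seteqP; split=> x /=; rewrite !in_itv /= subr_lt0.
apply: measurableI; first by apply: measurableX; exact: measurable_itv.
have mline : measurable_fun [set: measurableTypeR R * measurableTypeR R]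
    (fun x => (x.1 - x0) * S - (x.2 - y0) * C).
  by apply: measurable_funB; apply: measurable_funM => //; apply: measurable_funB.
by rewrite -[X in measurable X]setTI; apply: mline => //; exact: measurable_itv.
Qed.

Lemma measurable_Omega :
  measurable (Omega D : set (measurableTypeR R * measurableTypeR R)).
Proof. exact: measurable_open_cut_rectangle. Qed.

Lemma integrable_basis_fun J J' : (@area_measure R).-integrable (Omega D)
  (EFin \o (fun x => basis_fun J x * basis_fun J' x)).
Proof.
pose q : {poly {poly R}} := ('X^(J.2.2 + J'.2.2))%:P * 'X^(J.2.1 + J'.2.1).
pose E := interior (cell J.1) `&` interior (cell J'.1).
have mE : measurable (E : set (measurableTypeR R * measurableTypeR R)).
  by rewrite /E !interior_cell; apply: measurableI; exact: measurable_open_cut_rectangle.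
have -> : (fun x => basis_fun J x * basis_fun J' x) = beval q \_ E.
  apply/funext => x; rewrite patchE /basis_fun mulrACA.
  rewrite -[\1__ x * \1__ x]/((\1_(interior (cell J.1)) \* \1_(interior (cell J'.1))) x) -indicI.
  have -> : x.1 ^+ J.2.1 * x.2 ^+ J.2.2 * (x.1 ^+ J'.2.1 * x.2 ^+ J'.2.2) = beval q x.
    by rewrite /q bevalM /beval hornerC !hornerXn -polyC_exp hornerC !exprD; ring.
  rewrite indicE; case: (_ \in _); rewrite ?mul1r ?mul0r //.
rewrite -restrict_EFin; apply/(@integrable_restrict _ _ _ _ _ mE (Omega D) measurable_Omega).
have := integrable_cut_rectangle (foot D) (gy D 0%N) (cos (angle D)) (sin (angle D))
  (gx_lt_end D) (gy_lt_end D) q.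
apply: integrableS; [exact: measurable_cut_rectangle| |].
  by apply: measurableI => //; exact: measurable_Omega.
by move=> x [/Omega_sub_rect].
Qed.

Lemma L2_innerE u w : Vh p u -> Vh p w -> L2_inner u w =
  \sum_(J : dof | J.1 \in mesh D) \sum_(J' : dof | J'.1 \in mesh D)
    coef u J * coef w J' * mass J J'.
Proof.
move=> Vu Vw; rewrite /L2_inner.
have iZ J J' : (@area_measure R).-integrable (Omega D)
    (EFin \o (fun x => coef u J * coef w J' * (basis_fun J x * basis_fun J' x))).
  have := integrableZl measurable_Omega (coef u J * coef w J') (integrable_basis_fun J J').
  by apply: eq_integrable; first exact: measurable_Omega.
have sumE (A : finType) (P : pred A) (F : A -> R * R -> R) :
    (forall a, (@area_measure R).-integrable (Omega D) (EFin \o F a)) ->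
    (@area_measure R).-integrable (Omega D) (EFin \o (fun x => \sum_(a | P a) F a x)) /\
    \int[area_measure]_(x in Omega D) (\sum_(a | P a) F a x) =
    \sum_(a | P a) \int[area_measure]_(x in Omega D) F a x.
  move=> iF; elim: (index_enum A) => [|a s [IH1 IH2]].
    split; last by under eq_Rintegral do rewrite big_nil;
      rewrite big_nil Rintegral_cst ?mul0r //; exact: measurable_Omega.
    by under eq_fun do rewrite big_nil; exact: integrable0.
  have [Pa|nPa] := boolP (P a); last first.
    rewrite big_cons (negPf nPa); split.
      by under eq_fun do rewrite big_cons (negPf nPa).
    by under eq_Rintegral do rewrite big_cons (negPf nPa).
  rewrite big_cons Pa; split.
    under eq_fun do rewrite big_cons Pa.
    have := integrableD measurable_Omega (iF a) IH1.
    by apply: eq_integrable; first exact: measurable_Omega.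
  under eq_Rintegral do rewrite big_cons Pa.
  by rewrite RintegralD ?IH2 //; exact: measurable_Omega.
transitivity (\int[area_measure]_(x in Omega D)
   \sum_(J : dof | J.1 \in mesh D) \sum_(J' : dof | J'.1 \in mesh D)
     coef u J * coef w J' * (basis_fun J x * basis_fun J' x)).
  apply: eq_Rintegral => x _; rewrite (broken_funE _ Vu) (broken_funE _ Vw).
  rewrite mulr_suml; apply: eq_bigr => J _; rewrite mulr_sumr.
  by apply: eq_bigr => J' _; ring.
rewrite (sumE _ _ _ _).2; last by move=> J; exact: (sumE _ _ _ (iZ J)).1.
apply: eq_bigr => J _; rewrite (sumE _ _ _ (iZ J)).2; apply: eq_bigr => J' _.
by rewrite RintegralZl //; [exact: measurable_Omega|exact: integrable_basis_fun].
Qed.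

Lemma L2_innerC u w : L2_inner u w = L2_inner w u.
Proof. by apply: eq_Rintegral => x _; rewrite mulrC. Qed.

Lemma cvg_sum (F : set_system R) (FF : Filter F) (A : Type) (s : seq A) (P : pred A)
    (f : A -> R -> R) (l : A -> R) : (forall a, P a -> f a @ F --> l a) ->
  (fun t => \sum_(a <- s | P a) f a t) @ F --> \sum_(a <- s | P a) l a.
Proof.
move=> fl; elim: s => [|a s IH].
  by under eq_fun do rewrite big_nil; rewrite big_nil; exact: cvg_cst.
rewrite big_cons; under eq_fun do rewrite big_cons.
by case: (boolP (P a)) => [Pa|_]; [apply: cvgD; [exact: fl|exact: IH]|exact: IH].
Qed.

Lemma is_derive_big (t : R) (A : Type) (s : seq A) (P : pred A)
    (f : A -> R -> R) (l : A -> R) :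
  (forall a, P a -> is_derive t (1 : R) (f a) (l a)) ->
  is_derive t (1 : R) (fun t => \sum_(a <- s | P a) f a t) (\sum_(a <- s | P a) l a).
Proof.
move=> fl; elim: s => [|a s IH].
  by under eq_fun do rewrite big_nil; rewrite big_nil; exact: is_derive_cst.
rewrite big_cons; under eq_fun do rewrite big_cons.
case: (boolP (P a)) => [Pa|_]; last exact: IH.
by have := is_deriveD (fl a Pa) IH.
Qed.

(** The product rule, the inner product being a symmetric bilinear form with
    constant coefficients [mass] in the polynomial coefficients. *)
Lemma is_derive_L2_inner (t : R) (v : R -> broken_poly D) (dv : broken_poly D) :
  (\forall s \near t, Vh p (v s)) -> Vh p dv ->
  (forall K i j, K \in mesh D ->
    is_derive t (1 : R) (fun s => (v s K)`_i`_j) ((dv K)`_i`_j)) ->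
  is_derive t (1 : R) (fun s => L2_inner (v s) (v s)) (2 * L2_inner dv (v t)).
Proof.
move=> Vv Vdv dvE; have Vt : Vh p (v t) by exact: nbhs_singleton Vv.
pose Q s := \sum_(J : dof | J.1 \in mesh D) \sum_(J' : dof | J'.1 \in mesh D)
    coef (v s) J * coef (v s) J' * mass J J'.
have QE : {near t, (fun s => L2_inner (v s) (v s)) =1 Q}.
  by apply: filterS Vv => s Vs; exact: L2_innerE.
have -> : 2 * L2_inner dv (v t) =
    \sum_(J : dof | J.1 \in mesh D) \sum_(J' : dof | J'.1 \in mesh D)
      (coef dv J * coef (v t) J' + coef (v t) J * coef dv J') * mass J J'.
  rewrite mulr2n mulrDl mul1r {2}L2_innerC !L2_innerE // -big_split /=.
  apply: eq_bigr => J _; rewrite -big_split /=; apply: eq_bigr => J' _; ring.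
apply: (near_eq_is_derive (f := Q)) => //.
  by apply: filterS Vv => s Vs; rewrite /Q -L2_innerE.
apply: (@is_derive_big t _ _ _ (fun J s => \sum_(J' : dof | J'.1 \in mesh D)
    coef (v s) J * coef (v s) J' * mass J J')) => J KJ.
apply: (@is_derive_big t _ _ _ (fun J' s => coef (v s) J * coef (v s) J' * mass J J')) => J' KJ'.
have d1 := dvE J.1 J.2.1 J.2.2 KJ; have d2 := dvE J'.1 J'.2.1 J'.2.2 KJ'.
have d3 := is_deriveM (is_deriveM d1 d2) (is_derive_cst (mass J J') t (1 : R)).
apply: (trigger_derive d3).
rewrite /coef /= /GRing.scale /=; ring.
Qed.

(** Coefficients of too high degree vanish on an interval around each time. *)
Lemma Vh_derive (T : R) (v dv : R -> broken_poly D) :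
  (forall s : R, 0 <= s < T -> Vh p (v s)) ->
  (forall (s : R) K i j, 0 < s < T -> K \in mesh D ->
    is_derive s (1 : R) (fun s => (v s K)`_i`_j) ((dv s K)`_i`_j)) ->
  forall s, 0 < s < T -> Vh p (dv s).
Proof.
move=> Vv dvE s sT K KM i j pij.
have [_ <-] := dvE s K i j sT KM.
transitivity ('D_1 (fun=> 0 : R) s); last exact: derive_cst.
apply: near_eq_derive.
have /andP[s0 st] := sT.
near=> r; apply: Vv => //; apply/andP; split.
  by apply: ltW; near: r; exact: lt_nbhsr.
by near: r; exact: lt_nbhsl.
Unshelve. all: by end_near.
Qed.

Lemma cvg_L2_inner (T : R) (v : R -> broken_poly D) : 0 < T ->
  (forall s : R, 0 <= s < T -> Vh p (v s)) ->
  (forall K i j, K \in mesh D ->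
    (fun s => (v s K)`_i`_j) @ 0^'+ --> (v 0 K)`_i`_j) ->
  L2_inner (v s) (v s) @[s --> 0^'+] --> L2_inner (v 0) (v 0).
Proof.
move=> T0 Vv v0.
rewrite L2_innerE; [|by apply: Vv; rewrite lexx..].
pose Q s := \sum_(J : dof | J.1 \in mesh D) \sum_(J' : dof | J'.1 \in mesh D)
    coef (v s) J * coef (v s) J' * mass J J'.
have QE : {near 0^'+, Q =1 (fun s => L2_inner (v s) (v s))}.
  near=> s; have Vs : Vh p (v s).
    by apply: Vv; apply/andP; split; near: s; [exact: nbhs_right_ge|exact: nbhs_right_lt].
  by rewrite /Q -L2_innerE.
apply: (cvg_trans (near_eq_cvg QE)).
apply: cvg_sum => J KJ; apply: cvg_sum => J' KJ'.
apply: cvgM; last exact: cvg_cst.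
by apply: cvgM; exact: v0.
Unshelve. all: by end_near.
Qed.

End L2Coefficients.

Lemma le_initial_value (R : realType) (f : R -> R) (t : R) : 0 < t ->
  f s @[s --> 0^'+] --> f 0 ->
  (forall s, 0 < s <= t -> derivable f s 1 /\ derive1 f s <= 0) ->
  f t <= f 0.
Proof.
move=> t0 f0 df.
have cf s : 0 < s <= t -> {for s, continuous f}.
  by move=> /df[ds _]; exact/differentiable_continuous/derivable1_diffP.
apply: (@ler0_derive1_le_cc _ f 0 t); rewrite ?in_itv /= ?lexx ?(ltW t0) //.
- by move=> s; rewrite in_itv => /andP[/= s0 st]; apply: (df s _).1; rewrite s0 ltW.
- by move=> s; rewrite in_itv => /andP[/= s0 st]; apply: (df s _).2; rewrite s0 ltW.
- apply/(continuous_within_itvP _ t0); split => //.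
    by move=> s; rewrite in_itv /= => /andP[s0 st]; apply: cf; rewrite s0 ltW.
  by apply: cvg_at_left_filter; apply: cf; rewrite t0 lexx.
Qed.

(** Where the inflow weight is nonzero, g is the trace of the exact solution,
    whose support avoids the inflow boundary. *)
Lemma inflow_data_vanish (R : realType) (D : ramp_geometry R) (beta : R * R)
    (ut gt : R * R -> R) :
  (forall x, inflow_boundary D beta x -> ut x = gt x) ->
  support_in_closure D ut `&`
    (inflow_boundary D beta `|` outflow_boundary D beta) = set0 ->
  forall w : broken_poly D, l_h beta gt w = 0.
Proof.
move=> ug disj w; rewrite /l_h big1 ?oppr0 // => K _.
rewrite /arc_int big1 // => l _.
rewrite (@eq_Rintegral _ _ _ _ _ (fun=> 0)); first by rewrite /Rintegral integral0.
move=> s; rewrite inE /= => -[_ bO].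
set x := l.1 + s *: l.2 in bO *.
have [neg|pos] := ltP (dot beta (outer_normal (Omega D) x)) 0; last first.
  by rewrite /neg_part ger0_norm // subrr !mul0r.
have inx : inflow_boundary D beta x by split.
have [u0|un0] := eqVneq (ut x) 0; first by rewrite -ug // u0 mulr0 mul0r.
have : set0 x.
  rewrite -disj; split; last by left.
  by apply: subset_closure; split=> //; case: bO.
by [].
Qed.

Theorem theorem1 (R : realType) (p : nat) (D : ramp_geometry R)
  (beta : R * R) (beta_neq0 : beta != 0)
  (beta_parallel : exists c : R, beta = c *: ramp_dir D)
  (T : R) (T_gt0 : 0 < T)
  (g : R -> R * R -> R) (u0 : R * R -> R) (u : R -> R * R -> R)
  (u_sol : advection_solution D beta T g u0 u)
  (u_supp : forall t : R, 0 < t < T ->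
     compact (support_in_closure D (u t)) /\
     support_in_closure D (u t) `<=` Omega_hat D)
  (u_supp_bdry : forall t : R, 0 < t < T ->
     support_in_closure D (u t) `&`
       (inflow_boundary D beta `|` outflow_boundary D beta) = set0)
  (dt : R) (dt_gt0 : 0 < dt)
  (I : {set cell_id D}) (Ein Eout : cell_id D -> cell_id D)
  (I_stab : forall K, K \in I -> triangular_cut_cell beta K (Ein K) (Eout K))
  (uh duh : R -> broken_poly D)
  (uh_sol : semidiscrete_solution beta p dt T I Ein Eout g uh duh) :
  forall t : R, 0 < t < T -> L2_norm (uh t) <= L2_norm (uh 0).
Proof.
case: beta_parallel => c beta_ramp; case: uh_sol => Vuh uh0 duhE scheme t /andP[t0 tT].
have Vduh := Vh_derive Vuh duhE.
apply: ler_wsqrtr.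
apply: (@le_initial_value _ (fun s => L2_inner (uh s) (uh s))) => //.
  exact: (cvg_L2_inner T_gt0 Vuh).
move=> s /andP[s0 st]; have sT : 0 < s < T by rewrite s0 (le_lt_trans st tT).
have near_Vh : \forall r \near s, Vh p (uh r).
  near=> r; apply: Vuh; apply/andP; split.
    by apply: ltW; near: r; exact: lt_nbhsr.
  by near: r; apply: lt_nbhsl; case/andP: sT.
have dL2 := is_derive_L2_inner near_Vh (Vduh s sT) (fun K i j => duhE s K i j sT).
split; first exact: ex_derive.
rewrite derive1E derive_val pmulr_rle0 //.
have Vs : Vh p (uh s) by apply: Vuh; rewrite (ltW s0); case/andP: sT.
have [_ ug _] := u_sol.
have := scheme s (uh s) sT Vs.
rewrite (inflow_data_vanish (fun x => ug s x sT) (u_supp_bdry s sT)) addr0 -addrA.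
move=> /eqP; rewrite addr_eq0 => /eqP ->; rewrite oppr_le0.
exact: (energy_ge0 beta_ramp).
Unshelve. all: by end_near.
Qed.
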